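(* Let $V$ be an $n$-dimensional complex vector space and let $\mathcal{A}$ be a central hyperplane arrangement in $V$ consisting of $d$ hyperplanes. Let $D_{\mathcal{A}}=\sum_{H\in\mathcal{A}}H$. Then the Hilbert series of the multiplier ideal $I=\mathcal{I}\big((1-\epsilon)D_{\mathcal{A}}\big)$, with $0<\epsilon\ll 1$, is given by $$H_I(t)=\frac{t^{d}}{(1-t)^n}\cdot\pi(\mathcal{A},t^{-1}-1),$$ where $\pi(\mathcal{A},x)$ is the Poincaré polynomial of $\mathcal{A}$.
   Context: A central hyperplane arrangement $\mathcal{A}$ in $V$ is a (finite) collection of distinct linear hyperplanes of $V$ (all passing through the origin). The intersection lattice $L(\mathcal{A})$ is the set of all intersections of hyperplanes in $\mathcal{A}$ (including $V$, the empty intersection), ordered by reverse inclusion, so $V$ is its unique minimal element. The Möbius function $\mu\colon L(\mathcal{A})\times L(\mathcal{A})\to\mathbf{Z}$ is characterized by: $\mu(W,W)=1$ for all $W$; $\sum_{W_1\leq Z\leq W_2}\mu(W_1,Z)=0$ if $W_1<W_2$; $\mu(W_1,W_2)=0$ if $W_1\not\leq W_2$. Put $\mu(W):=\mu(V,W)$. The Poincaré polynomial is $$\pi(\mathcal{A},x)=\sum_{W\in L(\mathcal{A})}\mu(W)(-x)^{\mathrm{codim}(W,V)}\in\mathbf{Z}[x].$$ For a rational number $c>0$, $\mathcal{I}(cD_{\mathcal{A}})$ denotes the usual multiplier ideal of the $\mathbf{Q}$-divisor $cD_{\mathcal{A}}$; the ideal $\mathcal{I}((1-\epsilon)D_{\mathcal{A}})$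 is independent of $\epsilon$ for $\epsilon>0$ sufficiently small. Identify $V$ with affine space $\mathbf{A}^n$ with coordinate ring $S=\mathbf{C}[x_1,\ldots,x_n]$, with the standard grading $\deg x_i=1$. Since $D_{\mathcal{A}}$ is invariant under scaling by $\mathbf{C}^*$, $I$ corresponds to a homogeneous ideal $\bigoplus_j I_j$ of $S$, and $H_I(t)=\sum_{j}\dim_{\mathbf{C}}(I_j)t^j$. *)

(* Defs.v *)
From HB Require Import structures.
From mathcomp Require Import all_boot all_order all_algebra.
From mathcomp Require Import all_classical all_reals all_analysis.
From mathcomp Require Import complex.
From mathcomp Require Import(canonicals, coercions) mpoly.

Set Implicit Arguments.
Unset Strict Implicit.
Unset Printing Implicit Defensive.

Import Order.TTheory GRing.Theory Num.Theory.
Import numFieldNormedType.Exports.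

Local Open Scope classical_set_scope.
Local Open Scope ring_scope.

(** [m1 \x m2] repackaged, because the canonical sigma-finite structure on the
    library's [\x] is only inferred for subprobabilities. *)
Section prod_measure.
Context (d1 d2 : measure_display) (T1 : measurableType d1)
  (T2 : measurableType d2) (R : realType).
Variables (m1 : {sigma_finite_measure set T1 -> \bar R})
  (m2 : {sigma_finite_measure set T2 -> \bar R}).

Definition prod_measure : set (T1 * T2) -> \bar R := (m1 \x m2)%E.

HB.instance Definition _ := Measure.copy prod_measure (m1 \x m2)%E.

Lemma prod_measure_sigma_finite : sigma_finite setT prod_measure.
Proof.
have /sigma_finiteP[F [TF ndF Foo]] := sigma_finiteT m1.
have /sigma_finiteP[G [TG ndG Goo]] := sigma_finiteT m2.
exists (fun n => F n `*` G n) => [|k].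
  rewrite -setXTT TF TG predeqE => -[x y]; split.
    move=> [/= [n _ Fnx] [k _ Gky]]; exists (maxn n k) => //; split.
    - by move: x Fnx; exact/subsetPset/ndF/leq_maxl.
    - by move: y Gky; exact/subsetPset/ndG/leq_maxr.
  by move=> [n _ []/= ? ?]; split; exists n.
have [? ?] := Foo k; have [? ?] := Goo k.
split; first exact: measurableX.
by rewrite /prod_measure product_measure1E// lte_mul_pinfty// ge0_fin_numE.
Qed.

HB.instance Definition _ := Measure_isSigmaFinite.Build _ _ _
  prod_measure prod_measure_sigma_finite.

End prod_measure.

(** The [n]-fold power of a sigma-finite measure, on [n.-tuple T] with its
    product sigma-algebra. *)
Section power_measure.
Context (d : measure_display) (T : measurableType d) (R : realType).
Variable mu : {sigma_finite_measure set T -> \bar R}.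

Definition tuple_cons n (p : T * n.-tuple T) : n.+1.-tuple T :=
  [tuple of p.1 :: p.2].

Lemma measurable_tuple_cons n : measurable_fun setT (@tuple_cons n).
Proof. exact: measurable_cons. Qed.

Section step.
Variables (n : nat) (nu : {sigma_finite_measure set (n.-tuple T) -> \bar R}).

Definition power_measureS : set (n.+1.-tuple T) -> \bar R :=
  pushforward (prod_measure mu nu) (@tuple_cons n).

HB.instance Definition _ := Measure.copy power_measureS
  (measure_function_pushforward__canonical__measure_function_Measure
    (prod_measure mu nu) (@measurable_tuple_cons n)).

Lemma power_measureS_sigma_finite : sigma_finite setT power_measureS.
Proof.
have [F FT Ffin] := sigma_finiteT (prod_measure mu nu).
pose u (z : n.+1.-tuple T) := (thead z, [tuple of behead z]).
have uK : cancel (@tuple_cons n) u.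
  by case=> x t; congr pair; apply: val_inj.
have mu_ : measurable_fun setT u.
  apply/measurable_fun_pair => /=; first exact: measurable_tnth.
  exact: measurable_behead.
exists (fun k => u @^-1` F k) => [|k].
  by rewrite -preimage_bigcup -FT preimage_setT.
have [mF Fk] := Ffin k; split.
  by rewrite -[X in measurable X]setTI; exact: mu_.
rewrite /power_measureS /pushforward -comp_preimage.
by rewrite (_ : u \o _ = id) //; apply/funext => p /=; rewrite uK.
Qed.

HB.instance Definition _ := Measure_isSigmaFinite.Build _ _ _
  power_measureS power_measureS_sigma_finite.

End step.

Fixpoint power_measure n : {sigma_finite_measure set (n.-tuple T) -> \bar R} :=
  if n is k.+1 then power_measureS (power_measure k)
  else \d_([tuple] : 0.-tuple T).

Lemma power_measure_box n (A : 'I_n -> set T) :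
  (forall i, measurable (A i)) ->
  power_measure n [set z | forall i, A i (tnth z i)]
  = (\prod_(i < n) mu (A i))%E.
Proof.
elim: n A => [|n IHn] A mA.
  rewrite big_ord0 /= diracE mem_set //; by case.
rewrite big_ord_recl -(IHn (fun i => A (lift ord0 i))) //=.
rewrite /power_measureS /pushforward -product_measure1E //; last first.
  rewrite (_ : [set _ | _] = \bigcap_(i in [set: 'I_n])
     ((fun z => tnth z i) @^-1` A (lift ord0 i))).
    apply: fin_bigcap_measurable => [|i _]; first exact: finite_finset.
    rewrite -[X in measurable X]setTI.
    exact: measurable_tnth.
  by apply/seteqP; split => z /= zA => [i _|i]; apply: zA.
congr (_ _); apply/seteqP; split => -[x t] /=.
  move=> H; split; first exact: (H ord0).
  by move=> i; have := H (lift ord0 i); rewrite tnthS.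
move=> [xA tA] i; case: (unliftP ord0 i) => [j|] ->; last by [].
by rewrite tnthS.
Qed.

End power_measure.

(* A point of [C^n] is a tuple of pairs (real part, imaginary part). *)
Notation cspace R n :=
  (n.-tuple (measurableTypeR R * measurableTypeR R)%type) (only parsing).

Definition ccoord (R : realType) n (z : cspace R n) (i : 'I_n) : R[i] :=
  Complex (tnth z i).1 (tnth z i).2.

Definition lebesgueC (R : realType) n :
    {sigma_finite_measure set (cspace R n) -> \bar R} :=
  power_measure (prod_measure lebesgue_measure lebesgue_measure) n.

Definition polydisc (R : realType) n (a : cspace R n) (r : R) :
    set (cspace R n) :=
  [set z | forall i, Normc.normc (ccoord z i - ccoord a i) < r].

Definition locally_integrable (R : realType) n (h : cspace R n -> R) : Prop :=
  forall a, exists2 r : R, 0 < r &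
    (lebesgueC R n).-integrable (polydisc a r) (EFin \o h).

(** The multiplier ideal of the Q-divisor [c div(g)] on affine [n]-space, for a
    polynomial [g]: the polynomials [f] such that [|f|^2 / |g|^(2c)] is locally
    integrable.  The value of the quotient on the null set [g = 0] is
    irrelevant. *)
Definition multiplier_ideal (R : realType) n (c : rat)
    (g f : mpoly.mpoly n R[i]) : Prop :=
  locally_integrable (fun z : cspace R n =>
    Normc.normc (mpoly.meval (ccoord z) f) ^+ 2
    / Normc.normc (mpoly.meval (ccoord z) g) `^ (2 * ratr c)).

Section arrangement.
Context (K : fieldType) (V : vectType K).
Implicit Types (H W : {vspace V}).

Definition is_hyperplane H : bool := (\dim H).+1 == \dim {:V}.

Definition is_arrangement d (A : d.-tuple {vspace V}) : bool :=
  uniq A && all is_hyperplane A.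

Definition codim W : nat := (\dim {:V} - \dim W)%N.

Definition intersection_lattice d (A : d.-tuple {vspace V}) :
    seq {vspace V} :=
  undup [seq (\bigcap_(i in B) tnth A i)%VS | B : {set 'I_d}].

(** The Moebius function of a finite set [L] of subspaces ordered by reverse
    inclusion: [W1] is below [W2] iff [(W2 <= W1)%VS].  The recursion is on the
    upper end [W2], with fuel [dim W1 - dim W2]; [mobius_refl], [mobius_sum] and
    [mobius_not_le] characterize the result. *)
Fixpoint mobius_rec (k : nat) (L : seq {vspace V}) (W1 W2 : {vspace V}) : int :=
  if W1 == W2 then 1 else
  if k is k'.+1 then
    if (W2 <= W1)%VS then
      - \sum_(Z <- L | [&& (W2 <= Z)%VS, (Z <= W1)%VS & Z != W2])
          mobius_rec k' L W1 Z
    else 0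
  else 0.

Definition mobius L W1 W2 : int := mobius_rec (\dim W1 - \dim W2) L W1 W2.

Lemma mobius_refl L W : mobius L W W = 1.
Proof. by rewrite /mobius; case: (_ - _)%N => [|k] /=; rewrite eqxx. Qed.

Lemma mobius_not_le L W1 W2 : ~~ (W2 <= W1)%VS -> mobius L W1 W2 = 0.
Proof.
move=> W21; have W12 : (W1 == W2) = false.
  by apply: contraNF W21 => /eqP ->.
by rewrite /mobius; case: (_ - _)%N => [|k] /=; rewrite W12 ?(negbTE W21).
Qed.

Lemma ltn_dimv W Z : (W <= Z)%VS -> Z != W -> (\dim W < \dim Z)%N.
Proof.
move=> leWZ; apply: contraR; rewrite -leqNgt => leZW.
by rewrite eq_sym eqEdim leWZ.
Qed.

Lemma mobius_rec_fuel k m L W1 W2 :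
    (\dim W1 - \dim W2 <= k)%N -> (\dim W1 - \dim W2 <= m)%N ->
  mobius_rec k L W1 W2 = mobius_rec m L W1 W2.
Proof.
elim: k m W2 => [|k IHk] m W2 lek lem.
  case: m lem => [|m] lem //=; case: eqVneq => // neq.
  case: ifP => // le21; move: lek; rewrite leqn0 subn_eq0 leqNgt.
  by rewrite ltn_dimv.
case: m lem => [|m] lem /=; case: eqVneq => // neq; case: ifP => // le21.
  by move: lem; rewrite leqn0 subn_eq0 leqNgt ltn_dimv.
congr (- _); apply: eq_bigr => Z /and3P[le2Z leZ1 neZ].
have lt2Z := ltn_dimv le2Z neZ; have lt21 := ltn_dimv le21 neq.
have ltS : (\dim W1 - \dim Z < \dim W1 - \dim W2)%N by rewrite ltn_sub2l.
by apply: IHk; rewrite -ltnS (leq_trans ltS).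
Qed.

Lemma mobius_sum L W1 W2 : uniq L -> W2 \in L -> (W2 <= W1)%VS -> W1 != W2 ->
  \sum_(Z <- L | (W2 <= Z)%VS && (Z <= W1)%VS) mobius L W1 Z = 0.
Proof.
move=> uL L2 le21 neq; rewrite -big_filter (bigD1_seq W2) ?filter_uniq //=; last first.
  by rewrite mem_filter subvv le21.
rewrite big_filter_cond.
rewrite {1}/mobius; have lt21 := ltn_dimv le21 neq.
case E: (_ - _)%N => [|k]; first by move: lt21; rewrite -subn_gt0 E.
rewrite /= (negbTE neq) le21 addrC; apply/eqP; rewrite subr_eq0; apply/eqP.
apply: eq_big => [Z|Z /andP[/andP[le2Z leZ1] neZ]]; first by rewrite andbA.
apply: mobius_rec_fuel => //; rewrite -ltnS -E ltn_sub2l //.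
exact: ltn_dimv.
Qed.

Definition poincare_poly d (A : d.-tuple {vspace V}) : {poly int} :=
  let L := intersection_lattice A in
  \sum_(W <- L) (mobius L fullv W)%:P * (- 'X) ^+ codim W.

(** Some linear form with kernel [H]; all of them are proportional. *)
Definition hyperplane_form H : 'Hom(V, K^o) :=
  xget 0 [set l : 'Hom(V, K^o) | lker l = H].

Lemma hyperplane_formP H : is_hyperplane H -> lker (hyperplane_form H) = H.
Proof.
move=> /eqP dH; suff [l lH] : exists l : 'Hom(V, K^o), lker l = H.
  exact: (@xgetPex _ 0 [set l : 'Hom(V, K^o) | lker l = H] (ex_intro _ l lH)).
have dC : \dim (H^C) = 1%N by rewrite dimv_compl -dH subSnn.
pose p := daddv_pi (H^C) H.
have capC : (H^C :&: H)%VS = 0%VS by rewrite capvC capv_compl.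
have cap' : (H :&: H^C)%VS = 0%VS by rewrite capv_compl.
have addC v : v \in (H^C + H)%VS by rewrite addvC addv_complf memvf.
pose v0 := vpick (H^C)%VS.
have v0C : v0 \in (H^C)%VS by exact: memv_pick.
have v0n : v0 != 0 by rewrite vpick0 -dimv_eq0 dC.
have CE : (H^C)%VS = <[v0]>%VS.
  by apply/esym/eqP; rewrite eqEdim -memvE v0C dC dim_vline v0n.
pose q (u : V) : K^o := coord [tuple v0] ord0 (p u).
have ql : linear q by move=> a x y; rewrite /q !linearP.
pose Q := GRing.isLinear.Build _ _ _ _ q ql.
pose qL : {linear V -> K^o} := HB.pack q Q.
exists (linfun qL); apply/vspaceP => v; rewrite memv_ker lfunE /= /q.
have pv : p v \in <[v0]>%VS by rewrite -CE memv_pi.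
have /vlineP[a pva] := pv.
have -> : (coord [tuple v0] ord0 (p v) == 0) = (p v == 0).
  rewrite pva linearZ /= (coord_free ord0 ord0) ?eqxx /=; last by rewrite seq1_free.
  by rewrite scaler_eq0 (negbTE v0n) orbF /GRing.scale /= mulr1.
have := daddv_pi_add capC (addC v); rewrite -/p => pe.
apply/eqP/idP => [p0|vH]; first by rewrite -pe p0 add0r memv_pi.
rewrite -[RHS](subrr v) -{3}(daddv_pi_id cap' vH) -{2}pe addrK //.
Qed.

(** The polynomial defining the reduced divisor [\sum_(H in A) H], in the
    coordinates of [V] with respect to the basis [e]. *)
Definition arrangement_poly n (e : n.-tuple V) d (A : d.-tuple {vspace V}) :
    mpoly.mpoly n K :=
  \prod_(H <- A) \sum_(i < n)
    (hyperplane_form H (tnth e i) : K) *: mpoly.mpolyX K (mpoly.mnm1 i).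

End arrangement.

(** [P] is a subspace of dimension [m]: it is the span of a linearly
    independent family of size [m]. *)
Definition has_dim (K : fieldType) (W : lmodType K) (P : W -> Prop)
    (m : nat) : Prop :=
  exists b : 'I_m -> W,
    (forall a : 'I_m -> K,
       \sum_(i < m) a i *: b i = 0 -> forall i, a i = 0) /\
    (forall w, P w <-> exists a : 'I_m -> K, w = \sum_(i < m) a i *: b i).

Definition graded_piece (K : fieldType) n (I : mpoly.mpoly n K -> Prop)
    (j : nat) (f : mpoly.mpoly n K) : Prop :=
  I f /\ f \is mpoly.ishomog1 j (@mpoly.mdeg n).

(** [H] is the Hilbert series of the homogeneous ideal [I]. *)
Definition is_hilbert_series (K : fieldType) n (I : mpoly.mpoly n K -> Prop)
    (H : nat -> nat) : Prop :=
  forall j, has_dim (graded_piece I j) (H j).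

(** The rational function [F] of [t = 'X] is regular at [t = 0], with power
    series expansion [\sum_k a k * t ^ k]. *)
Definition is_expansion (F : {fraction {poly int}}) (a : nat -> int) : Prop :=
  exists p q : {poly int},
    [/\ q`_0 != 0, F * tofrac q = tofrac p &
        forall k, \sum_(i < k.+1) q`_i * a (k - i)%N = p`_k].

(* Main.v *)
(** Let [A] be the list of linear forms of the arrangement and call nullity of a
    point [w] the number of forms vanishing at [w] minus their rank.  For
    [c = 1 - eps] the multiplier ideal coincides in each degree with two
    combinatorial ideals: the polynomials [f] vanishing at every [w] to order at
    least the nullity of [w], and the span of the products of the forms lying
    outside a basis of the span of [A].

    - If [g] is the product of all forms and [h] that of the forms outside a
      basis [B], then [|h|^2 / |g|^(2c)] is locally bounded by a multiple of
      [\prod_(b in B) |b|^(-2c)], which is locally integrable because [c < 1].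
    - Suppose that [f] only vanishes to order [i] at a point where [s] forms of
      rank [r] vanish, with [i < s - r].  At distance about [t] from the flat cut
      out by these forms there is a box of volume about [t^(2r)] on which
      [|f|^2 / |g|^(2c)] is at least about [t^(2i - 2cs)].  Since [i + r <= s - 1]
      and [(1 - c) s < 1], the exponent [2 (i + r - c s)] is negative, so the
      integral diverges.
    - Restriction to the kernel of a form [a] and division by [a] show by
      induction on [A] that the first ideal is contained in the second, and that
      the Hilbert series satisfy [H_A = t H_(A - a) + H_(A / a)].  This is the
      recursion satisfied by Whitney's subset expansion of the Poincare
      polynomial. *)

From HB Require Import structures.
Require Import Defs.
From mathcomp Require Import all_boot all_order all_algebra.

(* [mpoly] is imported inside a module because its notations clash with those
   of the analysis library. *)
Module Algebra.
From mathcomp Require Import mpoly ring zify.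
Import GRing.Theory Num.Theory.
Local Open Scope ring_scope.
Set Implicit Arguments.
Unset Strict Implicit.
Unset Printing Implicit Defensive.

(** * Linear forms and restriction to affine lines *)

(** The forms are kept in a list of row vectors rather than a set of hyperplanes, because
    restricting to the kernel of a form can make other forms proportional or zero. A zero form kills
    both the ideal and Whitney's sum, so the recursion never has to simplify the list. For the same
    reason the recursion runs on Whitney's sum over sublists; the intersection lattice and its
    Moebius function enter only for the original arrangement. Orders of vanishing are read off on
    the lines [w + v X]: this is compatible with linear substitutions and turns each condition into
    divisibility of a univariate polynomial by a power of ['X]. The delicate point of the recursion
    is that restriction to a kernel is surjective between the ideals; products of forms can be
    lifted explicitly, and this is why the vanishing conditions are compared with them. On the
    analytic side, a linear change of coordinates enters only through the fact that it scales the
    measure by some positive finite constant. *)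

Lemma eq_mpoly_rmorph (R : comNzRingType) n (S : nzRingType)
    (f g : {rmorphism {mpoly R[n]} -> S}) :
  (forall c, f c%:MP = g c%:MP) -> (forall i, f 'X_i = g 'X_i) -> f =1 g.
Proof.
move=> fgC fgX p; rewrite [p]mpolyE !rmorph_sum; apply: eq_bigr => m _.
rewrite -mul_mpolyC !rmorphM fgC mpolyXE_id !rmorph_prod; congr (_ * _).
by apply: eq_bigr => i _; rewrite !rmorphXn fgX.
Qed.

Section LinearForms.
Variable K : fieldType.

Definition linf n (a : 'rV[K]_n) : {mpoly K[n]} := \sum_i a 0 i *: 'X_i.

Definition lsub n k (M : 'M[K]_(n, k)) : {mpoly K[n]} -> {mpoly K[k]} :=
  comp_mpoly [tuple linf (row i M) | i < n].

HB.instance Definition _ n k (M : 'M[K]_(n, k)) :=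
  GRing.LRMorphism.copy (lsub M) (comp_mpoly [tuple linf (row i M) | i < n]).

Lemma linf_is_linear n : linear (@linf n).
Proof.
move=> c a b; rewrite /linf scaler_sumr -big_split; apply: eq_bigr => i _.
by rewrite !mxE scalerDl scalerA.
Qed.
HB.instance Definition _ n := GRing.isLinear.Build _ _ _ _ _ (@linf_is_linear n).

Lemma linf_homog n (a : 'rV[K]_n) : linf a \is 1.-homog.
Proof. by apply: rpred_sum => i _; rewrite rpredZ // dhomogX /= mdeg1. Qed.

Lemma lsubX n k (M : 'M[K]_(n, k)) i : lsub M 'X_i = linf (row i M).
Proof. by rewrite /lsub comp_mpolyXU -tnth_nth tnth_mktuple. Qed.

Lemma lsubC n k (M : 'M[K]_(n, k)) c : lsub M c%:MP = c%:MP.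
Proof. exact: comp_mpolyC. Qed.

Lemma lsub_linf n k (M : 'M[K]_(n, k)) a : lsub M (linf a) = linf (a *m M).
Proof.
rewrite mulmx_sum_row !linear_sum; apply: eq_bigr => i _.
by rewrite !linearZ /= lsubX.
Qed.

Lemma lsub_comp n k l (M : 'M[K]_(n, k)) (N : 'M[K]_(k, l)) p :
  lsub N (lsub M p) = lsub (M *m N) p.
Proof.
apply: (eq_mpoly_rmorph (f := lsub N \o lsub M)) => [c|i] /=.
  by rewrite !lsubC.
by rewrite !lsubX lsub_linf row_mul.
Qed.

Lemma linf1 n i : linf (row i 1%:M) = 'X_i :> {mpoly K[n]}.
Proof.
rewrite /linf (bigD1 i) //= big1 => [|j ji]; rewrite !mxE ?eqxx ?scale1r ?addr0 //.
by rewrite eq_sym (negPf ji) scale0r.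
Qed.

Lemma lsub1 n (p : {mpoly K[n]}) : lsub 1%:M p = p.
Proof.
apply: (eq_mpoly_rmorph (f := lsub 1%:M) (g := idfun)) => [c|i] /=.
  exact: lsubC.
by rewrite lsubX linf1.
Qed.

Lemma lsub_homog n k (M : 'M[K]_(n, k)) d p :
  p \is d.-homog -> lsub M p \is d.-homog.
Proof.
move=> /dhomogP hp; rewrite /lsub comp_mpolyEX big_seq; apply: rpred_sum => m mp.
rewrite rpredZ // comp_mpolyX.
have -> : d = (\sum_(i < n) 1 * m i)%N.
  by rewrite -(hp m mp) /= mdegE; apply: eq_bigr => i _; rewrite mul1n.
elim/big_rec2: _ => [|i e q _ IH]; first exact: dhomog1.
by apply: dhomogM => //; apply: dhomogMn; rewrite tnth_mktuple linf_homog.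
Qed.

Definition prodl n (A : seq 'rV[K]_n) : {mpoly K[n]} := \prod_(a <- A) linf a.

Lemma prodl_homog n (A : seq 'rV[K]_n) : prodl A \is (size A).-homog.
Proof.
elim: A => [|a A IH]; rewrite /prodl ?big_nil ?big_cons ?dhomog1 //.
exact: (dhomogM (linf_homog a) IH).
Qed.

Lemma lsub_prodl n k (M : 'M[K]_(n, k)) A :
  lsub M (prodl A) = prodl [seq a *m M | a <- A].
Proof.
by rewrite /prodl rmorph_prod big_map; apply: eq_bigr => a _; rewrite /= lsub_linf.
Qed.

(* The univariate polynomial [f (w + v X)]. *)
Definition along n (w v : 'cV[K]_n) (f : {mpoly K[n]}) : {poly K} :=
  mmap (@polyC K) (fun i => (w i 0)%:P + v i 0 *: 'X) f.

HB.instance Definition _ n (w v : 'cV[K]_n) :=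
  GRing.RMorphism.copy (along w v)
    (mmap (@polyC K) (fun i => (w i 0)%:P + v i 0 *: 'X)).

Lemma alongC n c (w v : 'cV[K]_n) : along w v c%:MP = c%:P.
Proof. exact: mmapC. Qed.

Lemma alongX n i (w v : 'cV[K]_n) : along w v 'X_i = (w i 0)%:P + v i 0 *: 'X.
Proof. by rewrite /along mmapX mmap1U. Qed.

Lemma alongZ n c f (w v : 'cV[K]_n) : along w v (c *: f) = c *: along w v f.
Proof. by rewrite -mul_mpolyC rmorphM /= alongC mul_polyC. Qed.

Lemma along_linf n a (w v : 'cV[K]_n) :
  along w v (linf a) = ((a *m w) 0 0)%:P + (a *m v) 0 0 *: 'X.
Proof.
rewrite /linf rmorph_sum !mxE rmorph_sum scaler_suml -big_split /=.
apply: eq_bigr => i _.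
by rewrite alongZ alongX scalerDr scalerA -mul_polyC -polyCM.
Qed.

Lemma along_lsub n k (M : 'M[K]_(n, k)) f w v :
  along w v (lsub M f) = along (M *m w) (M *m v) f.
Proof.
apply: (eq_mpoly_rmorph (f := along w v \o lsub M)) => [c|i] /=.
  by rewrite lsubC !alongC.
by rewrite lsubX along_linf alongX -!row_mul !mxE.
Qed.

Lemma horner_along n f (w v : 'cV[K]_n) t :
  (along w v f).[t] = f.@[fun i => w i 0 + t * v i 0].
Proof.
pose g := meval (fun i => w i 0 + t * v i 0).
apply: (eq_mpoly_rmorph (f := horner_eval t \o along w v) (g := g)) => [c|i] /=.
  by rewrite /horner_eval alongC hornerC /g mevalC.
by rewrite /horner_eval alongX hornerD hornerC hornerZ hornerX /g mevalXU mulrC.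
Qed.

(** When base point and direction move linearly in [t], each coefficient of the restriction is a
    polynomial in [t]; a vanishing known for all but finitely many [t] then extends to [t = 0]. *)
Lemma along_pencil n f (w v y u : 'cV[K]_n) :
  exists F : {poly {poly K}}, forall t,
    map_poly (horner_eval t) F = along (w + t *: y) (v + t *: u) f.
Proof.
pose h i : {poly {poly K}} :=
  ((w i 0)%:P + y i 0 *: 'X)%:P + ((v i 0)%:P + u i 0 *: 'X)%:P * 'X.
exists (mmap (@polyC _ \o @polyC K) h f) => t.
apply: (eq_mpoly_rmorph
  (f := map_poly (horner_eval t) \o mmap (@polyC _ \o @polyC K) h)) => [c|i] /=.
  by rewrite alongC mmapC /= map_polyC /= /horner_eval hornerC.
rewrite alongX mmapX mmap1U /h rmorphD rmorphM /= !map_polyC map_polyX /=.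
by rewrite /horner_eval !hornerD !hornerC !hornerZ !hornerX !mxE mul_polyC !(mulrC t).
Qed.

Lemma meval_linf n (a : 'rV[K]_n) (y : 'cV[K]_n) :
  (linf a).@[fun i => y i 0] = (a *m y) 0 0.
Proof.
rewrite /linf rmorph_sum mxE; apply: eq_bigr => i _.
by rewrite /= mevalZ mevalXU.
Qed.

(** Version of the pencil with [n] parameters: the coefficients are polynomials in [y], so their
    size near [y = 0] can be estimated. *)
Lemma along_family n f (w v : 'cV[K]_n) (M N : 'M[K]_n) :
  exists F : {poly {mpoly K[n]}}, forall y : 'cV[K]_n,
    map_poly (meval (fun i => y i 0)) F = along (w + M *m y) (v + N *m y) f.
Proof.
pose h i : {poly {mpoly K[n]}} :=
  ((w i 0)%:MP + linf (row i M))%:P + ((v i 0)%:MP + linf (row i N))%:P * 'X.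
exists (mmap (@polyC _ \o @mpolyC n K) h f) => y.
pose ev : {mpoly K[n]} -> K := meval (fun i => y i 0).
apply: (eq_mpoly_rmorph
  (f := map_poly (meval (fun i => y i 0)) \o mmap (@polyC _ \o @mpolyC n K) h)) => [c|i] /=.
  by rewrite alongC mmapC /= map_polyC /= mevalC.
rewrite alongX mmapX mmap1U /h rmorphD rmorphM /= !map_polyC map_polyX /=.
by rewrite !mevalD !mevalC !meval_linf mul_polyC -!row_mul !mxE.
Qed.

Lemma dvdXnP m (p : {poly K}) : reflect (forall i, (i < m)%N -> p`_i = 0) ('X^m %| p).
Proof.
apply: (iffP (dvdpP _ _)) => [[q ->] i im|p0]; first by rewrite coefMXn im.
exists (drop_poly m p); rewrite -[LHS](poly_take_drop m).
suff -> : take_poly m p = 0 by rewrite add0r.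
by apply/polyP => i; rewrite coef_take_poly coef0; case: ifP => // /p0.
Qed.

Lemma dvdXn_unitM m (c b : K) p : c != 0 ->
  'X^m %| (c%:P + b *: 'X) * p -> 'X^m %| p.
Proof.
move=> c0; rewrite Gauss_dvdpr // coprimep_sym coprimep_expr // coprimep_sym.
by rewrite coprimep_sym coprimepX /root hornerD hornerC hornerZ hornerX mulr0 addr0.
Qed.

End LinearForms.

(** * Rank of a list of forms *)

Section Span.
Variable K : fieldType.

(** Full row rank makes the middle factor of the factorization of [B] equal to [[1 0]]; the
    remaining rows of the invertible matrix [row_ebase B] complete [B]. *)
Lemma row_free_completion r m (B : 'M[K]_(r, r + m)) :
  row_free B -> exists C : 'M_(m, r + m), col_mx B C \in unitmx.
Proof.
move=> /eqP rB; exists (dsubmx (row_ebase B)).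
suff -> : col_mx B (dsubmx (row_ebase B)) =
    block_mx (col_ebase B) 0 0 1%:M *m row_ebase B.
  rewrite unitmx_mul row_ebase_unit andbT unitmxE det_ublock det1 mulr1.
  by rewrite -unitmxE col_ebase_unit.
rewrite -{2}[row_ebase B]vsubmxK mul_block_col !mul0mx mul1mx addr0 add0r.
congr col_mx; rewrite -{1}(mulmx_ebase B) -mulmxA; congr (_ *m _).
rewrite -{1}[row_ebase B]vsubmxK rB.
have -> : pid_mx r = row_mx 1%:M 0 :> 'M[K]_(r, r + m).
  by rewrite pid_mx_row -pid_mx_1.
by rewrite mul_row_col mul1mx mul0mx addr0.
Qed.

(** [u] and [E] are the column blocks of the inverse of the square matrix with rows [e] and [P].
    Substituting [E] is restriction to the kernel of [e], and substituting [P] extends a polynomial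
    from the kernel to the whole space. *)
Lemma hyperplane_splitting n (e : 'rV[K]_n.+1) : e != 0 ->
  exists u : 'cV_n.+1, exists E : 'M_(n.+1, n), exists P : 'M_(n, n.+1),
  [/\ e *m u = 1%:M, e *m E = 0, P *m E = 1%:M & u *m e + E *m P = 1%:M].
Proof.
move=> e0; have /row_free_completion[P uP] : @row_free _ 1 (1 + n) e.
  by rewrite -row_leq_rank lt0n mxrank_eq0.
pose N : 'M_(1 + n) := col_mx e P; pose M := invmx N.
exists (lsubmx M), (rsubmx M), P.
have h1 := mulVmx uP; rewrite -/N -/M -[M]hsubmxK mul_row_col in h1.
have h2 := mulmxV uP; rewrite -/N -/M -[M]hsubmxK mul_col_row in h2.
have /eq_block_mx[eu eE _ PE] := etrans h2 (@scalar_mx_block _ 1 n 1).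
by split.
Qed.

Definition sp n (A : seq 'rV[K]_n) : 'M_n := (\sum_(a <- A) <<a>>)%MS.

Definition rk n (A : seq 'rV[K]_n) := \rank (sp A).

Lemma sp_nil n : @sp n [::] = 0.
Proof. by rewrite /sp big_nil. Qed.

Lemma sp_cons n a (A : seq 'rV[K]_n) : (sp (a :: A) :=: a + sp A)%MS.
Proof. by rewrite /sp big_cons; apply: adds_eqmx => //; apply: genmxE. Qed.

Lemma sub_sp n m (A : seq 'rV[K]_n) (B : 'M_(m, n)) :
  reflect {in A, forall a, (a <= B)%MS} (sp A <= B)%MS.
Proof.
elim: A => [|a A IH]; first by rewrite sp_nil sub0mx; left=> a; rewrite in_nil.
rewrite sp_cons addsmx_sub; apply: (iffP andP) => [[aB /IH AB] b|AB].
  by rewrite in_cons => /predU1P[->|/AB].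
split; first by apply: AB; rewrite mem_head.
by apply/IH => b bA; apply: AB; rewrite in_cons bA orbT.
Qed.

Lemma mem_sp n (A : seq 'rV[K]_n) a : a \in A -> (a <= sp A)%MS.
Proof. by move: a; apply/sub_sp. Qed.

Lemma spS n (A B : seq 'rV[K]_n) : {subset A <= B} -> (sp A <= sp B)%MS.
Proof. by move=> AB; apply/sub_sp => a /AB; apply: mem_sp. Qed.

Lemma rkS n (A B : seq 'rV[K]_n) : {subset A <= B} -> (rk A <= rk B)%N.
Proof. by move=> AB; apply: mxrankS; apply: spS. Qed.

Lemma rk_size n (A : seq 'rV[K]_n) : (rk A <= size A)%N.
Proof.
elim: A => [|a A IH]; first by rewrite /rk sp_nil mxrank0.
rewrite /rk sp_cons (leq_trans (mxrank_adds_leqif _ _)) // -[(size _)]add1n.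
by rewrite leq_add // rank_leq_row.
Qed.

Lemma rk_cons_sub n a (A : seq 'rV[K]_n) : (a <= sp A)%MS -> rk (a :: A) = rk A.
Proof. by move=> aA; rewrite /rk sp_cons; apply: eqmx_rank; apply/eqmxP/addsmx_idPr. Qed.

Lemma rk_consNsub n a (A : seq 'rV[K]_n) :
  ~~ (a <= sp A)%MS -> rk (a :: A) = (rk A).+1.
Proof.
move=> aA; have a0 : a != 0 by apply: contraNneq aA => ->; rewrite sub0mx.
rewrite /rk sp_cons; apply/eqP; rewrite eqn_leq.
have r1 : \rank a = 1%N by rewrite rank_rV a0.
rewrite (leq_trans (mxrank_adds_leqif _ _)) ?r1 //=.
rewrite ltn_neqAle mxrankS ?addsmxSr // andbT.
apply: contra aA => /eqP; rewrite addsmxC => /esym eqr.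
have /mxrank_leqif_sup[_ ] : (sp A <= sp A + a)%MS by exact: addsmxSl.
by rewrite eqr eqxx => /esym; rewrite addsmx_sub => /andP[].
Qed.

Lemma rk_cons_leq n a (A : seq 'rV[K]_n) : (rk (a :: A) <= (rk A).+1)%N.
Proof.
by case: (boolP (a <= sp A)%MS) => aA; rewrite ?(rk_cons_sub aA) ?(rk_consNsub aA).
Qed.

(** Each discarded form lowers the rank by at most one. *)
Lemma rk_filter n (p : pred 'rV[K]_n) A :
  (rk A <= rk (filter p A) + count (predC p) A)%N.
Proof.
elim: A => [|a A IH]; first by rewrite addn0.
rewrite /=; case: (p a) => /=; last first.
  by rewrite addnCA add1n (leq_trans (rk_cons_leq _ _)).
rewrite add0n; case: (boolP (a <= sp (filter p A))%MS) => aA.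
  rewrite !rk_cons_sub //; apply: submx_trans aA (spS _) => b.
  by rewrite mem_filter => /andP[].
by rewrite (rk_consNsub aA) addSn (leq_trans (rk_cons_leq _ _)).
Qed.

Lemma rk_filter_free n (p : pred 'rV[K]_n) B :
  rk B = size B -> rk (filter p B) = size (filter p B).
Proof.
move=> rB; apply/eqP; rewrite eqn_leq rk_size size_filter.
by have := rk_filter p B; rewrite rB -(count_predC p B) leq_add2r.
Qed.

Lemma free_extension n (B : seq 'rV[K]_n) : rk B = size B ->
  exists C, rk (C ++ B) = n /\ size (C ++ B) = n.
Proof.
move: {2}(n - size B)%N (erefl (n - size B)%N) => k.
elim: k B => [|k IH] B kE rB.
  exists [::]; rewrite /= rB; suff -> : size B = n by [].
  have := rank_leq_col (sp B); rewrite -/(rk B) rB => leB.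
  by apply/eqP; rewrite eqn_leq leB -subn_eq0 kE.
have : ~~ (1%:M <= sp B)%MS.
  rewrite sub1mx /row_full -/(rk B) rB; apply/eqP => nB.
  by rewrite nB subnn in kE.
move=> /row_subPn[i iB].
have [C [rC sC]] : exists C, rk (C ++ row i 1%:M :: B) = n /\ size (C ++ row i 1%:M :: B) = n.
  by apply: IH; [rewrite /= subnS kE | rewrite rk_consNsub ?rB].
by exists (rcons C (row i 1%:M)); rewrite cat_rcons.
Qed.

Lemma unitmx_rows n (B : seq 'rV[K]_n) : rk B = n -> size B = n ->
  (\matrix_(i < n) B`_i) \in unitmx.
Proof.
move=> rB sB; rewrite -row_full_unit /row_full eqn_leq rank_leq_col -{1}rB.
apply: mxrankS; apply/sub_sp => a /(nthP 0)[i]; rewrite sB => iB <-.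
by have := row_sub (Ordinal iB) (\matrix_(i < n) B`_i); rewrite rowK.
Qed.

Lemma sp_map n k (M : 'M[K]_(n, k)) A : (sp [seq a *m M | a <- A] :=: sp A *m M)%MS.
Proof.
elim: A => [|a A IH] /=; first by rewrite !sp_nil mul0mx; apply/eqmxP; rewrite !sub0mx.
apply: (eqmx_trans (sp_cons _ _)); apply: eqmx_sym.
apply: (eqmx_trans (eqmxMr _ (sp_cons _ _))).
by apply: (eqmx_trans (addsmxMr _ _ _)); apply: adds_eqmx; [apply: eqmx_refl | apply: eqmx_sym].
Qed.

(** The kernel of right multiplication by [E] is the line of [e], so this multiplication is the
    quotient by [e], that is, the contraction of [e] in the matroid of forms. *)
Lemma rk_cons_quotient n (e : 'rV[K]_n.+1) (E : 'M_(n.+1, n)) (P : 'M_(n, n.+1)) A :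
  e != 0 -> e *m E = 0 -> P *m E = 1%:M ->
  rk (e :: A) = (rk [seq a *m E | a <- A]).+1.
Proof.
move=> e0 eE PE; have rE : \rank E = n.
  by apply/eqP; rewrite eqn_leq rank_leq_col -{1}(mxrank1 K n) -PE mxrankM_maxr.
have kE : (e :=: kermx E)%MS.
  apply/eqmxP; rewrite -(geq_leqif (mxrank_leqif_eq _)).
    by rewrite mxrank_ker rE subSnn rank_rV e0.
  by apply/sub_kermxP.
have := mxrank_mul_ker (sp (e :: A)) E.
have -> : \rank (sp (e :: A) :&: kermx E) = 1%N.
  rewrite (cap_eqmx (eqmx_refl (sp (e :: A))) (eqmx_sym kE)).
  rewrite (capmx_idPr _) ?rank_rV ?e0 //.
  by rewrite sp_cons addsmxSl.
rewrite addn1 /rk => <-; congr _.+1.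
by rewrite -(sp_map E (e :: A)) /= -/(rk (_ :: _)) rk_cons_sub // eE sub0mx.
Qed.

End Span.

(** * The two combinatorial ideals *)

Section Density.
Variable K : numFieldType.

(** Multiplying by the monic polynomial with roots [s] gives a polynomial that vanishes everywhere;
    in characteristic zero the integers supply too many roots. *)
Lemma poly_eq0_cofinite (q : {poly K}) (s : seq K) :
  (forall t, t \notin s -> q.[t] = 0) -> q = 0.
Proof.
move=> q0; pose S := \prod_(z <- s) ('X - z%:P).
have qS t : (q * S).[t] = 0.
  rewrite hornerM; case: (boolP (t \in s)) => [ts|/q0 ->]; last by rewrite mul0r.
  by have := root_prod_XsubC s t; rewrite ts => /eqP ->; rewrite mulr0.
suff /eqP : q * S = 0.
  by rewrite mulf_eq0 (negPf (monic_neq0 (monic_prod_XsubC _ _ _))) orbF => /eqP.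
apply/eqP/negPn/negP => qS0.
pose r : seq K := [seq i%:R | i <- iota 0 (size (q * S))].
have := max_poly_roots (rs := r) qS0; rewrite size_map size_iota ltnn => /(_ _ _)/negP[] //.
  by apply/allP => t _; apply/eqP.
by rewrite map_inj_uniq ?iota_uniq // => i j /eqP; rewrite eqr_nat => /eqP.
Qed.

(** Induction on [n]: [phi] regards [f] as univariate in the variable of index 0, with coefficients
    in the other variables, and [psi] undoes this. *)
Lemma mpoly_eq0_fun n (f : {mpoly K[n]}) : (forall y, f.@[y] = 0) -> f = 0.
Proof.
elim: n f => [|n IH] f f0.
  have fE : f = (f@_0)%:MP.
    apply/mpolyP => m; rewrite mcoeffC; have -> : m = 0%MM by apply/mnmP => -[].
    by rewrite eqxx mulr1.
  by have := f0 (fun _ => 0); rewrite fE mevalC => ->.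
pose h i : {poly {mpoly K[n]}} := if unlift ord0 i is Some j then ('X_j)%:P else 'X.
pose phi := mmap (@polyC _ \o @mpolyC n K) h.
pose s := [tuple ('X_(lift ord0 j) : {mpoly K[n.+1]}) | j < n].
pose psi := horner_eval ('X_ord0 : {mpoly K[n.+1]}) \o map_poly (comp_mpoly s).
have phiK : psi (phi f) = f.
  apply: (eq_mpoly_rmorph (f := psi \o phi) (g := idfun)) => [c|i] /=.
    by rewrite /psi /phi /= mmapC /= map_polyC /horner_eval hornerC /= comp_mpolyC.
  rewrite /psi /phi /= mmapX mmap1U /h /horner_eval.
  case: unliftP => [j|] ->; last by rewrite map_polyX hornerX.
  by rewrite map_polyC hornerC /= comp_mpolyXU -tnth_nth tnth_mktuple.
suff phi0 : phi f = 0 by rewrite -phiK phi0 /psi rmorph0.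
apply/polyP => k; rewrite coef0; apply: IH => y.
pose z t i := if unlift ord0 i is Some j then y j else t.
have ev t : (map_poly (meval y) (phi f)).[t] = f.@[z t].
  apply: (eq_mpoly_rmorph (f := horner_eval t \o map_poly (meval y) \o phi)
    (g := meval (z t))) => [c|i] /=.
    by rewrite /phi mmapC /= map_polyC /horner_eval hornerC /= !mevalC.
  rewrite /phi /= mmapX mmap1U /h /horner_eval mevalXU /z.
  case: unliftP => [j|] _; last by rewrite map_polyX hornerX.
  by rewrite map_polyC hornerC /= mevalXU.
have /polyP/(_ k) : map_poly (meval y) (phi f) = 0.
  by apply: (@poly_eq0_cofinite _ [::]) => t _; rewrite ev.
by rewrite coef_map coef0.
Qed.

Lemma along_dense n m (f : {mpoly K[n]}) (w v y u : 'cV[K]_n) (s : seq K) :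
  (forall t, t \notin s -> 'X^m %| along (w + t *: y) (v + t *: u) f) ->
  'X^m %| along w v f.
Proof.
have [F FE] := along_pencil f w v y u => Fs; apply/dvdXnP => i im.
have Fi0 : F`_i = 0.
  apply: (@poly_eq0_cofinite _ s) => t /Fs; rewrite -FE => /dvdXnP/(_ i im).
  by rewrite coef_map.
by have := FE 0; rewrite !scale0r !addr0 => <-; rewrite coef_map /= Fi0 rmorph0.
Qed.

End Density.

Section VanishingIdeal.
Variable K : numFieldType.

Definition through n (w : 'cV[K]_n) (A : seq 'rV[K]_n) := [seq a <- A | a *m w == 0].

Definition nullity n (w : 'cV[K]_n) (A : seq 'rV[K]_n) :=
  (size (through w A) - rk (through w A))%N.

(** The order of vanishing at [w] is tested on all lines through [w]. By [rk_size] the subtraction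
    in [nullity] is never truncated. *)
Definition nullity_ideal n (A : seq 'rV[K]_n) (f : {mpoly K[n]}) : Prop :=
  forall w v, 'X^(nullity w A) %| along w v f.

Lemma nullity_ideal_lin n (A : seq 'rV[K]_n) c f g :
  nullity_ideal A f -> nullity_ideal A g -> nullity_ideal A (c *: f + g).
Proof.
by move=> fA gA w v; rewrite rmorphD /= alongZ dvdp_add // -mul_polyC dvdp_mull.
Qed.

Lemma nullity_ideal0 n (A : seq 'rV[K]_n) : nullity_ideal A 0.
Proof. by move=> w v; rewrite rmorph0 dvdp0. Qed.

Lemma nullity_idealD n (A : seq 'rV[K]_n) f g :
  nullity_ideal A f -> nullity_ideal A g -> nullity_ideal A (f + g).
Proof. by move=> fA gA; rewrite -[f]scale1r; apply: nullity_ideal_lin. Qed.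

Lemma nullity_idealN n (A : seq 'rV[K]_n) f : nullity_ideal A f -> nullity_ideal A (- f).
Proof. by move=> fA; rewrite -scaleN1r -[_ *: _]addr0; apply/nullity_ideal_lin/nullity_ideal0. Qed.

Lemma nullity_ideal_nil n (f : {mpoly K[n]}) : nullity_ideal [::] f.
Proof. by move=> w v; rewrite /nullity /= sub0n expr0 dvd1p. Qed.

(** A zero form passes through every point and adds nothing to the rank, so the nullity is positive
    everywhere. *)
Lemma nullity_ideal_loop n (A : seq 'rV[K]_n) f : nullity_ideal (0 :: A) f -> f = 0.
Proof.
move=> fA; apply: mpoly_eq0_fun => y; pose w := \col_i y i.
have := fA w 0; rewrite /nullity /= mul0mx eqxx /= rk_cons_sub ?sub0mx //.
rewrite subSn ?rk_size // => /dvdXnP/(_ 0 isT).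
rewrite -horner_coef0 horner_along => <-; apply: meval_eq => i.
by rewrite !mxE mul0r addr0.
Qed.

(** At a point [M w] the form [e] vanishes; compared with the restricted forms it raises both the
    number of forms and their rank by one, so the nullities agree. *)
Lemma nullity_ideal_restrict n k (M : 'M[K]_(n, k)) e A f : e *m M = 0 ->
  (forall B, rk (e :: B) = (rk [seq a *m M | a <- B]).+1) ->
  nullity_ideal (e :: A) f -> nullity_ideal [seq a *m M | a <- A] (lsub M f).
Proof.
move=> eM rkE fA w v; rewrite along_lsub; have := fA (M *m w) (M *m v).
rewrite /nullity /= mulmxA eM mul0mx eqxx /= rkE subSS.
suff -> : through w [seq a *m M | a <- A] = [seq a *m M | a <- through (M *m w) A].
  by rewrite size_map.
rewrite /through filter_map; congr map; apply: eq_filter => a /=.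
by rewrite mulmxA.
Qed.

(* Dividing by [e] is harmless at points with [e w != 0].  At the other points, if
   [e] depends on the forms through [w], the nullity drops with [e] and one
   divides along the dense set of directions [u] with [e u != 0]; otherwise [w]
   can be moved off the kernel of [e] without leaving the other forms. *)
Lemma nullity_ideal_divide n (e : 'rV[K]_n) A f : e != 0 ->
  nullity_ideal (e :: A) (linf e * f) -> nullity_ideal A f.
Proof.
move=> e0 fA w; have [z ez] : exists z : 'cV_n, e *m z = 1%:M.
  have [i ei] := rV0Pn _ e0.
  exists ((e 0 i)^-1 *: delta_mx i 0); apply/matrixP => a b.
  rewrite -scalemxAr -colE !mxE !ord1 eqxx mulVf //.
have generic m w' v : (e *m w' != 0) ->
    'X^m %| along w' v (linf e * f) -> 'X^m %| along w' v f.
  move=> ew; rewrite rmorphM /= along_linf; apply: dvdXn_unitM.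
  by apply: contraNneq ew => ew; apply/eqP/matrixP => a b; rewrite !ord1 ew !mxE.
case: (eqVneq (e *m w) 0) => [ew|ew v]; last first.
  by apply: generic => //; have := fA w v; rewrite /nullity /= (negPf ew).
case: (boolP (e <= sp (through w A))%MS) => [esp|esp] v.
  have dir u : e *m u != 0 -> 'X^(nullity w A) %| along w u f.
    move=> eu; have := fA w u; rewrite /nullity /= ew eqxx /= rk_cons_sub //.
    rewrite subSn ?rk_size // rmorphM /= along_linf ew mxE polyC0 add0r.
    rewrite -scalerAl dvdpZr ?exprS ?dvdp_mul2l ?polyX_eq0 //.
    apply: contraNneq eu => eu; apply/eqP/matrixP => a b.
    by rewrite !ord1 eu !mxE.
  apply: (@along_dense _ _ _ _ _ _ 0 z [:: - (e *m v) 0 0]) => t.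
  rewrite inE scaler0 addr0 => tev; apply: dir; rewrite mulmxDr -scalemxAr ez.
  apply: contra tev => /eqP/matrixP/(_ 0 0); rewrite !mxE mulr1 addrC => /eqP.
  by rewrite addr_eq0.
have [y [ey Ay]] : exists y : 'cV_n, e *m y != 0 /\ sp (through w A) *m y = 0.
  move: esp; rewrite submxE => /rV0Pn[j ej]; exists (col j (cokermx (sp (through w A)))).
  split; last by rewrite colE mulmxA mulmx_coker mul0mx.
  by rewrite colE mulmxA -colE; apply: contraNneq ej => /colP/(_ 0); rewrite !mxE => ->.
have Ay0 a : a \in A -> a *m w = 0 -> a *m y = 0.
  move=> aA aw; have /submxP[D ->] : (a <= sp (through w A))%MS.
    by apply: mem_sp; rewrite mem_filter aw eqxx.
  by rewrite -mulmxA Ay mulmx0.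
(* Excluded are [t = 0], where [e] still vanishes, and the finitely many [t] at which a form of [A]
   that is nonzero at [w] could vanish at [w + t y]. *)
apply: (@along_dense _ _ _ _ _ _ y 0
   (0 :: [seq - (a *m w) 0 0 / (a *m y) 0 0 | a <- A])) => t.
rewrite in_cons negb_or => /andP[t0 tA].
have thr : through (w + t *: y) A = through w A.
  apply: eq_in_filter => a aA; rewrite mulmxDr -scalemxAr.
  case: (eqVneq (a *m w) 0) => [aw|aw]; first by rewrite aw Ay0 // scaler0 addr0 eqxx.
  apply: contraNF tA => /eqP/matrixP/(_ 0 0) h; apply/mapP; exists a => //.
  move: h; rewrite !mxE => /eqP; rewrite addr_eq0 => /eqP h.
  apply: (canRL (mulfK _)); last by rewrite h opprK.
  apply: contraNneq aw => ay; apply/eqP/matrixP => b c; rewrite !ord1.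
  by move: ay; rewrite !mxE => ay; rewrite h ay mulr0 oppr0.
have et : e *m (w + t *: y) != 0.
  by rewrite mulmxDr ew add0r -scalemxAr scaler_eq0 negb_or t0.
apply: generic => //; have := fA (w + t *: y) (v + t *: 0).
by rewrite /nullity /= (negPf et) thr.
Qed.

(* The mask [m] selects a basis of the span of [A]. *)
Inductive cobasis_span n (A : seq 'rV[K]_n) (j : nat) : {mpoly K[n]} -> Prop :=
| cobasis_span0 : cobasis_span A j 0
| cobasis_spanD f g : cobasis_span A j f -> cobasis_span A j g -> cobasis_span A j (f + g)
| cobasis_spanM (m : bitseq) h i : size m = size A ->
    rk (mask m A) = count id m -> rk (mask m A) = rk A ->
    h \is i.-homog -> (i + count negb m)%N = j ->
    cobasis_span A j (h * prodl (mask (map negb m) A)).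

Lemma cobasis_span_homog n (A : seq 'rV[K]_n) j f : cobasis_span A j f -> f \is j.-homog.
Proof.
elim=> [|g h _ gj _ hj|m h i sm _ _ hi <-]; rewrite ?rpred0 ?rpredD //.
apply: dhomogM => //; have := prodl_homog (mask (map negb m) A).
by rewrite size_mask ?size_map // count_map.
Qed.

Lemma dvdXn_prodl n (w v : 'cV[K]_n) A : 'X^(size (through w A)) %| along w v (prodl A).
Proof.
elim: A => [|a A IH] /=; first by rewrite expr0 dvd1p.
rewrite /prodl big_cons rmorphM /= along_linf; case: eqP => [aw|_] /=.
  by rewrite exprS dvdp_mul // aw mxE polyC0 add0r -mul_polyC dvdp_mull.
exact: dvdp_mull.
Qed.

Lemma count_mask_negb (T : Type) (p : pred T) m (s : seq T) : size m = size s ->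
  count p s = (count p (mask m s) + count p (mask (map negb m) s))%N.
Proof.
elim: s m => [|x s IH] [|[] m] //= [/IH ->]; first by rewrite addnA.
by rewrite addnCA.
Qed.

(** Among the forms through [w], those selected by the mask are independent, hence no more than the
    rank in number; the others, at least as many as the nullity, are factors of the product. *)
Lemma cobasis_span_nullity_ideal n (A : seq 'rV[K]_n) j f : cobasis_span A j f -> nullity_ideal A f.
Proof.
elim=> [|g h _ gj _ hj|m h i sm rm _ _ _]; rewrite ?nullity_ideal0 ?nullity_idealD //.
  exact: nullity_ideal0.
  exact: nullity_idealD.
move=> w v; rewrite rmorphM /= dvdp_mull // (dvdp_trans _ (dvdXn_prodl _ _ _)) //.
rewrite dvdp_exp2l // leq_subLR !size_filter (count_mask_negb _ sm) leq_add2r.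
have rB : rk (mask m A) = size (mask m A) by rewrite rm size_mask.
rewrite -size_filter -(rk_filter_free _ rB).
by apply: rkS => a; rewrite !mem_filter => /andP[-> /mem_mask].
Qed.

End VanishingIdeal.

(** * Division by a linear form and restriction to its kernel *)

Section Division.
Variable K : fieldType.

(** Being congruent to its own substitution modulo [e] is stable under sums and products, so it
    suffices to check the variables, where it is the hypothesis read row by row. *)
Lemma lsub_congr n (e : 'rV[K]_n) u M (f : {mpoly K[n]}) :
  u *m e + M = 1%:M -> exists q, f = lsub M f + linf e * q.
Proof.
move=> uM; pose C (g : {mpoly K[n]}) := exists q, g = lsub M g + linf e * q.
have C0 : C 0 by exists 0; rewrite rmorph0 mulr0 addr0.
have C1 : C 1 by exists 0; rewrite rmorph1 mulr0 addr0.
have CD g h : C g -> C h -> C (g + h).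
  by move=> [q qE] [r rE]; exists (q + r); rewrite {1}qE {1}rE rmorphD mulrDr addrACA.
have CZ c g : C g -> C (c *: g).
  by move=> [q qE]; exists (c *: q); rewrite {1}qE scalerDr linearZ -scalerAr.
have CM g h : C g -> C h -> C (g * h).
  move=> [q qE] [r rE]; exists (lsub M g * r + q * lsub M h + q * linf e * r).
  rewrite {1}qE {1}rE rmorphM /=; move: (lsub M g) (lsub M h) (linf e) => x y z.
  by ring.
have CX i : C 'X_i.
  exists ((u i 0)%:MP); rewrite lsubX -linf1 -uM linearD linearD /= addrC.
  by congr (_ + _); rewrite row_mul mulmx_sum_row big_ord1 linearZ /= mulrC mul_mpolyC !mxE row_id.
rewrite [f]mpolyE; apply: (big_ind C) => // m _; apply: CZ.
rewrite mpolyXE_id; apply: (big_ind C) => // i _.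
by elim: (m i) => [|k IH]; rewrite ?expr0 // exprS; apply: CM.
Qed.

(** This makes cofactors homogeneous: in a homogeneous multiple of a form the cofactor may be
    replaced by its component one degree lower. *)
Lemma pihomog_linfM n (a : 'rV[K]_n) q j :
  pihomog (@mdeg n) j (linf a * q) =
    if j is j'.+1 then linf a * pihomog (@mdeg n) j' q else 0.
Proof.
pose k := (msize q + j)%N.
have qk : q = \sum_(d < k) pihomog (@mdeg n) d q.
  by apply: pihomog_partitionE; exact: leq_addr.
have hom d : linf a * pihomog (@mdeg n) d q \is d.+1.-homog.
  by rewrite -[d.+1]add1n dhomogM ?linf_homog ?pihomogP.
rewrite {1}qk mulr_sumr linear_sum /=.
case: j @k qk => [|j] k qk.
  by rewrite big1 // => d _; apply: pihomog_ne0 (hom d).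
have jk : (j < k)%N by rewrite /k addnS ltnS leq_addl.
rewrite (bigD1 (Ordinal jk)) //= big1 => [|d dj]; last first.
  by apply: pihomog_ne0 (hom d); rewrite eqSS.
by rewrite addr0 pihomog_dE.
Qed.

End Division.

Section Restriction.
Variables (K : numFieldType) (n : nat) (e : 'rV[K]_n.+1).
Variables (u : 'cV[K]_n.+1) (E : 'M[K]_(n.+1, n)) (P : 'M[K]_(n, n.+1)).
Hypotheses (e0 : e != 0) (eE : e *m E = 0) (PE : P *m E = 1%:M).
Hypothesis uEP : u *m e + E *m P = 1%:M.

Lemma linf_neq0 k (a : 'rV[K]_k) : a != 0 -> linf a != 0.
Proof.
move=> /rV0Pn[i ai]; apply: contraNneq ai => /(congr1 (mcoeff U_(i))).
rewrite mcoeff0 /linf raddf_sum (bigD1 i) //= big1 => [|j ji].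
  by rewrite mcoeffZ mcoeffX eqxx mulr1 addr0 => ->.
rewrite mcoeffZ mcoeffX; case: eqP => [/mnmP/(_ i)|]; last by rewrite mulr0.
by rewrite !mnm1E eqxx (negPf ji).
Qed.

(** Modulo [e], [f] is congruent to the extension by [P] of its restriction, which is zero. In
    degree 0 there is no room for a factor [e]. *)
Lemma homog_ker_restrict j f : f \is j.-homog -> lsub E f = 0 ->
  if j is j'.+1 then exists2 q, q \is j'.-homog & f = linf e * q else f = 0.
Proof.
move=> fj fE; have [q] := lsub_congr f uEP.
rewrite -lsub_comp fE rmorph0 add0r => fq.
have := pihomog_dE fj; rewrite fq pihomog_linfM -fq.
case: j {fj} => [<-|j <-] //.
by exists (pihomog (@mdeg _) j q); rewrite ?pihomogP.
Qed.

(** A basis of the restricted list together with [e] is a basis of [e :: A] with the same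
    complementary positions; the multiplier is carried back by [P]. *)
Lemma cobasis_span_lift A j g : cobasis_span [seq a *m E | a <- A] j g ->
  exists2 f, cobasis_span (e :: A) j f & lsub E f = g.
Proof.
elim=> [|g1 g2 _ [f1 J1 E1] _ [f2 J2 E2]|m h i sm rm rA hi ij].
- by exists 0; rewrite ?rmorph0 //; apply: cobasis_span0.
- by exists (f1 + f2); rewrite ?rmorphD /= ?E1 ?E2 //; apply: cobasis_spanD.
exists (lsub P h * prodl (mask (map negb (true :: m)) (e :: A))).
  rewrite -map_mask in rm rA; rewrite size_map in sm.
  apply: (@cobasis_spanM _ _ _ _ (true :: m) _ i) => //=.
  - by rewrite sm.
  - by rewrite (rk_cons_quotient _ e0 eE PE) rm.
  - by rewrite !(rk_cons_quotient _ e0 eE PE) rA.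
  - exact: lsub_homog.
by rewrite rmorphM /= lsub_comp PE lsub1 lsub_prodl map_mask.
Qed.

(** If [e] depends on [A], it joins the complement of the basis. Otherwise it is added to the basis,
    and the factor [e] is absorbed by the homogeneous multiplier. *)
Lemma cobasis_span_mul A j f : cobasis_span A j f -> cobasis_span (e :: A) j.+1 (linf e * f).
Proof.
elim=> [|f1 f2 _ J1 _ J2|m h i sm rm rA hi ij].
- by rewrite mulr0; apply: cobasis_span0.
- by rewrite mulrDr; apply: cobasis_spanD.
case: (boolP (e <= sp A)%MS) => eA.
  have -> : linf e * (h * prodl (mask (map negb m) A)) =
      h * prodl (mask (map negb (false :: m)) (e :: A)).
    by rewrite mulrCA /= /prodl big_cons.
  apply: (@cobasis_spanM _ _ _ _ (false :: m) _ i) => //=; rewrite ?sm ?rk_cons_sub //.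
  by rewrite -ij addnCA add1n.
rewrite mulrA; have -> : mask (map negb m) A = mask (map negb (true :: m)) (e :: A) by [].
have em : ~~ (e <= sp (mask m A))%MS.
  by apply: contra eA => /submx_trans; apply; apply: spS => a /mem_mask.
apply: (@cobasis_spanM _ _ _ _ (true :: m) _ i.+1) => //=.
- by rewrite sm.
- by rewrite rk_consNsub // rm.
- by rewrite !rk_consNsub // rA.
- by rewrite -[i.+1]add1n dhomogM ?linf_homog.
- by rewrite -ij.
Qed.

End Restriction.

Theorem nullity_ideal_cobasis_span (K : numFieldType) n (A : seq 'rV[K]_n) j f :
  f \is j.-homog -> nullity_ideal A f -> cobasis_span A j f.
Proof.
move: {2}(size A) (leqnn (size A)) => k.
elim: k n A j f => [|k IH] n A j f.
  rewrite leqn0 size_eq0 => /eqP -> fj _.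
  have -> : f = f * prodl (mask (map negb [::]) [::]) by rewrite /prodl big_nil mulr1.
  by apply: (@cobasis_spanM _ _ _ _ [::] _ j) => //; rewrite /= ?addn0 // /rk sp_nil mxrank0.
case: A => [|e A] sA fj fA; first exact: IH.
case: (eqVneq e 0) fA => [->|e0] fA; first by rewrite (nullity_ideal_loop fA); apply: cobasis_span0.
case: n e A f sA fj e0 fA => [|n] e A f sA fj e0 fA.
  by rewrite thinmx0 eqxx in e0.
have [u [E [P [eu eE PE uEP]]]] := hyperplane_splitting e0.
have rkE B := rk_cons_quotient B e0 eE PE.
have /(IH _ _ _ _ _ (lsub_homog E fj)) := nullity_ideal_restrict eE rkE fA.
rewrite size_map => /(_ sA)/(cobasis_span_lift e0 eE PE)[g gJ gE].
have fg : f = g + (f - g) by rewrite addrC subrK.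
rewrite fg; apply: cobasis_spanD => //.
have /(homog_ker_restrict uEP) : f - g \is j.-homog by rewrite rpredB // (cobasis_span_homog gJ).
rewrite rmorphB /= gE subrr => /(_ erefl).
(* The lift [g] satisfies the vanishing conditions itself, hence so does the difference, and its
   quotient by [e] falls under the induction hypothesis. *)
have := nullity_idealD fA (nullity_idealN (cobasis_span_nullity_ideal gJ)).
case: j fj gJ => [|j] fj gJ fgA; first by move=> ->; apply: cobasis_span0.
move=> [q qj qE]; rewrite qE in fgA *; apply: cobasis_span_mul => //.
by apply: IH => //; apply: nullity_ideal_divide e0 fgA.
Qed.

(** * Deletion-restriction for the Hilbert series *)

Section Dimension.
Variable K : fieldType.

Definition linclosed (X : lmodType K) (P : X -> Prop) : Prop :=
  P 0 /\ forall c x y, P x -> P y -> P (c *: x + y).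

Lemma linclosed_sum (X : lmodType K) (P : X -> Prop) m (b : 'I_m -> X) a :
  linclosed P -> (forall i, P (b i)) -> P (\sum_i a i *: b i).
Proof.
move=> [P0 PD] Pb; apply: (big_ind P) => // [x y Px Py|i _].
  by rewrite -[x]scale1r; apply: PD.
by rewrite -[_ *: _]addr0; apply: PD.
Qed.

Lemma has_dim_mem (X : lmodType K) (P : X -> Prop) m (b : 'I_m -> X) :
  (forall x, P x <-> exists a : 'I_m -> K, x = \sum_i a i *: b i) -> forall i, P (b i).
Proof.
move=> Pb i; apply/Pb; exists (fun j => (j == i)%:R).
rewrite (bigD1 i) //= eqxx scale1r big1 ?addr0 // => j /negPf ->.
by rewrite scale0r.
Qed.

Lemma has_dim0 (X : lmodType K) (P : X -> Prop) :
  (forall x, P x <-> x = 0) -> has_dim P 0.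
Proof.
move=> P0; exists (fun _ => 0); split => [a _ []//|x]; rewrite P0; split=> [->|[a ->]].
  by exists (fun _ => 0); rewrite big_ord0.
by rewrite big_ord0.
Qed.

(** Additivity along the exact sequence [0 -> U -> P -> W -> 0]: a basis of [P] consists of the
    images of a basis of [U] and of lifts of a basis of [W]. *)
Lemma has_dim_exact (X Y Z : lmodType K) (U : X -> Prop) (P : Y -> Prop) (W : Z -> Prop)
    (f : {linear X -> Y}) (g : {linear Y -> Z}) a b :
  linclosed P -> (forall x, f x = 0 -> x = 0) -> (forall x, g (f x) = 0) ->
  (forall x, U x -> P (f x)) -> (forall y, P y -> W (g y)) ->
  (forall y, P y -> g y = 0 -> exists2 x, U x & y = f x) ->
  (forall z, W z -> exists2 y, P y & g y = z) ->
  has_dim U a -> has_dim W b -> has_dim P (a + b).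
Proof.
move=> Plin finj gf UP PW ex surj [bU [freeU genU]] [bW [freeW genW]].
have bWP i : exists y, P y /\ g y = bW i.
  by have [y] := surj _ (has_dim_mem genW i); exists y.
have [l lP] := fin_all_exists bWP.
pose B k := match split k with inl i => f (bU i) | inr i => l i end.
have BE c : \sum_k c k *: B k =
    f (\sum_i c (lshift b i) *: bU i) + \sum_i c (rshift a i) *: l i.
  rewrite big_split_ord /=; congr (_ + _).
    rewrite linear_sum; apply: eq_bigr => i _.
    by rewrite linearZ /B; case: split_ordP => j /eqP; rewrite ?eq_lrshift // eq_lshift => /eqP <-.
  apply: eq_bigr => i _.
  by rewrite /B; case: split_ordP => j /eqP; rewrite ?eq_rlshift // eq_rshift => /eqP <-.
have gB c : g (\sum_k c k *: B k) = \sum_i c (rshift a i) *: bW i.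
  rewrite BE linearD gf add0r linear_sum; apply: eq_bigr => i _.
  by rewrite linearZ (lP i).2.
have PB k : P (B k).
  rewrite /B; case: split => i; last by case: (lP i).
  by apply: UP; apply: has_dim_mem genU i.
exists B; split=> [c cB|y].
  have cW : forall i, c (rshift a i) = 0 by apply: freeW; rewrite -gB cB linear0.
  have cU : forall i, c (lshift b i) = 0.
    apply: freeU; apply: finj; move: cB; rewrite BE.
    by rewrite [X in _ + X]big1 ?addr0 // => i _; rewrite cW scale0r.
  by move=> k; rewrite -(splitK k) /unsplit; case: split.
split=> [Py|[c ->]]; last exact: linclosed_sum.
have [cW cWE] := (genW _).1 (PW _ Py).
have Pl : P (\sum_i cW i *: l i) by apply: linclosed_sum => // i; case: (lP i).
have [x Ux xE] : exists2 x, U x & y - \sum_i cW i *: l i = f x.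
  apply: ex.
    by rewrite addrC -scaleN1r; case: Plin => _; apply.
  rewrite linearB cWE linear_sum; apply/eqP; rewrite subr_eq0; apply/eqP.
  by apply: eq_bigr => i _; rewrite linearZ (lP i).2.
have [cU cUE] := (genU _).1 Ux.
exists (fun k => match split k with inl i => cU i | inr i => cW i end).
rewrite BE -[LHS](subrK (\sum_i cW i *: l i)) xE cUE; congr (f _ + _).
  by apply: eq_bigr => i _; case: split_ordP => j /eqP; rewrite ?eq_lrshift // eq_lshift => /eqP <-.
by apply: eq_bigr => i _; case: split_ordP => j /eqP; rewrite ?eq_rlshift // eq_rshift => /eqP <-.
Qed.

Lemma eq_has_dim (X : lmodType K) (P Q : X -> Prop) m :
  (forall x, P x <-> Q x) -> has_dim P m -> has_dim Q m.
Proof. by move=> PQ [b [fb gb]]; exists b; split=> // x; rewrite -PQ. Qed.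

End Dimension.

Section GradedExact.
Variables (K : numFieldType) (n : nat) (e : 'rV[K]_n.+1).
Variables (u : 'cV[K]_n.+1) (E : 'M[K]_(n.+1, n)) (P : 'M[K]_(n, n.+1)).
Hypotheses (e0 : e != 0) (eE : e *m E = 0) (PE : P *m E = 1%:M).
Hypothesis uEP : u *m e + E *m P = 1%:M.

(** The sequence formed by multiplication by [e], which raises degrees by one and so has nothing on
    the left in degree 0, and restriction to the kernel. The three predicates stay abstract because
    it serves both for a list of forms and for the whole polynomial ring. *)
Lemma graded_exact (Q' Q : {mpoly K[n.+1]} -> Prop) (Q'' : {mpoly K[n]} -> Prop) j c b :
  linclosed Q ->
  (forall i f, f \is i.-homog -> Q' f -> Q (linf e * f)) ->
  (forall f, Q (linf e * f) -> Q' f) ->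
  (forall f, Q f -> Q'' (lsub E f)) ->
  (forall i g, g \is i.-homog -> Q'' g -> exists f, [/\ f \is i.-homog, Q f & lsub E f = g]) ->
  (if j is i.+1 then has_dim (graded_piece Q' i) c else c = 0%N) ->
  has_dim (graded_piece Q'' j) b -> has_dim (graded_piece Q j) (c + b).
Proof.
move=> [Q0 QD] Qmul Qdiv Qres Qlift dU dW.
have fl : linear (fun f => linf e * f).
  by move=> a x y /=; rewrite mulrDr -scalerAr.
pose ml := GRing.isLinear.Build _ _ _ _ _ fl.
pose f : {linear {mpoly K[n.+1]} -> {mpoly K[n.+1]}} := HB.pack (fun f => linf e * f) ml.
pose U q := if j is i.+1 then graded_piece Q' i q else q = 0.
apply: (has_dim_exact (U := U) (W := graded_piece Q'' j) (f := f) (g := lsub E)) => //.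
- split=> [|a x y [Qx hx] [Qy hy]]; first by split; rewrite ?rpred0.
  by split; [apply: QD | rewrite rpredD ?rpredZ].
- by move=> x /eqP; rewrite /= mulf_eq0 (negPf (linf_neq0 e0)) => /eqP.
- by move=> x; rewrite /= rmorphM /= lsub_linf eE linear0 mul0r.
- rewrite /U; case: j {dU dW U} => [|i] x /=.
    by move=> ->; rewrite mulr0; split; rewrite ?rpred0.
  by move=> [Qx hx]; split; [apply: Qmul hx Qx | rewrite -[i.+1]add1n dhomogM ?linf_homog].
- by move=> y [Qy hy]; split; [apply: Qres | apply: lsub_homog].
- move=> y [Qy hy] yE; have := homog_ker_restrict uEP hy yE; rewrite /U.
  case: j {dU dW U hy} => [->|i [q qi qE]]; first by exists 0; rewrite ?linear0.
  by exists q => //; split=> //; apply: Qdiv; rewrite -qE.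
- by move=> z [Qz hz]; have [y [hy Qy yE]] := Qlift _ _ hz Qz; exists y.
rewrite /U; case: j dU {dW U} => [->|i //].
exact: has_dim0.
Qed.

End GradedExact.

(** * Whitney's sum over sublists of forms *)

Fixpoint sublists (T : Type) (s : seq T) : seq (seq T) :=
  if s is x :: s' then sublists s' ++ map (cons x) (sublists s') else [:: [::]].

Lemma sublists_map T U (f : T -> U) s :
  sublists (map f s) = map (map f) (sublists s).
Proof. by elim: s => //= x s ->; rewrite map_cat -!map_comp. Qed.

Lemma sublists_subseq (T : eqType) (s B : seq T) : (B \in sublists s) = subseq B s.
Proof.
elim: s B => [|x s IH] B; first by rewrite inE subseq0.
rewrite mem_cat IH; case: B => [|y B]; first by rewrite !sub0seq.
rewrite /=; case: eqVneq => [<-|yx].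
  rewrite mem_map ?IH; last by move=> ? ? [].
  by apply/orP/idP => [[/cons_subseq|]|->]; last by right.
rewrite (_ : (_ \in map _ _) = false) ?orbF //.
by apply/negP => /mapP[C _ [yx' _]]; rewrite yx' eqxx in yx.
Qed.

(** With ['X] as [t] and [d] the number of forms, this is [t^d pi(A, t^-1 - 1)], with [pi] expanded
    over sublists and the negative powers of [t] cleared. Sublists are taken by position, so
    repeated forms count separately. *)
Definition whitney (K : fieldType) n (A : seq 'rV[K]_n) : {poly int} :=
  \sum_(B <- sublists A)
    (-1) ^+ (size B + rk B) *: ('X^(size A - rk B) * (1 - 'X) ^+ rk B).

(** The terms of [B] and [0 :: B] cancel. *)
Lemma whitney_loop (K : fieldType) n (A : seq 'rV[K]_n) : whitney (0 :: A) = 0.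
Proof.
rewrite /whitney /= big_cat big_map /= -big_split big1 // => B _ /=.
by rewrite rk_cons_sub ?sub0mx // addSn exprS mulN1r scaleNr subrr.
Qed.

Lemma whitney_cons (K : fieldType) n (e : 'rV[K]_n.+1) (E : 'M_(n.+1, n)) P A :
  e != 0 -> e *m E = 0 -> P *m E = 1%:M ->
  whitney (e :: A) = 'X * whitney A + (1 - 'X) * whitney [seq a *m E | a <- A].
Proof.
move=> e0 eE PE; rewrite /whitney /= big_cat big_map /=; congr (_ + _).
  rewrite mulr_sumr [LHS]big_seq [RHS]big_seq; apply: eq_bigr => B.
  rewrite sublists_subseq => /size_subseq BA.
  rewrite subSn ?exprS ?(leq_trans (rk_size _)) //.
  by rewrite -scalerAr mulrA.
rewrite sublists_map big_map mulr_sumr; apply: eq_bigr => B _ /=.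
rewrite (rk_cons_quotient _ e0 eE PE) !size_map subSS addSnnS addnS addnS.
by rewrite 2!exprS mulrA mulrNN mulr1 mul1r -scalerAr exprS mulrCA.
Qed.

(* [w] is the product of [p] with the power series of coefficients [H]. *)
Definition expands (p : {poly int}) (H : nat -> nat) (w : {poly int}) :=
  forall k, (p * \poly_(i < k.+1) (H i)%:Z)`_k = w`_k.

Lemma eq_coefMl (p q r : {poly int}) k :
  (forall i, (i <= k)%N -> q`_i = r`_i) -> (p * q)`_k = (p * r)`_k.
Proof. by move=> qr; rewrite !coefM; apply: eq_bigr => i _; rewrite qr ?leq_subr. Qed.

Lemma expandsE p H w m k : expands p H w -> (k < m)%N ->
  (p * \poly_(i < m) (H i)%:Z)`_k = w`_k.
Proof.
move=> pH km; rewrite -pH; apply: eq_coefMl => i ik.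
by rewrite !coef_poly ltnS ik (leq_ltn_trans ik km).
Qed.

(** The restricted ideal lives in one variable fewer, so its denominator lacks a factor [1 - 'X],
    which reappears as the coefficient of [w'']. The factor ['X] is the degree shift. *)
Lemma expands_step p H' w' H'' w'' : expands (p * (1 - 'X)) H' w' -> expands p H'' w'' ->
  expands (p * (1 - 'X)) (fun j => (if j is i.+1 then H' i else 0) + H'' j)%N
    ('X * w' + (1 - 'X) * w'').
Proof.
move=> pH' pH'' k; set S := \poly_(i < _) _.
pose S' := \poly_(i < k.+1) (H' i)%:Z; pose S'' := \poly_(i < k.+1) (H'' i)%:Z.
rewrite (@eq_coefMl _ _ ('X * S' + S'')) => [|i ik].
  have -> : p * (1 - 'X) * ('X * S' + S'') =
     'X * (p * (1 - 'X) * S') + (1 - 'X) * (p * S'') by ring.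
  rewrite !coefD; congr (_ + _).
    rewrite !coefXM; case: eqP => // k0.
    by apply: expandsE pH' _; rewrite ltnS leq_pred.
  by apply: eq_coefMl => i ik; apply: expandsE.
rewrite coefD coefXM !coef_poly ltnS ik; case: i ik => [|i] ik //=.
by rewrite ltnS (ltnW ik).
Qed.

Theorem hilbert_nullity_ideal (K : numFieldType) n (A : seq 'rV[K]_n) :
  exists2 H, is_hilbert_series (nullity_ideal A) H & expands ((1 - 'X) ^+ n) H (whitney A).
Proof.
move: {2}(size A) (leqnn (size A)) => k; elim: k n A => [|k IH] n A.
  rewrite leqn0 size_eq0 => /eqP ->.
  rewrite (_ : whitney [::] = 1); last first.
    by rewrite /whitney big_seq1 /rk sp_nil mxrank0 /= !expr0 scale1r mulr1.
  have dim0 m j f : graded_piece (@nullity_ideal K m [::]) j f <-> f \is j.-homog.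
    by split=> [[]//|fj]; split=> //; apply: nullity_ideal_nil.
  elim: n {A} => [|n [H HH Hn]].
    exists (fun j => (j == 0)%N) => [j|i]; last first.
      by rewrite expr0 mul1r coef_poly ltnSn coef1; case: eqP.
    case: j => [|j] /=; last first.
      apply: has_dim0 => f; rewrite dim0; split=> [fj|->]; last exact: rpred0.
      apply/eqP/negPn/negP => f0.
      by have := dhomog_uniq f0 fj (nvar0_homog _ f).
    exists (fun _ => 1); split=> [a|f].
      by rewrite big_ord1 => /eqP; rewrite scaler_eq0 oner_eq0 orbF => /eqP a0 i; rewrite ord1.
    rewrite dim0; split=> [_|_]; last exact: nvar0_homog.
    exists (fun _ => f@_0); rewrite big_ord1 -mul_mpolyC mulr1.
    apply/mpolyP => m; rewrite mcoeffC; have -> : m = 0%MM by apply/mnmP => -[].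
    by rewrite eqxx mulr1.
  (* Without forms the ideal is the whole ring. One more variable replaces the Hilbert function by
     its partial sums, by the same exact sequence for an arbitrary nonzero form. *)
  pose G j := (\sum_(i < j.+1) H i)%N.
  exists G => [j|i].
    pose e : 'rV[K]_n.+1 := const_mx 1.
    have e0 : e != 0 by apply/rV0Pn; exists 0; rewrite mxE oner_eq0.
    have [u [E [P [eu eE PE uEP]]]] := hyperplane_splitting e0.
    have -> : G j = ((if j is i.+1 then G i else 0) + H j)%N.
      by rewrite /G big_ord_recr /=; case: j => [|j] //=; rewrite big_ord0.
    elim: j => [|j IHj]; last first.
      apply: (graded_exact (Q' := nullity_ideal [::]) (Q'' := nullity_ideal [::]) e0 eE uEP) => //.
      - by split=> [|c x y]; [apply: nullity_ideal0 | apply: nullity_ideal_lin].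
      - by move=> *; apply: nullity_ideal_nil.
      - by move=> *; apply: nullity_ideal_nil.
      - by move=> *; apply: nullity_ideal_nil.
      - move=> i g gi _; exists (lsub P g); split; first exact: lsub_homog.
          exact: nullity_ideal_nil.
        by rewrite lsub_comp PE lsub1.
      rewrite (_ : G j = ((if j is i.+1 then G i else 0) + H j)%N) //.
      by rewrite /G big_ord_recr /=; case: j {IHj} => [|j] //=; rewrite big_ord0.
    apply: (graded_exact (Q' := nullity_ideal [::]) (Q'' := nullity_ideal [::]) e0 eE uEP) => //.
    - by split=> [|c x y]; [apply: nullity_ideal0 | apply: nullity_ideal_lin].
    - by move=> *; apply: nullity_ideal_nil.
    - by move=> *; apply: nullity_ideal_nil.
    - by move=> *; apply: nullity_ideal_nil.
    - move=> i g gi _; exists (lsub P g); split; first exact: lsub_homog.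
        exact: nullity_ideal_nil.
      by rewrite lsub_comp PE lsub1.
  rewrite exprSr -mulrA -Hn; apply: eq_coefMl => m mi.
  rewrite mulrBl mul1r coefB coefXM !coef_poly ltnS mi.
  case: m mi => [|m] mi /=; first by rewrite subr0 /G big_ord1.
  by rewrite ltnS (ltnW mi) /G big_ord_recr /= PoszD addrC addKr.
case: A => [|e A] sA; first exact: IH.
case: (eqVneq e 0) => [->|e0].
  exists (fun _ => 0%N) => [j|i]; last first.
    by rewrite whitney_loop coef0 (@eq_coefMl _ _ 0) ?mulr0 ?coef0 // => *; rewrite coef_poly if_same coef0.
  apply: has_dim0 => f; split=> [[/nullity_ideal_loop]//|->].
  by split; [apply: nullity_ideal0 | apply: rpred0].
case: n e A sA e0 => [|n] e A sA e0; first by rewrite thinmx0 eqxx in e0.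
have [u [E [P [eu eE PE uEP]]]] := hyperplane_splitting e0.
have rkE B := rk_cons_quotient B e0 eE PE.
have [H' HH' wH'] := IH _ A sA.
have [H'' HH'' wH''] := IH _ [seq a *m E | a <- A] (leq_trans (eq_leq (size_map _ _)) sA).
exists (fun j => (if j is i.+1 then H' i else 0) + H'' j)%N; last first.
  by rewrite (whitney_cons _ e0 eE PE) exprSr; apply: expands_step; rewrite -?exprSr.
move=> j; apply: (graded_exact (Q' := nullity_ideal A)
  (Q'' := nullity_ideal [seq a *m E | a <- A]) e0 eE uEP).
- by split=> [|c x y]; [apply: nullity_ideal0 | apply: nullity_ideal_lin].
- move=> i f fi fA; apply: cobasis_span_nullity_ideal (cobasis_span_mul e _).
  exact: (nullity_ideal_cobasis_span fi fA).
- by move=> f; apply: nullity_ideal_divide.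
- by move=> f; apply: nullity_ideal_restrict.
(* Surjectivity of restriction is obtained through the second ideal, whose generators lift
   explicitly. *)
- move=> i g gi gA; have [f fJ fE] := cobasis_span_lift e0 eE PE (nullity_ideal_cobasis_span gi gA).
  by exists f; split=> //; [apply: cobasis_span_homog fJ | apply: cobasis_span_nullity_ideal fJ].
- by case: j => [|j] //; apply: HH'.
exact: HH''.
Qed.

(** * Whitney's expansion of the Poincare polynomial *)

Section Lattice.
Variables (K : fieldType) (V : vectType K) (n : nat) (e : n.-tuple V).
Hypothesis he : basis_of {:V} e.

Definition form_row (H : {vspace V}) : 'rV[K]_n :=
  \row_i hyperplane_form H (tnth e i).

Lemma arrangement_polyE d (A : d.-tuple {vspace V}) :
  arrangement_poly e A = prodl [seq form_row H | H <- A].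
Proof.
rewrite /arrangement_poly /prodl big_map; apply: eq_bigr => H _.
by apply: eq_bigr => i _; rewrite mxE.
Qed.

Definition coord_col (v : V) : 'cV[K]_n := \col_i coord e i v.

Lemma form_row_coordE H v : (form_row H *m coord_col v) 0 0 = hyperplane_form H v.
Proof.
rewrite [in RHS](coord_basis he (memvf v)) linear_sum mxE; apply: eq_bigr => i _.
by rewrite linearZ /= !mxE -tnth_nth mulrC.
Qed.

Lemma form_row_coord H v : is_hyperplane H -> (v \in H) = (form_row H *m coord_col v == 0).
Proof.
move=> hH; rewrite -{1}(hyperplane_formP hH) memv_ker -form_row_coordE.
by apply/eqP/eqP => [h|->]; [apply/matrixP => i j; rewrite !ord1 h mxE | rewrite mxE].
Qed.

Lemma dim_full : \dim {:V} = n.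
Proof. by rewrite (vector.size_basis he). Qed.

Definition cap (B : seq {vspace V}) : {vspace V} := (\bigcap_(H <- B) H)%VS.

Lemma memv_cap_seq B v : (v \in cap B) = all (fun H : {vspace V} => v \in H) B.
Proof.
elim: B => [|H B IH]; rewrite /cap ?big_nil ?memvf // big_cons memv_cap /=.
by rewrite -IH.
Qed.

Lemma memv_cap_forms B v : all (@is_hyperplane K V) B ->
  (v \in cap B) = (sp [seq form_row H | H <- B] *m coord_col v == 0).
Proof.
move=> hB; rewrite memv_cap_seq; apply/allP/eqP => [vB|vB H HB].
  apply/sub_kermxP/sub_sp => _ /mapP[H HB ->]; apply/sub_kermxP/eqP.
  by rewrite -form_row_coord ?(allP hB) ?vB.
rewrite form_row_coord ?(allP hB) //.
have /submxP[D ->] : (form_row H <= sp [seq form_row H | H <- B])%MS.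
  by apply/mem_sp/map_f.
by rewrite -mulmxA vB mulmx0.
Qed.

(** If the form of [H] depends on those of [B], the intersection does not change. Otherwise a column
    of the cokernel gives a vector of the intersection outside [H], so that [H] and the intersection
    span the space. *)
Lemma dim_cap B : all (@is_hyperplane K V) B ->
  \dim (cap B) = (n - rk [seq form_row H | H <- B])%N.
Proof.
elim: B => [|H B IH]; first by rewrite /cap big_nil dim_full /rk sp_nil mxrank0 subn0.
move=> /andP[hH hB]; rewrite {1}/cap big_cons -/(cap B) [map _ _]/=.
case: (boolP (form_row H <= sp [seq form_row H | H <- B])%MS) => aB.
  rewrite rk_cons_sub // -IH //; congr (\dim _); apply/capv_idPr.
  apply/subvP => v; rewrite memv_cap_forms // form_row_coord // => /eqP vB.
  by have /submxP[D ->] := aB; rewrite -mulmxA vB mulmx0.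
rewrite rk_consNsub //; move: aB; rewrite submxE => /rV0Pn[j aj].
pose y := col j (cokermx (sp [seq form_row H | H <- B])).
pose v := \sum_i y i 0 *: tnth e i.
have yE : coord_col v = y.
  apply/colP => i; rewrite mxE /v.
  have -> : \sum_i y i 0 *: tnth e i = \sum_i y i 0 *: e`_i.
    by apply: eq_bigr => k _; rewrite (tnth_nth 0).
  by rewrite coord_sum_free // (basis_free he).
have vB : v \in cap B.
  by rewrite memv_cap_forms // yE /y colE mulmxA mulmx_coker mul0mx.
have vH : v \notin H.
  rewrite form_row_coord // yE /y colE mulmxA -colE.
  by apply: contraNneq aj => /colP/(_ 0); rewrite !mxE => ->.
have /eqP dH := hH; rewrite dim_full in dH.
have dS : \dim (H + cap B) = n.
  apply/eqP; rewrite eqn_leq -{1}dim_full dimvS ?subvf //= -dH.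
  rewrite ltnNge; apply: contra vH => le.
  have /eqP -> : H == (H + cap B)%VS by rewrite eqEdim addvSl.
  by apply: subvP vB; apply: addvSr.
have := dimv_sum_cap H (cap B); rewrite dS IH //.
by move: (rk _) (\dim H) dH (\dim (H :&: cap B)) => r h dH x; lia.
Qed.

Lemma cap_bigcap d (A : d.-tuple {vspace V}) (I : {set 'I_d}) :
  (\bigcap_(i in I) tnth A i)%VS = cap [seq tnth A i | i <- enum I].
Proof. by rewrite /cap big_map big_enum. Qed.

Lemma eq_cap (B C : seq {vspace V}) : B =i C -> cap B = cap C.
Proof.
by move=> BC; apply/vspaceP => v; rewrite !memv_cap_seq; apply: eq_all_r.
Qed.

Lemma mem_lattice d (A : d.-tuple {vspace V}) B : B \in sublists A ->
  cap B \in intersection_lattice A.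
Proof.
rewrite sublists_subseq => BA; rewrite mem_undup; apply/mapP.
exists [set i | tnth A i \in B]; first by rewrite mem_enum.
rewrite cap_bigcap; apply: eq_cap => H; apply/idP/mapP => [HB|[i]].
  have /tnthP[i iE] : H \in A by apply: mem_subseq HB.
  by exists i => //; rewrite mem_enum inE -iE.
by rewrite mem_enum inE => iB ->.
Qed.

Lemma lattice_sub d (A : d.-tuple {vspace V}) W : W \in intersection_lattice A ->
  W != fullv -> has (fun H => W <= H)%VS A.
Proof.
rewrite mem_undup => /mapP[I _ ->] neq; case: (set_0Vmem I) => [I0|[i iI]].
  by rewrite I0 big_set0 eqxx in neq.
apply/hasP; exists (tnth A i); first exact: mem_tnth.
by apply: bigcapv_inf iI _; apply: subvv.
Qed.

(** Inserting or removing an element that satisfies [p] pairs off terms of opposite sign; without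
    such an element only the empty sublist contributes. *)
Lemma signed_sublists (T : Type) (p : pred T) (s : seq T) :
  \sum_(B <- sublists s | all p B) (-1) ^+ size B = (~~ has p s)%:R :> int.
Proof.
elim: s => [|x s IH]; first by rewrite big_mkcond big_seq1.
rewrite /= big_cat big_map /= IH; case: (p x) => /=; last by rewrite big_pred0 ?addr0.
rewrite (eq_bigr (fun B => -1 * (-1) ^+ size B)) => [|B _]; last by rewrite exprS.
by rewrite -mulr_sumr IH mulN1r subrr.
Qed.

Lemma subv_cap (W : {vspace V}) B : (W <= cap B)%VS = all (fun H => W <= H)%VS B.
Proof.
elim: B => [|H B IH]; rewrite /cap ?big_nil ?subvf // big_cons subv_cap /=.
by rewrite -IH.
Qed.

(** The right side satisfies the recursion of the Moebius function: summed over the flats containing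
    [W'], it becomes the signed count of sublists of the hyperplanes containing [W'], which is 0
    unless [W'] is the whole space. Induction on the codimension then identifies the two. *)
Lemma mobius_whitney d (A : d.-tuple {vspace V}) W : all (@is_hyperplane K V) A ->
  W \in intersection_lattice A ->
  mobius (intersection_lattice A) fullv W =
    \sum_(B <- sublists A | cap B == W) (-1) ^+ size B.
Proof.
move=> hA; set L := intersection_lattice A.
have uL : uniq L by apply: undup_uniq.
pose m W' : int := \sum_(B <- sublists A | cap B == W') (-1) ^+ size B.
have msum W' : W' \in L -> \sum_(Z <- L | (W' <= Z)%VS) m Z = (W' == fullv)%:R.
  move=> W'L; rewrite (exchange_big_dep (fun B => W' <= cap B)%VS) /=; last first.
    by move=> Z B leZ /eqP ->.
  rewrite [LHS]big_seq_cond.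
  rewrite (eq_bigr (fun B => (-1) ^+ size B)) => [|B /andP[BA WB]].
    rewrite -big_seq_cond (eq_bigl _ _ (subv_cap W')) signed_sublists.
    case: eqP => [->|/eqP /(lattice_sub W'L)->] //.
    suff -> : has (fun H : {vspace V} => fullv <= H)%VS A = false by [].
    apply/hasPn => H HA; apply/negP => /dimvS; rewrite dim_full.
    by have /eqP := allP hA _ HA; rewrite dim_full => <-; rewrite ltnn.
  rewrite (eq_bigl (fun Z => Z == cap B)); last first.
    by move=> Z; rewrite eq_sym; case: eqP => [->|]; rewrite ?WB ?andbF.
  by rewrite -big_filter filter_pred1_uniq ?mem_lattice // big_seq1.
have sumD (x : {vspace V} -> int) W' : W' \in L -> \sum_(Z <- L | (W' <= Z)%VS) x Z =
    x W' + \sum_(Z <- L | (W' <= Z)%VS && (Z != W')) x Z.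
  move=> W'L; rewrite -big_filter (bigD1_seq W') ?filter_uniq ?mem_filter ?subvv //=.
  by rewrite big_filter_cond.
have mV : fullv \in L -> mobius L fullv fullv = m fullv.
  move=> VL; have := msum _ VL; rewrite sumD // eqxx mobius_refl big_pred0 ?addr0 => [->//|Z].
  by apply/negP => /andP[VZ /negP]; rewrite eqEsubv subvf VZ.
move: {2}(n - \dim W)%N (leqnn (n - \dim W)%N) => k.
elim: k W => [|k IH] W Wk WL; rewrite -/(m W); case: (eqVneq W fullv) WL => [-> //|WV] WL.
  case/eqP: WV; apply/eqP; rewrite eqEdim subvf dim_full /=.
  by move: Wk; rewrite leqn0 subn_eq0.
have := msum _ WL; rewrite sumD // (negPf WV).
have := mobius_sum uL WL (subvf W); rewrite eq_sym WV => /(_ isT).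
rewrite (eq_bigl (fun Z => W <= Z)%VS) => [|Z]; last by rewrite subvf andbT.
rewrite sumD // => mob /esym /(etrans mob).
rewrite [X in mobius _ _ _ + X](_ : _ = \sum_(Z <- L | (W <= Z)%VS && (Z != W)) m Z).
  exact: addIr.
rewrite big_seq_cond [RHS]big_seq_cond; apply: eq_bigr => Z /and3P[ZL WZ ZW].
apply: IH ZL; have := ltn_dimv WZ ZW.
by move: Wk; move: (\dim W) (\dim Z) => a b; lia.
Qed.

(** The sublists are grouped by their intersection, whose codimension is the rank of the forms. *)
Lemma poincare_polyE d (A : d.-tuple {vspace V}) : all (@is_hyperplane K V) A ->
  poincare_poly A = \sum_(B <- sublists A)
     (-1) ^+ size B *: (- 'X) ^+ rk [seq form_row H | H <- B].
Proof.
move=> hA; rewrite /poincare_poly; set L := intersection_lattice A.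
rewrite big_seq (eq_bigr (fun W => \sum_(B <- sublists A | cap B == W)
   (-1) ^+ size B *: (- 'X) ^+ codim (cap B))) => [|W WL]; last first.
  rewrite mobius_whitney // rmorph_sum mulr_suml /=; apply: eq_bigr => B /eqP <-.
  by rewrite mul_polyC.
rewrite -big_seq (exchange_big_dep predT) //= big_seq [RHS]big_seq.
apply: eq_bigr => B BA; rewrite (eq_bigl (pred1 (cap B))); last first.
  by move=> W; rewrite /= eq_sym.
rewrite -big_filter filter_pred1_uniq ?undup_uniq ?mem_lattice // big_seq1.
have hB : all (@is_hyperplane K V) B.
  by apply/allP => H HB; apply: (allP hA); move: BA; rewrite sublists_subseq => /mem_subseq; apply.
congr (_ *: _ ^+ _); rewrite /codim dim_cap // dim_full.
by rewrite subKn // rank_leq_col.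
Qed.

Lemma expr_shift_inv (F : fieldType) (t : F) d r s : t != 0 -> (r <= d)%N ->
  t ^+ d * ((-1) ^+ s * (- (t^-1 - 1)) ^+ r) =
  (-1) ^+ (s + r) * (t ^+ (d - r) * (1 - t) ^+ r).
Proof.
move=> t0 rd; have -> : - (t^-1 - 1) = - ((1 - t) / t).
  by rewrite mulrBl mul1r divff.
rewrite (exprNn (_ / _)) exprMn exprVn -{1}(subnK rd) !exprD.
by have tr : t ^+ r != 0 by [rewrite expf_neq0]; field.
Qed.

Lemma poincare_whitney d (A : d.-tuple {vspace V}) : all (@is_hyperplane K V) A ->
  let t : {fraction {poly int}} := tofrac 'X in
  t ^+ d / (1 - t) ^+ n * (map_poly intr (poincare_poly A)).[t^-1 - 1]
    * tofrac ((1 - 'X) ^+ n) = tofrac (whitney [seq form_row H | H <- A]).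
Proof.
move=> hA t; have t0 : t != 0 by rewrite tofrac_eq0 polyX_eq0.
have t1 : 1 - t = tofrac (1 - 'X) by rewrite rmorphB rmorph1.
have t10 : 1 - t != 0.
  rewrite t1 tofrac_eq0; apply/eqP => /polyP/(_ 0%N).
  by rewrite coefB coef1 coefX coef0.
rewrite rmorphXn /= -t1 mulrAC divfK ?expf_neq0 // poincare_polyE // /whitney.
rewrite sublists_map big_map !rmorph_sum horner_sum mulr_sumr big_seq [RHS]big_seq.
apply: eq_bigr => B; rewrite sublists_subseq => /size_subseq; rewrite size_tuple => BA.
have rB := leq_trans (rk_size [seq form_row H | H <- B]) (eq_leq (size_map _ _)).
rewrite -!mul_polyC !rmorphM /= !size_map size_tuple.
rewrite hornerM map_polyC hornerC /= !rmorph_sign !rmorphXn rmorphN /= map_polyX.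
rewrite horner_exp hornerN hornerX -t1.
exact: (expr_shift_inv _ t0 (leq_trans rB BA)).
Qed.

End Lattice.

End Algebra.
Import Algebra.

From mathcomp Require Import all_classical all_reals all_analysis.
From mathcomp Require Import complex.
From mathcomp Require Import(canonicals, coercions) mpoly.
Import Order.TTheory GRing.Theory Num.Theory.

Module Analysis.
From mathcomp Require Import measurable_realfun lra ring.
Local Open Scope classical_set_scope.
Local Open Scope ring_scope.
Set Implicit Arguments.
Unset Strict Implicit.
Unset Printing Implicit Defensive.

(** * Lebesgue measure under affine maps *)

Section Preserving.
Variable R : realType.

Definition preserving d (T : measurableType d) (mu : set T -> \bar R) (f : T -> T) :=
  measurable_fun setT f /\ forall A, measurable A -> mu (f @^-1` A) = mu A.

Lemma measurable_preimage d1 d2 (T1 : measurableType d1) (T2 : measurableType d2)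
    (f : T1 -> T2) A : measurable_fun setT f -> measurable A -> measurable (f @^-1` A).
Proof. by move=> mf mA; rewrite -[X in measurable X]setTI; exact: mf. Qed.

(** The pushforward agrees with the product measure on rectangles, which determines it. *)
Lemma preserving_prod d1 d2 (T1 : measurableType d1) (T2 : measurableType d2)
    (m1 : {sigma_finite_measure set T1 -> \bar R})
    (m2 : {sigma_finite_measure set T2 -> \bar R}) f1 f2 :
  preserving m1 f1 -> preserving m2 f2 ->
  preserving (prod_measure m1 m2) (fun p => (f1 p.1, f2 p.2)).
Proof.
move=> [mf1 p1] [mf2 p2].
have mf : measurable_fun setT (fun p : T1 * T2 => (f1 p.1, f2 p.2)).
  by apply: measurable_fun_pair; exact: measurableT_comp.
split=> // A mA; symmetry.
pose nu := measure_function_pushforward__canonical__measure_function_Measure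
  (prod_measure m1 m2) mf.
apply: (@product_measure_unique _ _ _ _ _ m1 m2 nu) => // B C mB mC.
rewrite /= /pushforward (_ : _ @^-1` _ = (f1 @^-1` B) `*` (f2 @^-1` C)) //.
have mB' := measurable_preimage mf1 mB; have mC' := measurable_preimage mf2 mC.
by rewrite -(p1 _ mB) -(p2 _ mC); exact: product_measure1E.
Qed.

Lemma preserving_lebesgue (a : R) :
  preserving (lebesgue_measure : set (measurableTypeR R) -> _) (fun x => x + a).
Proof.
have mf : measurable_fun setT ((fun x => x + a) : measurableTypeR R -> measurableTypeR R).
  exact: measurable_funD.
split=> // A mA; symmetry.
pose nu := measure_function_pushforward__canonical__measure_function_Measure
  (@lebesgue_measure R) mf.
apply: (@lebesgue_measure_unique _ nu) => // _ [[b c]] _ <-.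
rewrite /= /pushforward (_ : _ @^-1` _ = `]b - a, c - a]%classic); last first.
  apply/seteqP; split=> x /=; rewrite !in_itv /=.
    by rewrite ltrBlDr lerBrDr.
  by rewrite ltrBlDr lerBrDr.
rewrite !lebesgue_measure_itv /= !lte_fin ltrD2r.
by case: ifP => // _; rewrite -!EFinD; congr (_%:E); rewrite opprB addrA subrK.
Qed.

Section Tuple.
Context d (T : measurableType d) (mu : {sigma_finite_measure set T -> \bar R}).

Definition tuple_apply n (f : 'I_n -> T -> T) (z : n.-tuple T) : n.-tuple T :=
  [tuple f i (tnth z i) | i < n].

Lemma preserving_tuple n (f : 'I_n -> T -> T) :
  (forall i, preserving mu (f i)) -> preserving (power_measure mu n) (tuple_apply f).
Proof.
elim: n f => [|n IH] f pf.
  have -> : tuple_apply f = id by apply/funext => z; apply: eq_from_tnth => -[].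
  by split=> [|A mA]; [exact: measurable_id | rewrite preimage_id].
split.
  apply/measurable_fun_tnthP => i.
  rewrite (_ : _ \o _ = f i \o (fun z => tnth z i)); last first.
    by apply/funext => z /=; rewrite tnth_mktuple.
  by apply: measurableT_comp; [case: (pf i) | exact: measurable_tnth].
move=> A mA; have [mg pg] := preserving_prod (pf ord0) (IH _ (fun i => pf (lift ord0 i))).
have mA' := measurable_preimage (@measurable_tuple_cons _ T n) mA.
rewrite /= /power_measureS /pushforward -[RHS]pg //; congr (prod_measure _ _ _).
apply/seteqP; split=> -[x t] /= H.
  rewrite /preimage /= (_ : tuple_cons _ = tuple_apply f (tuple_cons (x, t))) //.
  apply: eq_from_tnth => i; rewrite tnth_mktuple.
  by case: (unliftP ord0 i) => [j|] ->; rewrite ?tnthS ?tnth0 ?tnth_mktuple.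
rewrite /preimage /= (_ : tuple_apply f _ =
  tuple_cons (f ord0 x, tuple_apply (fun i => f (lift ord0 i)) t)) //.
apply: eq_from_tnth => i; rewrite tnth_mktuple.
by case: (unliftP ord0 i) => [j|] ->; rewrite ?tnthS ?tnth0 ?tnth_mktuple.
Qed.

End Tuple.

End Preserving.

Notation normc := Normc.normc.

(** * Moduli and measurability of complex-valued functions *)

Section ComplexMeasurable.
Variable R : realType.
Implicit Types z : R[i].

Lemma normc_ge0 z : 0 <= normc z.
Proof. by case: z => a b; rewrite sqrtr_ge0. Qed.

Lemma Re_le_normc z : `|complex.Re z| <= normc z.
Proof.
by case: z => a b /=; rewrite -sqrtr_sqr ler_wsqrtr // lerDl sqr_ge0.
Qed.

Lemma Im_le_normc z : `|complex.Im z| <= normc z.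
Proof.
by case: z => a b /=; rewrite -sqrtr_sqr ler_wsqrtr // lerDr sqr_ge0.
Qed.

Lemma normc_le_ReIm z : normc z <= `|complex.Re z| + `|complex.Im z|.
Proof.
case: z => a b /=; rewrite -[leRHS]ger0_norm ?addr_ge0 // -sqrtr_sqr.
rewrite ler_wsqrtr // sqrrD !real_normK ?num_real //.
by rewrite addrAC lerDl mulrn_wge0 // mulr_ge0.
Qed.

Lemma le_normc_sum I (s : seq I) (F : I -> R[i]) :
  normc (\sum_(i <- s) F i) <= \sum_(i <- s) normc (F i).
Proof.
elim: s => [|x s IH]; first by rewrite !big_nil Normc.normc0.
by rewrite !big_cons (le_trans (le_normcD _ _)) // lerD2l.
Qed.

Lemma normc_prod I (s : seq I) (F : I -> R[i]) :
  normc (\prod_(i <- s) F i) = \prod_(i <- s) normc (F i).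
Proof.
elim: s => [|x s IH]; first by rewrite !big_nil Normc.normc1.
by rewrite !big_cons Normc.normcM IH.
Qed.

Definition cmeasurable d (T : measurableType d) (f : T -> R[i]) :=
  measurable_fun setT (fun x => complex.Re (f x)) /\
  measurable_fun setT (fun x => complex.Im (f x)).

Section Closure.
Context d (T : measurableType d).
Implicit Types f g : T -> R[i].

Lemma cmeasurable_cst c : cmeasurable (fun _ : T => c).
Proof. by split; exact: measurable_cst. Qed.

Lemma cmeasurableD f g : cmeasurable f -> cmeasurable g -> cmeasurable (fun x => f x + g x).
Proof.
move=> [rf jf] [rg jg]; split.
  rewrite (_ : (fun x => _) = (fun x => complex.Re (f x) + complex.Re (g x))); first exact: measurable_funD.
  by apply/funext => x; case: (f x) (g x) => a b [].
rewrite (_ : (fun x => _) = (fun x => complex.Im (f x) + complex.Im (g x))); first exact: measurable_funD.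
by apply/funext => x; case: (f x) (g x) => a b [].
Qed.

Lemma cmeasurableM f g : cmeasurable f -> cmeasurable g -> cmeasurable (fun x => f x * g x).
Proof.
move=> [rf jf] [rg jg]; split.
  rewrite (_ : (fun x => _) =
    (fun x => complex.Re (f x) * complex.Re (g x) - complex.Im (f x) * complex.Im (g x))).
    by apply: measurable_funB; exact: measurable_funM.
  by apply/funext => x; case: (f x) (g x) => a b [].
rewrite (_ : (fun x => _) =
    (fun x => complex.Re (f x) * complex.Im (g x) + complex.Im (f x) * complex.Re (g x))).
  by apply: measurable_funD; exact: measurable_funM.
by apply/funext => x; case: (f x) (g x) => a b [].
Qed.

Lemma cmeasurable_sum I (s : seq I) (F : I -> T -> R[i]) :
  (forall i, cmeasurable (F i)) -> cmeasurable (fun x => \sum_(i <- s) F i x).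
Proof.
move=> mF; elim: s => [|i s IH].
  rewrite (_ : (fun x => _) = fun _ => 0); first exact: cmeasurable_cst.
  by apply/funext => x; rewrite big_nil.
rewrite (_ : (fun x => _) = fun x => F i x + \sum_(j <- s) F j x).
  exact: cmeasurableD.
by apply/funext => x; rewrite big_cons.
Qed.

Lemma cmeasurable_prod I (s : seq I) (F : I -> T -> R[i]) :
  (forall i, cmeasurable (F i)) -> cmeasurable (fun x => \prod_(i <- s) F i x).
Proof.
move=> mF; elim: s => [|i s IH].
  rewrite (_ : (fun x => _) = fun _ => 1); first exact: cmeasurable_cst.
  by apply/funext => x; rewrite big_nil.
rewrite (_ : (fun x => _) = fun x => F i x * \prod_(j <- s) F j x).
  exact: cmeasurableM.
by apply/funext => x; rewrite big_cons.
Qed.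

Lemma measurable_normc f : cmeasurable f -> measurable_fun setT (fun x => normc (f x)).
Proof.
move=> [rf jf].
rewrite (_ : (fun x => _) = (fun x => (complex.Re (f x) ^+ 2 + complex.Im (f x) ^+ 2) `^ 2^-1)).
  apply: (measurableT_comp (measurable_powR _)).
  by apply: measurable_funD; exact: measurable_funX.
by apply/funext => x; rewrite powR12_sqrt ?addr_ge0 ?sqr_ge0 //; case: (f x).
Qed.

Lemma cmeasurable_meval n (h : T -> 'I_n -> R[i]) (p : mpoly.mpoly n R[i]) :
  (forall i, cmeasurable (fun x => h x i)) -> cmeasurable (fun x => mpoly.meval (h x) p).
Proof.
move=> mh; rewrite (_ : (fun x => _) = fun x => \sum_(m <- mpoly.msupp p)
    mpoly.mcoeff m p * \prod_i h x i ^+ (m i)).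
  apply: cmeasurable_sum => m; apply: cmeasurableM; first exact: cmeasurable_cst.
  apply: cmeasurable_prod => i; elim: (m i) => [|k IH]; first exact: cmeasurable_cst.
  rewrite (_ : (fun x => _) = fun x => h x i * h x i ^+ k); first exact: cmeasurableM.
  by apply/funext => x; rewrite exprS.
by apply/funext => x; rewrite mpoly.mevalE.
Qed.

End Closure.
End ComplexMeasurable.

(** * Translations, matrices and cubes in complex space *)

Section Space.
Variables (R : realType) (n : nat).
Implicit Types z : cspace R n.

Definition cvec z : 'cV[R[i]]_n := \col_i ccoord z i.

Definition cpt (x : 'cV[R[i]]_n) : cspace R n :=
  [tuple (complex.Re (x i 0), complex.Im (x i 0)) | i < n].

Lemma ccoord_cpt x i : ccoord (cpt x) i = x i 0.
Proof. by rewrite /ccoord tnth_mktuple; case: (x i 0). Qed.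

Lemma cptK : cancel cpt cvec.
Proof. by move=> x; apply/colP => i; rewrite mxE ccoord_cpt. Qed.

Lemma cvecK : cancel cvec cpt.
Proof.
by move=> z; apply: eq_from_tnth => i; rewrite tnth_mktuple mxE /=; case: (tnth z i).
Qed.

Lemma cmeasurable_cvec d (T : measurableType d) (h : T -> cspace R n) i :
  measurable_fun setT h -> cmeasurable (fun t => cvec (h t) i 0).
Proof.
move=> mh; have mt : measurable_fun setT (fun t => tnth (h t) i).
  by have /measurable_fun_tnthP/(_ i) := mh.
split.
  rewrite (_ : (fun t => _) = fun t => (tnth (h t) i).1); first exact: measurableT_comp.
  by apply/funext => t; rewrite mxE.
rewrite (_ : (fun t => _) = fun t => (tnth (h t) i).2); first exact: measurableT_comp.
by apply/funext => t; rewrite mxE.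
Qed.

Lemma measurable_cpt d (T : measurableType d) (h : T -> 'cV[R[i]]_n) :
  (forall i, cmeasurable (fun t => h t i 0)) -> measurable_fun setT (fun t => cpt (h t)).
Proof.
move=> mh; apply/measurable_fun_tnthP => i.
rewrite (_ : _ \o _ = fun t => (complex.Re (h t i 0), complex.Im (h t i 0))).
  by have [mr mj] := mh i; exact: measurable_fun_pair.
by apply/funext => t /=; rewrite tnth_mktuple.
Qed.

Lemma cmeasurable_mulmx d (T : measurableType d) m (N : 'M[R[i]]_(m, n)) (h : T -> 'cV[R[i]]_n) i :
  (forall i, cmeasurable (fun t => h t i 0)) -> cmeasurable (fun t => (N *m h t) i 0).
Proof.
move=> mh; rewrite (_ : (fun t => _) = fun t => \sum_j N i j * h t j 0).
  by apply: cmeasurable_sum => j; apply: cmeasurableM => //; exact: cmeasurable_cst.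
by apply/funext => t; rewrite mxE.
Qed.

Definition cshift (a : 'cV[R[i]]_n) z : cspace R n := cpt (cvec z + a).

Lemma preserving_cshift a : preserving (lebesgueC R n) (cshift a).
Proof.
pose f (i : 'I_n) (p : measurableTypeR R * measurableTypeR R) :
    (measurableTypeR R * measurableTypeR R)%type :=
  ((p.1 : R) + complex.Re (a i 0), (p.2 : R) + complex.Im (a i 0)).
have -> : cshift a = tuple_apply f.
  apply/funext => z; apply: eq_from_tnth => i; rewrite !tnth_mktuple !mxE /ccoord.
  by rewrite /f; case: (a i 0).
apply: preserving_tuple => i.
by apply: (preserving_prod (preserving_lebesgue _) (preserving_lebesgue _)).
Qed.

Definition clin (N : 'M[R[i]]_n) z : cspace R n := cpt (N *m cvec z).

Lemma measurable_clin N : measurable_fun setT (clin N).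
Proof.
apply: measurable_cpt => i; apply: cmeasurable_mulmx => j.
by apply: cmeasurable_cvec; exact: measurable_id.
Qed.

Definition csquare (r : R) : set (measurableTypeR R * measurableTypeR R) :=
  `[- r, r]%classic `*` `[- r, r]%classic.

Definition cbox (r : 'I_n -> R) : set (cspace R n) :=
  [set z | forall i, csquare (r i) (tnth z i)].

Lemma measurable_csquare r : measurable (csquare r).
Proof. by apply: measurableX; exact: measurable_itv. Qed.

Lemma measurable_cbox r : measurable (cbox r).
Proof.
rewrite (_ : cbox r = \bigcap_(i in [set: 'I_n])
   ((fun z => tnth z i) @^-1` csquare (r i))).
  apply: fin_bigcap_measurable => [|i _]; first exact: finite_finset.
  by apply: measurable_preimage; [exact: measurable_tnth | exact: measurable_csquare].
by apply/seteqP; split=> z zr => [i _|i]; apply: zr.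
Qed.

Lemma measure_csquare r : 0 <= r ->
  prod_measure (@lebesgue_measure R) (@lebesgue_measure R) (csquare r) = (4 * r ^+ 2)%:E.
Proof.
move=> r0.
rewrite /csquare /= /prod_measure product_measure1E; [|exact: measurable_itv..].
have lm : lebesgue_measure (`[- r, r]%classic : set R) = (2 * r)%:E.
  rewrite lebesgue_measure_itv /= lte_fin; case: ifPn => [_|].
    by rewrite -EFinD opprK mulr_natl mulr2n.
  by rewrite -leNgt => ri; congr EFin; move: r0; lra.
transitivity ((2 * r)%:E * (2 * r)%:E)%E; first by congr (_ * _)%E.
by rewrite -EFinM; congr (_%:E); ring.
Qed.

Lemma lebesgueC_box r : (forall i, 0 <= r i) ->
  lebesgueC R n (cbox r) = (\prod_(i < n) (4 * r i ^+ 2))%:E.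
Proof.
move=> r0; pose m2 := prod_measure (@lebesgue_measure R) (@lebesgue_measure R).
rewrite (_ : lebesgueC R n _ = (\prod_(i < n) m2 (csquare (r i)))%E); last first.
  by apply: power_measure_box => i; exact: measurable_csquare.
by rewrite -prodEFin; apply: eq_bigr => i _; exact: measure_csquare.
Qed.

Lemma cboxP r z : cbox r z <->
  forall i, `|complex.Re (ccoord z i)| <= r i /\ `|complex.Im (ccoord z i)| <= r i.
Proof.
split=> zr i; have := zr i; rewrite /csquare /= !in_itv /= !ler_norml.
  by case=> -> ->.
by case=> -> ->.
Qed.

Lemma cbox_normc r z i : cbox (fun=> r) z -> normc (ccoord z i) <= 2 * r.
Proof.
move=> /cboxP/(_ i)[re im]; rewrite (le_trans (normc_le_ReIm _)) //.
by rewrite mulr_natl mulr2n lerD.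
Qed.

Lemma normc_cbox r z : (forall i, normc (ccoord z i) <= r) -> cbox (fun=> r) z.
Proof.
move=> zr; apply/cboxP => i.
by split; apply: le_trans (zr i); rewrite ?Re_le_normc ?Im_le_normc.
Qed.

Definition cnorm1 p (N : 'M[R[i]]_(p, n)) : R := \sum_i \sum_j normc (N i j).

Lemma cnorm1_ge0 p (N : 'M[R[i]]_(p, n)) : 0 <= cnorm1 N.
Proof. by apply: sumr_ge0 => i _; apply: sumr_ge0 => j _; apply: normc_ge0. Qed.

Lemma normc_mulmx p (N : 'M[R[i]]_(p, n)) (x : 'cV[R[i]]_n) r i : 0 <= r ->
  (forall j, normc (x j 0) <= r) -> normc ((N *m x) i 0) <= cnorm1 N * r.
Proof.
move=> r0 xr; rewrite mxE (le_trans (le_normc_sum _ _)) //.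
apply: (@le_trans _ _ ((\sum_j normc (N i j)) * r)).
  rewrite mulr_suml; apply: ler_sum => j _; rewrite Normc.normcM.
  by rewrite ler_wpM2l ?normc_ge0.
rewrite ler_wpM2r // /cnorm1 [leRHS](bigD1 i) //= lerDl.
by apply: sumr_ge0 => k _; apply: sumr_ge0 => j _; apply: normc_ge0.
Qed.

Lemma clin_cbox N r z : 0 <= r -> cbox (fun=> r) z ->
  cbox (fun=> (cnorm1 N * 2 + 1) * r) (clin N z).
Proof.
move=> r0 zr; apply: normc_cbox => i; rewrite ccoord_cpt.
have r2 : 0 <= 2 * r by rewrite mulr_ge0.
have zr2 j : normc (cvec z j 0) <= 2 * r by rewrite mxE; exact: cbox_normc.
rewrite (le_trans (normc_mulmx _ _ r2 zr2)) //.
by rewrite mulrA mulrDl mul1r lerDl.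
Qed.

End Space.

(** * Scaling of Lebesgue measure by invertible matrices *)

Lemma integral_sections (R : realType) d1 d2 (T1 : measurableType d1) (T2 : measurableType d2)
    (m1 : {sigma_finite_measure set T1 -> \bar R})
    (m2 : {sigma_finite_measure set T2 -> \bar R}) (S : set (T1 * T2)) :
  measurable S ->
  (\int[m1]_x m2 (xsection S x) = \int[m2]_y m1 (ysection S y))%E.
Proof.
move=> mS; have := indic_fubini_tonelli m1 m2 mS.
rewrite (indic_fubini_tonelli_FE m2 mS) => ->.
by apply: eq_integral => y _; rewrite (indic_fubini_tonelli_GE m1 mS).
Qed.

Section LinearChange.
Variables (R : realType) (n : nat) (N : 'M[R[i]]_n).
Hypothesis uN : N \in unitmx.
Local Notation m := (lebesgueC R n).
Local Notation U := (@cbox R n (fun=> 1)).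

Lemma clinK z : clin (invmx N) (clin N z) = z.
Proof. by rewrite /clin cptK mulKmx // cvecK. Qed.

(** The cube is symmetric about the origin, so its reflected translate is an ordinary translate and
    has the same measure as the cube. *)
Lemma cbox_shift_sym (x : 'cV[R[i]]_n) :
  [set y : cspace R n | U (cpt (x - cvec y))] = cshift (- x) @^-1` U.
Proof.
have opp a b : `|complex.Re (a - b : R[i])| = `|complex.Re (b - a : R[i])| /\
    `|complex.Im (a - b : R[i])| = `|complex.Im (b - a : R[i])|.
  by case: a b => a a' [b b'] /=; rewrite -normrN opprB; split=> //; rewrite -normrN opprB.
apply/seteqP; split=> y /= /cboxP h; apply/cboxP => i; have := h i;
  rewrite !ccoord_cpt !mxE; have [-> ->] := opp (x i 0) (ccoord y i); done.
Qed.

(* Both sides are measures of subsets of the product computed by Fubini, namely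
   [{N x in U, N x + y in B}] and [{N x - y in U, N x in B}], which correspond
   under the shear [x |-> x - N^-1 y].  No factorization of [N] into elementary
   matrices is needed. *)
Lemma clin_box_exchange B : measurable B ->
  (m B * m (clin N @^-1` U) = m U * m (clin N @^-1` B))%E.
Proof.
move=> mB.
have mU : measurable U by exact: measurable_cbox.
have mLU := measurable_preimage (measurable_clin N) mU.
have mLB := measurable_preimage (measurable_clin N) mB.
have mfst i : cmeasurable (fun p : cspace R n * cspace R n => cvec p.1 i 0).
  by apply: cmeasurable_cvec; exact: measurable_fst.
have msnd i : cmeasurable (fun p : cspace R n * cspace R n => cvec p.2 i 0).
  by apply: cmeasurable_cvec; exact: measurable_snd.
pose f (p : cspace R n * cspace R n) := cpt (cvec p.2 + N *m cvec p.1).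
pose g (p : cspace R n * cspace R n) := cpt (N *m cvec p.1 - cvec p.2).
have mf : measurable_fun setT f.
  apply: measurable_cpt => i.
  rewrite (_ : (fun t => _) = fun t => cvec t.2 i 0 + (N *m cvec t.1) i 0).
    by apply: cmeasurableD => //; exact: cmeasurable_mulmx.
  by apply/funext => t; rewrite mxE.
have mg : measurable_fun setT g.
  apply: measurable_cpt => i.
  rewrite (_ : (fun t => _) = fun t => (N *m cvec t.1) i 0 + (-1) * cvec t.2 i 0).
    apply: cmeasurableD; first exact: cmeasurable_mulmx.
    by apply: cmeasurableM => //; exact: cmeasurable_cst.
  by apply/funext => t; rewrite !mxE mulN1r.
have mh : measurable_fun setT (fun p : cspace R n * cspace R n => clin N p.1).
  by apply: measurableT_comp measurable_fst; exact: measurable_clin.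
pose S := (fun p => clin N p.1) @^-1` U `&` f @^-1` B.
pose S' := g @^-1` U `&` (fun p => clin N p.1) @^-1` B.
have mS : measurable S by apply: measurableI; exact: measurable_preimage.
have mS' : measurable S' by apply: measurableI; exact: measurable_preimage.
have : (\int[m]_x m (xsection S x) = \int[m]_x m (xsection S' x))%E.
  rewrite !integral_sections //; apply: eq_integral => y _.
  have [mv pv] := preserving_cshift (- (invmx N *m cvec y)).
  rewrite -[LHS]pv; last by exact: measurable_ysection.
  pose s x := cshift (- (invmx N *m cvec y)) x.
  have e1 x : clin N (s x) = g (x, y).
    by rewrite /clin /s /cshift cptK mulmxDr mulmxN mulKVmx.
  have e2 x : f (s x, y) = clin N x.
    rewrite /f /= /s /cshift cptK mulmxDr mulmxN mulKVmx //.
    by rewrite addrC subrK.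
  by congr (m _); apply/seteqP; split=> x; rewrite /preimage /ysection /= !inE /S /S' /= e1 e2.
have secS x : m (xsection S x) = (m B * (\1_(clin N @^-1` U) x)%:E)%E.
  rewrite indicE; case: (boolP (x \in _)) => [xU|xU].
    have [mv pv] := preserving_cshift (N *m cvec x).
    rewrite mule1 -[RHS]pv //; congr (m _); apply/seteqP; split=> y.
      by rewrite /xsection /= inE => -[].
    by move=> yB; rewrite /xsection /= inE; split=> //; rewrite inE in xU.
  rewrite mule0 (_ : xsection S x = set0) ?measure0 //.
  apply/seteqP; split=> // y; rewrite /xsection /= inE => -[xU' _].
  by move: xU; rewrite notin_setE; apply.
have secS' x : m (xsection S' x) = (m U * (\1_(clin N @^-1` B) x)%:E)%E.
  rewrite indicE; case: (boolP (x \in _)) => [xB|xB].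
    have [mv pv] := preserving_cshift (- (N *m cvec x)).
    rewrite mule1 -[RHS]pv // -cbox_shift_sym; congr (m _); apply/seteqP; split=> y.
      by rewrite /xsection /= inE => -[].
    by move=> yB; rewrite /xsection /= inE; split=> //; rewrite inE in xB.
  rewrite mule0 (_ : xsection S' x = set0) ?measure0 //.
  apply/seteqP; split=> // y; rewrite /xsection /= inE => -[_ xB'].
  by move: xB; rewrite notin_setE; apply.
rewrite (eq_integral _ _ (fun x _ => secS x)) (eq_integral _ _ (fun x _ => secS' x)).
have mi A : measurable A -> measurable_fun setT (fun x : cspace R n => (\1_A x : R)%:E).
  by move=> mA; apply/measurable_EFinP; exact: measurable_indic.
rewrite !ge0_integralZl ?measure_ge0 //; try by move=> x _; rewrite lee_fin.
  by rewrite !integral_indic // !setIT.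
by exact: mi.
by exact: mi.
Qed.

(** The constant is the ratio of the measures of the preimage of [U] and of [U]. It is finite and
    positive because that preimage lies between two cubes whose sizes come from the entries of the
    inverse and of [N]. *)
Lemma clin_measure : exists2 c : R, 0 < c &
  forall B, measurable B -> m (clin N @^-1` B) = (c%:E * m B)%E.
Proof.
have mU : m U = (\prod_(i < n) (4 * 1 ^+ 2))%:E by apply: lebesgueC_box.
set u : R := \prod_(i < n) _ in mU.
have u0 : 0 < u by apply: prodr_gt0 => i _; rewrite expr1n mulr1.
have mLU := measurable_preimage (measurable_clin N) (@measurable_cbox R n (fun=> 1)).
pose C := cnorm1 (invmx N) * 2 + 1; pose C' := cnorm1 N * 2 + 1.
have C0 : 0 < C by rewrite ltr_wpDl // mulr_ge0 ?cnorm1_ge0.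
have C'0 : 0 < C' by rewrite ltr_wpDl // mulr_ge0 ?cnorm1_ge0.
have le1 : (m (clin N @^-1` U) <= m (cbox (fun=> C)))%E.
  apply: le_measure; rewrite ?inE //; first exact: measurable_cbox.
  by move=> x xU; rewrite -(clinK x) -[C]mulr1; apply: clin_cbox.
have le2 : (m (cbox (fun=> (C'^-1)%R)) <= m (clin N @^-1` U))%E.
  apply: le_measure; rewrite ?inE //; first exact: measurable_cbox.
  move=> x xU; have := clin_cbox N _ xU; rewrite invr_ge0 (ltW C'0) => /(_ isT).
  by rewrite -/C' divff // gt_eqF.
rewrite lebesgueC_box in le1 => [|i]; last exact: ltW.
rewrite lebesgueC_box in le2 => [|i]; last by rewrite invr_ge0 ltW.
have fin : m (clin N @^-1` U) \is a fin_num.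
  by rewrite ge0_fin_numE ?measure_ge0 //; apply: le_lt_trans le1 (ltry _).
exists (fine (m (clin N @^-1` U)) / u) => [|B mB].
  rewrite divr_gt0 // -lte_fin fineK //; apply: lt_le_trans le2.
  by rewrite lte_fin; apply: prodr_gt0 => i _; rewrite mulr_gt0 // exprn_gt0 // invr_gt0.
have := clin_box_exchange mB; rewrite mU -(fineK fin) => h.
rewrite EFinM [(_ * u^-1%:E)%E]muleC -muleA [X in (_ * X)%E]muleC h muleA.
by rewrite -EFinM mulVf ?mul1e // gt_eqF.
Qed.

End LinearChange.

Lemma measurable_tuple_prod (R : realType) d (T : measurableType d) n (f : T -> \bar R) :
  measurable_fun setT f ->
  measurable_fun setT (fun z : n.-tuple T => \prod_(i < n) f (tnth z i))%E.
Proof.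
move=> mf.
suff mp (s : seq 'I_n) :
    measurable_fun setT (fun z : n.-tuple T => \prod_(i <- s) f (tnth z i))%E by exact: mp.
elim: s => [|i s IH].
  rewrite (_ : (fun z => _) = cst 1%E); first exact: measurable_cst.
  by apply/funext => z; rewrite big_nil.
rewrite (_ : (fun z => _) = (fun z => f (tnth z i) * \prod_(j <- s) f (tnth z j))%E).
  apply: emeasurable_funM => //.
  by apply: measurableT_comp mf _; exact: measurable_tnth.
by apply/funext => z; rewrite big_cons.
Qed.

Lemma integral_power_prod (R : realType) d (T : measurableType d)
    (mu : {sigma_finite_measure set T -> \bar R}) n (f : T -> \bar R) :
  measurable_fun setT f -> (forall x, 0 <= f x)%E ->
  (\int[power_measure mu n]_z \prod_(i < n) f (tnth z i) =
    \prod_(i < n) \int[mu]_x f x)%E.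
Proof.
move=> mf f0; have mprod k := @measurable_tuple_prod _ _ _ k f mf.
have p0 k (z : k.-tuple T) : (0 <= \prod_(i < k) f (tnth z i))%E by apply: prode_ge0.
elim: n => [|n IH].
  rewrite big_ord0 (_ : (fun z => _) = cst 1%E); last first.
    by apply/funext => z; rewrite big_ord0.
  by rewrite integral_cst //= diracT mule1.
transitivity (\int[prod_measure mu (power_measure mu n)]_p
   (\prod_(i < n.+1) f (tnth (tuple_cons p) i)))%E.
  exact: (ge0_integral_pushforward (@measurable_tuple_cons _ T n)
    (prod_measure mu (power_measure mu n)) measurableT (mprod n.+1) (fun z _ => p0 _ z)).
rewrite big_ord_recl -IH.
pose F (p : T * n.-tuple T) := (\prod_(i < n.+1) f (tnth (tuple_cons p) i))%E.
have mF : measurable_fun setT F.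
  exact: (measurableT_comp (mprod n.+1) (@measurable_tuple_cons _ T n)).
have := @fubini_tonelli1 _ _ _ _ _ mu (power_measure mu n) F mF (fun p => p0 _ _).
rewrite /fubini_F => ->.
transitivity (\int[mu]_x (f x * \int[power_measure mu n]_z \prod_(i < n) f (tnth z i)))%E.
  apply: eq_integral => x _; rewrite -ge0_integralZl //; last exact: (mprod n).
  apply: eq_integral => t _; rewrite /F big_ord_recl; congr (_ * _)%E.
  by apply: eq_bigr => i _; rewrite tnthS.
under eq_integral do rewrite muleC.
rewrite ge0_integralZl //; first exact: muleC.
exact: integral_ge0.
Qed.

(** * Local integrability of products of cobases *)

Section Dyadic.
Variables (R : realType) (c r : R).
Hypotheses (c0 : 0 < c) (c1 : c < 1) (r1 : 1 <= r).
Local Notation C := (measurableTypeR R * measurableTypeR R)%type.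
Local Notation m2 := (prod_measure (@lebesgue_measure R) (@lebesgue_measure R)).

Let q := 4 `^ c.

(* A majorant of [|z|^(-2c)] on a square, locally constant on dyadic square
   annuli, whose integral is a geometric series of ratio [4^(c - 1)]. *)
Definition dyadic_weight (x : C) : \bar R :=
  (\sum_(k <oo) (q ^+ k.+1)%:E * (\1_(csquare (r * 2^-1 ^+ k)) x)%:E)%E.

Lemma q_gt0 : 0 < q. Proof. exact: powR_gt0. Qed.

Let term_ge0 k (x : C) :
  (0 <= (q ^+ k.+1)%:E * (\1_(csquare (r * 2^-1 ^+ k)) x)%:E)%E.
Proof. by rewrite mule_ge0 // lee_fin // exprn_ge0 // ltW // q_gt0. Qed.

Lemma dyadic_weight_ge0 x : (0 <= dyadic_weight x)%E.
Proof. exact: nneseries_ge0. Qed.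

Let mterm k : measurable_fun setT (fun x : C =>
  (q ^+ k.+1)%:E * (\1_(csquare (r * 2^-1 ^+ k)) x)%:E)%E.
Proof.
apply: measurable_funeM; apply/measurable_EFinP; apply: measurable_indic.
exact: measurable_csquare.
Qed.

Lemma measurable_dyadic_weight : measurable_fun setT dyadic_weight.
Proof.
rewrite (_ : dyadic_weight = fun x => (\sum_(k <oo | k \in predT)
   (q ^+ k.+1)%:E * (\1_(csquare (r * 2^-1 ^+ k)) x)%:E)%E) //.
by apply: ge0_emeasurable_sum.
Qed.

Lemma integral_dyadic_weight : (\int[m2]_x dyadic_weight x < +oo)%E.
Proof.
rewrite integral_nneseries //.
(* The [k]-th square has area [4 r^2 4^-k] and weight [q^(k+1)], hence the first term [a] and the
   ratio [q / 4]. *)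
pose a := 4 * r ^+ 2 * q; pose z := q / 4.
have z1 : `|z| < 1.
  rewrite ger0_norm ?divr_ge0 ?(ltW q_gt0) // ltr_pdivrMr // mul1r.
  rewrite /q /powR pnatr_eq0 /= -[ltRHS]lnK ?posrE // ltr_expR.
  by rewrite gtr_pMl // ln_gt0 // ltr1n.
have termE k : (\int[m2]_x ((q ^+ k.+1)%:E * (\1_(csquare (r * 2^-1 ^+ k)) x)%:E) =
    (geometric a z k)%:E)%E.
  rewrite ge0_integralZl ?lee_fin ?exprn_ge0 ?(ltW q_gt0) //; last first.
    by apply/measurable_EFinP/measurable_indic; exact: measurable_csquare.
  rewrite integral_indic ?setIT //; last exact: measurable_csquare.
  rewrite [X in (_ * X)%E](_ : _ = (4 * (r * 2^-1 ^+ k) ^+ 2)%:E); last first.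
    by apply: measure_csquare; rewrite mulr_ge0 ?exprn_ge0 // (le_trans _ r1).
  rewrite -EFinM; congr EFin; rewrite /geometric /= /a /z exprS !exprMn.
  have -> : (2^-1 ^+ k) ^+ 2 = 4^-1 ^+ k :> R.
    by rewrite -exprM mulnC exprM; congr (_ ^+ _); field.
  by ring.
rewrite (_ : (fun n => _) = EFin \o series (geometric a z)); last first.
  apply/funext => n; rewrite /series /= -sumEFin; apply: eq_bigr => k _; exact: termE.
by rewrite EFin_lim ?ltry //; exact: is_cvg_geometric_series.
Qed.

Lemma dyadic_weight_ge k (x : C) : csquare (r * 2^-1 ^+ k) x ->
  ((q ^+ k.+1)%:E <= dyadic_weight x)%E.
Proof.
move=> xk; apply: le_trans (nneseries_lim_ge k.+1 (fun n _ _ => term_ge0 n x)).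
rewrite big_nat_recr //= indicE mem_set // mule1 leeDr //.
exact: sume_ge0.
Qed.

(** Lets the coordinates that complete a basis of forms enter a product of weights without
    decreasing it. *)
Lemma dyadic_weight_ge1 (x : C) : csquare r x -> (1 <= dyadic_weight x)%E.
Proof.
move=> xr; have /(@dyadic_weight_ge 0) : csquare (r * 2^-1 ^+ 0) x by rewrite expr0 mulr1.
apply: le_trans; rewrite lee_fin expr1 /q.
by rewrite -[leLHS](powRr0 4) ler_powR ?ler1n // ltW.
Qed.

(** If the larger of the two coordinates lies between [r 2^-(k+1)] and [r 2^-k], the point is in the
    [k]-th square and its modulus exceeds [2^-(k+1)] because [r >= 1]. This is why the [k]-th weight
    carries the exponent [k + 1]. *)
Lemma dyadic_weight_ge_powR (x : C) : csquare r x ->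
  (((normc (Complex x.1 x.2) `^ (2 * c))^-1)%:E <= dyadic_weight x)%E.
Proof.
move=> xr.
have c2 : 2 * c != 0 by rewrite mulf_neq0 // gt_eqF.
(* At the origin the left side is 0, since the inverse of 0 is 0. *)
have [x0|x0] := eqVneq (normc (Complex x.1 x.2)) 0.
  by rewrite x0 powR0 // invr0; exact: dyadic_weight_ge0.
have xn0 : 0 < normc (Complex x.1 x.2) by rewrite lt_neqAle eq_sym x0 normc_ge0.
pose M := Order.max `|x.1 : R| `|x.2 : R|.
have sqE t : csquare t x <-> M <= t.
  by rewrite /csquare /= !in_itv /= -!ler_norml ge_max; split=> [[-> ->]|/andP].
have M0 : 0 < M.
  rewrite lt_max !normr_gt0 -negb_and; apply: contra x0 => /andP[/eqP -> /eqP ->].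
  by rewrite Normc.normc0.
have ex : exists k, (r * 2^-1 ^+ k < M)%R.
  have [k] : exists k, r / M < 2 ^+ k :> R.
    have rM : 0 <= r / M by rewrite divr_ge0 ?(ltW M0) // (le_trans _ r1).
    exists (Num.bound (r / M)); apply: lt_trans (archi_boundP rM) _.
    by rewrite -natrX ltr_nat ltn_expl.
  rewrite ltr_pdivrMr // => rk; exists k; rewrite exprVn ltr_pdivrMr ?exprn_gt0 //.
  by rewrite mulrC.
case: (ex_minnP ex) => -[|k] Mk kmin.
  by move: Mk; rewrite expr0 mulr1 ltNge; move/sqE: xr => ->.
have /sqE/dyadic_weight_ge : M <= r * 2^-1 ^+ k.
  by rewrite leNgt; apply/negP => /kmin; rewrite ltnn.
apply: le_trans; rewrite lee_fin.
have Mx : M <= normc (Complex x.1 x.2).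
  by rewrite ge_max (Re_le_normc (Complex x.1 x.2)) (Im_le_normc (Complex x.1 x.2)).
have : (2^-1 ^+ k.+1) `^ (2 * c) <= normc (Complex x.1 x.2) `^ (2 * c).
  rewrite ge0_ler_powR ?nnegrE ?normc_ge0 ?exprn_ge0 //; first by rewrite mulr_ge0 // ltW.
  apply: le_trans Mx; apply: le_trans (ltW Mk).
  by rewrite ler_peMl ?exprn_ge0.
have -> : (2^-1 ^+ k.+1) `^ (2 * c) = (q ^+ k.+1)^-1.
  have q0 := ltW q_gt0; have e4 : 0 <= 4 ^+ k.+1 :> R by rewrite exprn_ge0.
  rewrite powRrM powR_mulrn ?exprn_ge0 // -exprM mulnC exprM.
  have -> : (2^-1 ^+ 2) ^+ k.+1 = (4 ^+ k.+1)^-1 :> R.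
    by rewrite -exprVn; congr (_ ^+ _); field.
  rewrite -powR_inv1 // powRAC powR_inv1 ?powR_ge0 //; congr (_^-1).
  by rewrite -powR_mulrn // /q powRAC powR_mulrn.
have qk : 0 < q ^+ k.+1 by rewrite exprn_gt0 // q_gt0.
by move=> le; rewrite -[leRHS]invrK lef_pV2 ?posrE ?invr_gt0 ?powR_gt0.
Qed.

End Dyadic.

Section Bounds.
Variables (R : realType) (n : nat).
Local Notation K := (R[i] : fieldType).
Local Notation m := (lebesgueC R n).
Implicit Types (a b : 'rV[R[i]]_n) (x : cspace R n) (A B : seq 'rV[R[i]]_n).

Lemma normc_exp (z : R[i]) k : normc (z ^+ k) = normc z ^+ k.
Proof. by elim: k => [|k IH]; rewrite ?expr0 ?Normc.normc1 // !exprS Normc.normcM IH. Qed.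

Lemma meval_bounded (p : mpoly.mpoly n R[i]) T : 0 <= T ->
  exists2 M, 0 <= M & forall y, (forall i, normc (y i) <= T) -> normc (mpoly.meval y p) <= M.
Proof.
move=> T0.
pose M := \sum_(k <- mpoly.msupp p) normc (mpoly.mcoeff k p) * \prod_i T ^+ k i.
exists M => [|y yT].
  by apply: sumr_ge0 => k _; rewrite mulr_ge0 ?normc_ge0 ?prodr_ge0 // => i _; rewrite exprn_ge0.
rewrite mpoly.mevalE (le_trans (le_normc_sum _ _)) //; apply: ler_sum => k _.
rewrite Normc.normcM ler_wpM2l ?normc_ge0 // normc_prod; apply: ler_prod => i _.
by rewrite normc_exp exprn_ge0 ?normc_ge0 // lerXn2r ?nnegrE ?normc_ge0.
Qed.

Definition form_val a x : R[i] := (a *m cvec x) 0 0.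

Lemma meval_form_val a x : mpoly.meval (ccoord x) (linf a) = form_val a x.
Proof.
by rewrite /form_val -meval_linf; apply: mpoly.meval_eq => i; rewrite mxE.
Qed.

Lemma normc_prodl A x :
  normc (mpoly.meval (ccoord x) (prodl A)) = \prod_(a <- A) normc (form_val a x).
Proof.
rewrite /prodl rmorph_prod normc_prod; apply: eq_bigr => a _.
by rewrite /= meval_form_val.
Qed.

Lemma measurable_normc_meval p :
  measurable_fun setT (fun x => normc (mpoly.meval (ccoord x) p)).
Proof.
apply: measurable_normc; apply: cmeasurable_meval => i.
rewrite (_ : (fun x => _) = fun x => cvec x i 0); last by apply/funext => x; rewrite mxE.
by apply: cmeasurable_cvec; exact: measurable_id.
Qed.

Lemma measurable_polydisc (z : cspace R n) r : measurable (polydisc z r).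
Proof.
rewrite (_ : polydisc z r = \bigcap_(i in [set: 'I_n])
   ((fun x => normc (ccoord x i - ccoord z i)) @^-1` `]-oo, r[%classic)); last first.
  by apply/seteqP; split=> x xr => [i _|i]; [have := xr i | have := xr i I];
    rewrite /= in_itv.
apply: fin_bigcap_measurable => [|i _]; first exact: finite_finset.
apply: measurable_preimage; last exact: measurable_itv.
apply: measurable_normc; apply: cmeasurableD; last exact: cmeasurable_cst.
rewrite (_ : (fun x => _) = fun x => cvec x i 0); last by apply/funext => x; rewrite mxE.
by apply: cmeasurable_cvec; exact: measurable_id.
Qed.

Definition polydisc_radius (z : cspace R n) (r : R) : R := `|r| + \sum_i normc (ccoord z i).

Lemma polydisc_radius_ge0 z r : 0 <= polydisc_radius z r.
Proof. by rewrite addr_ge0 // sumr_ge0 // => i _; exact: normc_ge0. Qed.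

Lemma polydisc_bounded z r x i : polydisc z r x -> normc (ccoord x i) <= polydisc_radius z r.
Proof.
move=> /(_ i) xr; rewrite -[ccoord x i](subrK (ccoord z i)) (le_trans (le_normcD _ _)) //.
apply: lerD; first by rewrite (le_trans (ltW xr)) // ler_norm.
by rewrite (bigD1 i) //= lerDl sumr_ge0 // => j _; exact: normc_ge0.
Qed.

Lemma integral_clin (N : 'M[R[i]]_n) (f : cspace R n -> \bar R) : N \in unitmx ->
  measurable_fun setT f -> (forall x, 0 <= f x)%E ->
  (\int[m]_x f x < +oo -> \int[m]_x f (clin N x) < +oo)%E.
Proof.
move=> uN mf f0 fin; have [c c0 cE] := clin_measure uN.
have := ge0_integral_pushforward (measurable_clin N) m measurableT mf (fun x _ => f0 x).
rewrite preimage_setT => <-.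
pose cn : {nonneg R} := NngNum (ltW c0).
have -> : (\int[pushforward m (clin N)]_y f y = \int[mscale cn m]_y f y)%E.
  pose nu := measure_function_pushforward__canonical__measure_function_Measure
    m (measurable_clin N).
  apply: (@eq_measure_integral _ _ _ _ (mscale cn m) nu) => B mB _. exact: cE.
rewrite ge0_integral_mscale //.
by rewrite lte_mul_pinfty // ?lee_fin ?ltW.
Qed.

Lemma le_prode_split (T : eqType) (C D : seq T) (p : T -> R) (f : T -> \bar R) :
  (forall u, 0 <= p u) -> {in C ++ D, forall u, (p u)%:E <= f u}%E ->
  {in C ++ D, forall u, 1 <= f u}%E ->
  ((\prod_(u <- D) p u)%:E <= \prod_(u <- C ++ D) f u)%E.
Proof.
move=> p0; elim: C => [|x C IH] pf f1; last first.
  rewrite big_cons -[leLHS]mul1e lee_pmul ?f1 ?mem_head //.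
    by rewrite lee_fin prodr_ge0.
  by apply: IH => u uC; [apply: pf | apply: f1]; rewrite in_cons uC orbT.
elim: D pf {f1} => [|x D IH] pf; first by rewrite !big_nil.
rewrite !big_cons EFinM lee_pmul ?pf ?mem_head // ?lee_fin ?prodr_ge0 //.
by apply: IH => u uC; apply: pf; rewrite in_cons uC orbT.
Qed.

Lemma measurable_inv_prodl B (p : R) :
  measurable_fun setT (fun x => \prod_(b <- B) (normc (form_val b x) `^ p)^-1).
Proof.
elim: B => [|b B IH].
  rewrite (_ : (fun x => _) = cst 1); first exact: measurable_cst.
  by apply/funext => x; rewrite big_nil.
rewrite (_ : (fun x => _) = (fun x => normc (form_val b x) `^ (- p) *
    \prod_(b <- B) (normc (form_val b x) `^ p)^-1)); last first.
  by apply/funext => x; rewrite big_cons powRN.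
apply: measurable_funM => //; apply: (measurableT_comp (measurable_powR _)).
apply: measurable_normc; apply: cmeasurable_mulmx => i.
by apply: cmeasurable_cvec; exact: measurable_id.
Qed.

(** Independent forms can be completed to linear coordinates. In these the integrand is dominated by
    a product of one-variable weights, whose integral factors and is finite. *)
Lemma integral_inv_prodl B (c : R) z r : rk B = size B -> 0 < c -> c < 1 ->
  (\int[m]_(x in polydisc z r)
    (\prod_(b <- B) (normc (form_val b x) `^ (2 * c))^-1)%:E < +oo)%E.
Proof.
move=> rB c0 c1; have [C [rC sC]] := free_extension rB.
pose N := \matrix_(i < n) (C ++ B)`_i : 'M[R[i]]_n.
have uN : N \in unitmx := unitmx_rows rC sC.
pose T := polydisc_radius z r; have T0 : 0 <= T := polydisc_radius_ge0 z r.
(* [cnorm1 N * T] bounds all new coordinates on the polydisc; the summand 1 ensures [r' >= 1], as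
   the weight requires. *)
pose r' := 1 + cnorm1 N * T.
have r'1 : 1 <= r' by rewrite lerDl mulr_ge0 ?cnorm1_ge0.
pose w := dyadic_weight c r'.
pose psi (x : cspace R n) := (\prod_(i < n) w (tnth x i))%E.
have mw : measurable_fun setT w by exact: measurable_dyadic_weight.
have w0 v : (0 <= w v)%E by exact: dyadic_weight_ge0.
have psi0 x : (0 <= psi x)%E by exact: prode_ge0.
have mpsi : measurable_fun setT psi by exact: measurable_tuple_prod.
have psifin : (\int[m]_x psi x < +oo)%E.
  rewrite /m /psi integral_power_prod //.
  have wfin : (\int[prod_measure (@lebesgue_measure R) (@lebesgue_measure R)]_x w x < +oo)%E.
    exact: integral_dyadic_weight.
  elim: n => [|k IH]; first by rewrite big_ord0 ltry.
  rewrite big_ord_recl; apply: lte_mul_pinfty IH.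
    exact: integral_ge0.
  by rewrite ge0_fin_numE //; exact: integral_ge0.
have fin := integral_clin uN mpsi psi0 psifin.
apply: le_lt_trans fin.
apply: (@le_trans _ _ (\int[m]_(x in polydisc z r) psi (clin N x))%E); last first.
  apply: ge0_subset_integral => //; first exact: measurable_polydisc.
  by apply: measurableT_comp mpsi _; exact: measurable_clin.
apply: ge0_le_integral => //.
- exact: measurable_polydisc.
- move=> x _; rewrite lee_fin; apply: prodr_ge0 => b _.
  by rewrite invr_ge0 powR_ge0.
- by apply: measurable_funTS; apply/measurable_EFinP; exact: measurable_inv_prodl.
- apply: measurable_funTS; apply: measurableT_comp mpsi _; exact: measurable_clin.
move=> x xz; pose pr (v : R[i]) : measurableTypeR R * measurableTypeR R :=
  (complex.Re v, complex.Im v).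
have NE i : (N *m cvec x) i 0 = form_val (C ++ B)`_i x.
  by rewrite /form_val !mxE; apply: eq_bigr => j _; rewrite mxE.
have small : {in C ++ B, forall u, csquare r' (pr (form_val u x))}.
  move=> u uC; have iC : (index u (C ++ B) < n)%N by rewrite -[X in (_ < X)%N]sC index_mem.
  rewrite -(nth_index 0 uC) -(NE (Ordinal iC)).
  have vr : normc ((N *m cvec x) (Ordinal iC) 0) <= r'.
    apply: (@le_trans _ _ (cnorm1 N * T)); last by rewrite lerDr.
    by apply: normc_mulmx => // j; rewrite mxE; exact: polydisc_bounded.
  rewrite /csquare /pr /= !in_itv /= -!ler_norml.
  by rewrite (le_trans (Re_le_normc _) vr) (le_trans (Im_le_normc _) vr).
have -> : psi (clin N x) = (\prod_(b <- C ++ B) w (pr (form_val b x)))%E.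
  rewrite (big_nth 0) sC big_mkord; apply: eq_bigr => i _.
  by rewrite tnth_mktuple -NE.
apply: le_prode_split => [u|u /small su|u /small su].
- by rewrite invr_ge0 powR_ge0.
- have := dyadic_weight_ge_powR c0 r'1 su; rewrite /pr /=.
  by case: (form_val u x).
- exact: dyadic_weight_ge1.
Qed.

Lemma prodl_mask_negb (mk : bitseq) A : size mk = size A ->
  prodl A = prodl (mask mk A) * prodl (mask (map negb mk) A).
Proof.
elim: A mk => [|a A IH] [|[] mk] //=; first by rewrite /prodl big_nil mulr1.
  by case=> /IH AE; rewrite /prodl !big_cons -!/(prodl _) AE mulrA.
by case=> /IH AE; rewrite /prodl !big_cons -!/(prodl _) AE mulrCA.
Qed.

Lemma multiplier_integrand_measurable (c : rat) (f g : mpoly.mpoly n R[i]) :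
  measurable_fun setT (fun x => normc (mpoly.meval (ccoord x) f) ^+ 2
    / normc (mpoly.meval (ccoord x) g) `^ (2 * ratr c)).
Proof.
apply: measurable_funM; first by apply: measurable_funX; exact: measurable_normc_meval.
rewrite (_ : (fun x => _) = (fun x => normc (mpoly.meval (ccoord x) g) `^ (- (2 * ratr c)))).
  apply: (measurableT_comp (measurable_powR _)); exact: measurable_normc_meval.
by apply/funext => x; rewrite powRN.
Qed.

Lemma powR_prod (I : Type) (s : seq I) (F : I -> R) p : (forall i, 0 <= F i) ->
  (\prod_(i <- s) F i) `^ p = \prod_(i <- s) F i `^ p.
Proof.
move=> F0; elim: s => [|i s IH]; first by rewrite !big_nil powR1.
by rewrite !big_cons powRM ?prodr_ge0 // IH.
Qed.

Lemma inv_powR_prodl B (p : R) x : (normc (mpoly.meval (ccoord x) (prodl B)) `^ p)^-1 =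
  \prod_(b <- B) (normc (form_val b x) `^ p)^-1.
Proof.
rewrite normc_prodl powR_prod => [|b]; last exact: normc_ge0.
by rewrite prodfV.
Qed.

Lemma sqr_div_powR_le (t T p : R) : 0 <= t -> t <= T -> 1 <= T -> 0 < p -> p <= 2 ->
  t ^+ 2 / t `^ p <= T ^+ 2.
Proof.
move=> t0 tT T1 p0 p2; have T2 : 1 <= T ^+ 2 by rewrite exprn_ege1.
case: (eqVneq t 0) => [->|tn0]; first by rewrite expr0n mul0r (le_trans ler01).
have tp : 0 < t by rewrite lt_neqAle eq_sym tn0.
rewrite ler_pdivrMr ?powR_gt0 //; case: (leP t 1) => t1.
  apply: (@le_trans _ _ (t `^ p)); last by rewrite ler_peMl // powR_ge0.
  by rewrite -powR_mulrn // ger_powR ?tp.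
rewrite (@le_trans _ _ (T ^+ 2)) //; first by rewrite lerXn2r ?nnegrE // (le_trans t0).
rewrite ler_peMr ?sqr_ge0 // -[leLHS](powRr0 t) ler_powR ?ltW //.
Qed.

Lemma lee_norm_nneg (s t : R) : 0 <= s -> s <= t -> (`|s|%:E <= `|t|%:E)%E.
Proof. by move=> s0 st; rewrite lee_fin ger0_norm // (le_trans st) // ler_norm. Qed.

(** [a], [u] and [t] will be the moduli of the multiplier, of the product over the basis and of the
    product over its complement. The last occurs in numerator and denominator, and its net exponent
    [2 - p] is nonnegative; [1 + T] provides a bound that is at least 1. *)
Lemma quotient_bound (a u t H T p : R) : 0 <= a -> a <= H -> 0 <= u -> 0 <= t -> t <= T ->
  0 < p -> p <= 2 ->
  (a * t) ^+ 2 / (u * t) `^ p <= H ^+ 2 * (1 + T) ^+ 2 * (u `^ p)^-1.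
Proof.
move=> a0 aH u0 t0 tT p0 p2; rewrite powRM // exprMn invfM mulrACA [leRHS]mulrAC.
apply: ler_pM; rewrite ?mulr_ge0 ?exprn_ge0 ?invr_ge0 ?powR_ge0 //.
  by rewrite ler_wpM2r ?invr_ge0 ?powR_ge0 // lerXn2r ?nnegrE // (le_trans a0).
by apply: sqr_div_powR_le; rewrite ?lerDl ?(le_trans t0) // (le_trans tT) // lerDr.
Qed.

Theorem cobasis_span_integrable A (c : rat) j f z r : 0 < c -> c < 1 -> cobasis_span A j f ->
  m.-integrable (polydisc z r) (EFin \o (fun x =>
    normc (mpoly.meval (ccoord x) f) ^+ 2
    / normc (mpoly.meval (ccoord x) (prodl A)) `^ (2 * ratr c))).
Proof.
move=> c0 c1.
have C0 : 0 < ratr c :> R by rewrite ltr0q.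
have C1 : ratr c < 1 :> R by rewrite -(rmorph1 (ratr : rat -> R)) ltr_rat.
have p0 : 0 < 2 * ratr c :> R by rewrite mulr_gt0.
have p2 : 2 * ratr c <= 2 :> R by rewrite ger_pMr // ltW.
have mI g := measurable_funTS (D := polydisc z r) (multiplier_integrand_measurable c g (prodl A)).
elim=> [|f1 f2 _ I1 _ I2|mk h i smk rmk _ _ _].
- apply: (eq_integrable _ (cst 0%E)) => //; first exact: measurable_polydisc.
    by move=> x _ /=; rewrite rmorph0 Normc.normc0 expr0n mul0r.
  exact: integrable0.
(* Stability under sums comes from [|u + v|^2 <= 2 |u|^2 + 2 |v|^2]. *)
- pose F g x := normc (mpoly.meval (ccoord x) g) ^+ 2
    / normc (mpoly.meval (ccoord x) (prodl A)) `^ (2 * ratr c).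
  have mP := measurable_polydisc z r.
  apply: (le_integrable mP (g := (fun x => (2%:E * (F f1 x)%:E + 2%:E * (F f2 x)%:E)%E))).
  + by apply/measurable_EFinP; exact: mI.
  + move=> x _ /=; have F0 g : 0 <= F g x by rewrite divr_ge0 ?powR_ge0 ?sqr_ge0.
    suff le : F (f1 + f2) x <= 2 * F f1 x + 2 * F f2 x.
      by rewrite lee_fin ger0_norm ?(F0 (f1 + f2)) // (le_trans le) ?ler_norm.
    rewrite /F !mulrA -mulrDl ler_wpM2r ?invr_ge0 ?powR_ge0 // rmorphD /=.
    set u := mpoly.meval _ f1; set v := mpoly.meval _ f2.
    apply: (@le_trans _ _ ((normc u + normc v) ^+ 2)).
      by rewrite lerXn2r ?nnegrE ?addr_ge0 ?normc_ge0 ?le_normcD.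
    rewrite -subr_ge0 (_ : _ - _ = (normc u - normc v) ^+ 2) ?sqr_ge0 //.
    by ring.
  + by apply: integrableD => //; apply: integrableZl.
pose B := mask mk A; pose Cc := mask (map negb mk) A.
have rB : rk B = size B by rewrite rmk size_mask.
have [H H0 hH] := meval_bounded h (polydisc_radius_ge0 z r).
have [T T0 hT] := meval_bounded (prodl Cc) (polydisc_radius_ge0 z r).
pose G x : R := (normc (mpoly.meval (ccoord x) (prodl B)) `^ (2 * ratr c))^-1.
have GE x : G x = \prod_(b <- B) (normc (form_val b x) `^ (2 * ratr c))^-1.
  exact: inv_powR_prodl.
pose M : R := H ^+ 2 * (1 + T) ^+ 2.
have mP := measurable_polydisc z r.
apply: (le_integrable mP (g := (fun x => (M%:E * (G x)%:E)%E))).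
- by apply/measurable_EFinP; exact: mI.
- move=> x xz /=; have xb i0 := polydisc_bounded i0 xz.
  have G0 : 0 <= G x by rewrite invr_ge0 powR_ge0.
  apply: lee_norm_nneg; first by rewrite mulr_ge0 ?sqr_ge0 ?invr_ge0 ?powR_ge0.
  rewrite (prodl_mask_negb smk) !rmorphM /= !Normc.normcM -/B -/Cc.
  by apply: quotient_bound; rewrite ?normc_ge0 ?hH ?hT.
apply: integrableZl => //; apply/integrableP; split.
  apply/measurable_EFinP; apply: measurable_funTS.
  have -> : G = fun x => \prod_(b <- B) (normc (form_val b x) `^ (2 * ratr c))^-1.
    by apply/funext => x; exact: GE.
  exact: measurable_inv_prodl.
rewrite (eq_integral (fun x => (\prod_(b <- B) (normc (form_val b x) `^ (2 * ratr c))^-1)%:E)).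
  exact: integral_inv_prodl.
by move=> x _; rewrite /= -GE ger0_norm // invr_ge0 powR_ge0.
Qed.

End Bounds.

(** * Divergence for small vanishing order *)

Lemma powR_neg_unbounded (R : realType) (p k M e : R) : 0 < p -> 0 < k -> 0 < e ->
  exists2 t, 0 < t <= e & M < k * t `^ (- p).
Proof.
move=> p0 k0 e0; pose B := `|M| / k + 1.
have B0 : 0 < B by rewrite ltr_wpDl // divr_ge0 // ltW.
pose t := Order.min e (B `^ (- p^-1)).
have t0 : 0 < t by rewrite lt_min e0 powR_gt0.
exists t; first by rewrite t0 ge_min lexx.
apply: (@lt_le_trans _ _ (k * B)).
  by rewrite /B mulrDr mulr1 mulrC divfK ?gt_eqF // (le_lt_trans (ler_norm M)) // ltrDl.
rewrite ler_pM2l // powRN -[leLHS]invrK lef_pV2 ?posrE ?invr_gt0 ?powR_gt0 //.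
have -> : B^-1 = (B `^ (- p^-1)) `^ p.
  by rewrite -powRrM mulNr mulVf ?gt_eqF // powR_inv1 // ltW.
apply: ge0_ler_powR; rewrite ?nnegrE ?powR_ge0 ?(ltW p0) ?(ltW t0) //.
by rewrite ge_min lexx orbT.
Qed.

Section NullSet.
Variables (R : realType) (n : nat).
Local Notation m := (lebesgueC R n).

(** In coordinates that include the form, its zero set is a box with one side reduced to a point and
    the others infinite; the product of the measures is 0 because [0 * +oo = 0]. *)
Lemma form_null (a : 'rV[R[i]]_n) : a != 0 -> m [set x | form_val a x = 0] = 0%E.
Proof.
move=> a0; have ra : rk [:: a] = size [:: a].
  by rewrite rk_consNsub ?sp_nil ?submx0 // /rk sp_nil mxrank0.
have [C [rC sC]] := free_extension ra.
have kn : (size C < n)%N by rewrite -[X in (_ < X)%N]sC size_cat addn1.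
pose N := \matrix_(i < n) (C ++ [:: a])`_i : 'M[R[i]]_n.
have uN : N \in unitmx := unitmx_rows rC sC.
have NE x : (N *m cvec x) (Ordinal kn) 0 = form_val a x.
  rewrite /form_val !mxE; apply: eq_bigr => j _.
  by rewrite mxE nth_cat ltnn subnn.
pose A (i : 'I_n) : set (measurableTypeR R * measurableTypeR R) :=
  if i == Ordinal kn then csquare 0 else setT.
have mA i : measurable (A i) by rewrite /A; case: ifP => _ //; exact: measurable_csquare.
pose H := [set z : cspace R n | forall i, A i (tnth z i)].
have mH0 : m H = 0%E.
  pose m2 := prod_measure (@lebesgue_measure R) (@lebesgue_measure R).
  rewrite (_ : m H = (\prod_(i < n) m2 (A i))%E); last exact: power_measure_box.
  rewrite (bigD1 (Ordinal kn)) //= {1}/A eqxx (_ : m2 _ = 0%E) ?mul0e //.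
  by rewrite /m2 measure_csquare // expr0n mulr0.
have mH : measurable H.
  rewrite (_ : H = \bigcap_(i in [set: 'I_n]) ((fun z => tnth z i) @^-1` A i)).
    apply: fin_bigcap_measurable => [|i _]; first exact: finite_finset.
    by apply: measurable_preimage; [exact: measurable_tnth | exact: mA].
  by apply/seteqP; split=> z zr => [i _|i]; apply: zr.
have [c c0 cE] := clin_measure uN.
rewrite (_ : [set x | _] = clin N @^-1` H); first by rewrite cE // mH0 mule0.
apply/seteqP; split=> x /= xH.
  move=> i; rewrite /A; case: eqP => // ->.
  by rewrite tnth_mktuple NE xH /csquare /= in_itv /= oppr0 lexx.
have := xH (Ordinal kn); rewrite /A eqxx tnth_mktuple NE /csquare /= !in_itv /= oppr0.
by case: (form_val a x) => u v /= [/le_anti <- /le_anti <-].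
Qed.

Lemma prodl_null (A : seq 'rV[R[i]]_n) : all (fun a => a != 0) A ->
  m [set x | normc (mpoly.meval (ccoord x) (prodl A)) = 0] = 0%E.
Proof.
elim: A => [_|a A IH /= /andP[a0 hA]].
  rewrite (_ : [set x | _] = set0) ?measure0 //.
  apply/seteqP; split=> // x /=; rewrite normc_prodl big_nil => /eqP.
  by rewrite oner_eq0.
have mZ B : measurable [set x : cspace R n | normc (mpoly.meval (ccoord x) (prodl B)) = 0].
  rewrite (_ : [set x | _] = (fun x => normc (mpoly.meval (ccoord x) (prodl B))) @^-1` [set 0]) //.
  by apply: measurable_preimage => //; exact: measurable_normc_meval.
have mF : measurable [set x : cspace R n | form_val a x = 0].
  rewrite (_ : [set x | _] = [set x : cspace R n | normc (mpoly.meval (ccoord x) (prodl [:: a])) = 0]) //.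
  apply/seteqP; split=> x /=; rewrite normc_prodl big_seq1; first by move=> ->; rewrite Normc.normc0.
  exact: Normc.eq0_normc.
rewrite (_ : [set x | _] = [set x | form_val a x = 0] `|`
   [set x | normc (mpoly.meval (ccoord x) (prodl A)) = 0]).
  rewrite measureU0 //; first exact: form_null.
  exact: IH.
apply/seteqP; split=> x /=; rewrite !normc_prodl big_cons.
  by move/eqP; rewrite mulf_eq0 => /orP[/eqP/Normc.eq0_normc|/eqP]; [left|right].
by case=> ->; rewrite ?Normc.normc0 ?mul0r ?mulr0.
Qed.

(** Each nonconstant monomial has one factor of modulus at most [e], the others being at most 1. *)
Lemma meval_lipschitz0 (p : mpoly.mpoly n R[i]) : exists2 C, 0 <= C &
  forall e y, 0 <= e -> e <= 1 -> (forall i, normc (y i) <= e) ->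
    normc (mpoly.meval y p - mpoly.meval (fun=> 0) p) <= C * e.
Proof.
exists (\sum_(k <- mpoly.msupp p) normc (mpoly.mcoeff k p)) => [|e y e0 e1 ye].
  by apply: sumr_ge0 => k _; exact: normc_ge0.
rewrite !mpoly.mevalE -sumrB (le_trans (le_normc_sum _ _)) // mulr_suml.
apply: ler_sum => k _; rewrite -mulrBr Normc.normcM ler_wpM2l ?normc_ge0 //.
case: (pickP (fun i => (0 < k i)%N)) => [i ki|k0]; last first.
  rewrite !big1 ?subrr ?Normc.normc0 // => i _; have := k0 i; case: (k i) => //.
rewrite [X in _ - X](bigD1 i) //= expr0n gtn_eqF // mul0r subr0 normc_prod.
rewrite (bigD1 i) //= -[leRHS]mulr1; apply: ler_pM; rewrite ?normc_ge0 ?prodr_ge0 //.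
- by move=> j _; exact: normc_ge0.
- rewrite normc_exp -(prednK ki) exprS -[leRHS]mulr1 ler_pM ?normc_ge0 ?exprn_ge0 ?normc_ge0 //.
  by rewrite exprn_ile1 ?normc_ge0 // (le_trans (ye i)).
apply: prodr_ile1 => j _.
by rewrite normc_ge0 normc_exp exprn_ile1 ?normc_ge0 // (le_trans (ye j)).
Qed.

End NullSet.

(** * Lower bounds on thin boxes near a flat *)

Section Scaling.
Variables (R : realType) (n : nat).
Local Notation m := (lebesgueC R n).
Local Notation K := (R[i]).

Definition rc (t : R) : K := Complex t 0.

Lemma normc_rc t : 0 <= t -> normc (rc t) = t.
Proof. by move=> t0; rewrite /rc /= expr0n addr0 sqrtr_sqr ger0_norm. Qed.

Lemma normc_sub_le (a b : K) : normc a - normc b <= normc (a + b).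
Proof.
by rewrite lerBlDr -{1}[a](addrK b) (le_trans (le_normcD _ _)) // normcN.
Qed.

(** Expand in powers of [t] with coefficients polynomial in [y]: the terms below [i] vanish, the
    coefficient at [i] stays close to its nonzero value at [y = 0], and the higher terms carry an
    extra factor [t]. *)
Lemma along_lower_bound (f : mpoly.mpoly n K) (w v : 'cV[K]_n) (M N : 'M[K]_n) i :
  (forall l y, (l < i)%N -> (along (w + M *m y) (v + N *m y) f)`_l = 0) ->
  (along w v f)`_i != 0 ->
  exists e c : R, [/\ 0 < e, e <= 1, 0 < c & forall (y : 'cV[K]_n) t,
    (forall j, normc (y j 0) <= e) -> 0 < t -> t <= e ->
    c * t ^+ i <= normc (mpoly.meval
      (fun j => ((w + M *m y) + rc t *: (v + N *m y)) j 0) f)].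
Proof.
have [F FE] := along_family f w v M N => low fi.
pose ev (y : 'cV[K]_n) l := mpoly.meval (fun j => y j 0) F`_l.
have evE y l : (along (w + M *m y) (v + N *m y) f)`_l = ev y l.
  by rewrite -FE coef_map.
have ev0 : ev 0 i = (along w v f)`_i.
  by rewrite -evE !mulmx0 !addr0.
have iF : (i < size F)%N.
  rewrite ltnNge; apply: contraNN fi => Fi.
  by rewrite -ev0 /ev nth_default // rmorph0.
have [C C0 CL] := meval_lipschitz0 F`_i.
have /boolp.choice[D DP] : forall l, exists d, 0 <= d /\
    forall y, (forall j, normc (y j) <= 1) -> normc (mpoly.meval y F`_l) <= d.
  by move=> l; have [d d0 dP] := meval_bounded F`_l (@ler01 R); exists d.
pose S := \sum_(l < size F) D l.
have S0 : 0 <= S by apply: sumr_ge0 => l _; case: (DP l).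
pose a := normc (ev 0 i).
have a0 : 0 < a.
  rewrite lt_neqAle normc_ge0 andbT eq_sym; apply: contraNneq fi => /Normc.eq0_normc.
  by rewrite ev0 => ->.
have CS : 0 < C + S + 1 by rewrite ltr_wpDl // addr_ge0.
(* The losses [C * e] in the leading coefficient and [S * t] from the higher terms together stay
   below [a / 4], so [a / 2] remains; the summand 1 keeps the divisor positive. *)
pose e := Order.min 1 (a / 4 / (C + S + 1)).
have e0 : 0 < e by rewrite lt_min ltr01 !divr_gt0.
have e1 : e <= 1 by rewrite ge_min lexx.
have eb : e * (C + S + 1) <= a / 4.
  by rewrite -ler_pdivlMr // ge_min lexx orbT.
exists e, (a / 2); split=> //; first by rewrite divr_gt0.
move=> y t ye t0 te.
have -> : mpoly.meval (fun j => ((w + M *m y) + rc t *: (v + N *m y)) j 0) f =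
    \sum_(l < size F) ev y l * rc t ^+ l.
  transitivity (along (w + M *m y) (v + N *m y) f).[rc t].
    by rewrite horner_along; apply: mpoly.meval_eq => j; rewrite !mxE.
  rewrite -FE (horner_coef_wide _ (size_poly _ _)); apply: eq_bigr => l _.
  by rewrite coef_map.
rewrite (bigD1 (Ordinal iF)) //= (le_trans _ (normc_sub_le _ _)) //.
rewrite Normc.normcM normc_exp normc_rc ?(ltW t0) //.
have ti0 : 0 < t ^+ i by rewrite exprn_gt0.
have t1 : t <= 1 := le_trans te e1.
have tail : normc (\sum_(l < size F | l != Ordinal iF) ev y l * rc t ^+ l) <= S * t * t ^+ i.
  rewrite -big_filter (le_trans (le_normc_sum _ _)) // big_filter.
  rewrite /S !mulr_suml [leRHS](bigD1 (Ordinal iF)) //= ler_wpDl //.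
    by rewrite !mulr_ge0 ?(ltW t0) ?(ltW ti0) //; case: (DP i).
  apply: ler_sum => l li; rewrite Normc.normcM normc_exp normc_rc ?(ltW t0) //.
  have [d0 dP] := DP l; case: (ltngtP l i) => [lti|gti|eqi].
  - rewrite -evE low // Normc.normc0 mul0r !mulr_ge0 ?(ltW t0) ?(ltW ti0) //.
  - rewrite -mulrA; apply: ler_pM; rewrite ?normc_ge0 ?exprn_ge0 ?(ltW t0) //.
      by apply: dP => j; apply: le_trans (ye j) e1.
    by rewrite -exprS ler_wiXn2l // ltW.
  - by move: li; rewrite -val_eqE /= eqi eqxx.
have head : a - C * e <= normc (ev y i).
  have := CL e (fun j => y j 0) (ltW e0) e1 ye.
  rewrite /a -[ev 0 i](subrK (ev y i)) lerBlDr => h.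
  rewrite (le_trans (le_normcD _ _)) // addrC lerD2l -normcN opprB.
  apply: le_trans h; rewrite le_eqVlt; apply/orP; left; apply/eqP.
  by congr (normc (_ - _)); apply: mpoly.meval_eq => j; rewrite mxE.
apply: (@le_trans _ _ ((a - C * e) * t ^+ i - S * t * t ^+ i)); last first.
  by apply: lerB => //; rewrite ler_wpM2r // ltW.
rewrite -mulrBl ler_wpM2r ?(ltW ti0) //.
have Ste : S * t <= S * e by rewrite ler_wpM2l.
have : e * C + e * S <= a / 4.
  by apply: le_trans eb; rewrite !mulrDr lerDl mulr1 ltW.
move: Ste; rewrite (mulrC e C) (mulrC e S); move: a0; move: (S * t) (S * e) (C * e) => x1 x2 x3.
lra.
Qed.

Lemma pid_mulE r (y : 'cV[K]_n) i :
  (pid_mx r *m y) i 0 = if (i < r)%N then y i 0 else 0.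
Proof.
rewrite mxE (bigD1 i) //= big1 ?addr0 => [|j ji].
  by rewrite mxE eqxx /=; case: ifP => _; rewrite ?mul1r ?mul0r.
by rewrite mxE [_ == _]val_eqE eq_sym (negPf ji) mul0r.
Qed.

Definition slab r (t d : R) (i : 'I_n) : R := if (i < r)%N then t * d else d.

(** Each of the [r] thin coordinates is complex and contributes [t^2] to the volume. *)
Lemma slab_measure (Psi : 'M[K]_n) r : Psi \in unitmx -> (r <= n)%N ->
  exists2 c : R, 0 < c & forall (b : 'cV[K]_n) t d, 0 < t -> 0 < d ->
    m [set x | cbox (slab r t d) (clin Psi (cshift (- b) x))] =
      (c * ((4 * d ^+ 2) ^+ n * t ^+ (2 * r)))%:E.
Proof.
move=> uP rn; have [c c0 cE] := clin_measure uP.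
exists c => // b t d t0 d0; have [mb pb] := preserving_cshift (- b).
rewrite (_ : [set x | _] = cshift (- b) @^-1` (clin Psi @^-1` cbox (slab r t d))) //.
rewrite pb; last by apply: measurable_preimage; [exact: measurable_clin | exact: measurable_cbox].
rewrite cE; last exact: measurable_cbox.
rewrite lebesgueC_box => [|i]; last by rewrite /slab; case: ifP => _; rewrite ?mulr_ge0 // ltW.
rewrite -EFinM; congr ((_ * _)%:E).
transitivity (\prod_(i < n) ((4 * d ^+ 2) * (if (i < r)%N then t ^+ 2 else 1))).
  apply: eq_bigr => i _; rewrite /slab; case: ifP => _; last by rewrite mulr1.
  by rewrite exprMn; ring.
rewrite big_split /= prodr_const card_ord; congr (_ * _).
rewrite -big_mkcond /= -(big_ord_widen _ (fun _ => t ^+ 2)) // prodr_const card_ord.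
by rewrite exprM.
Qed.

(** Dividing the first [r] coordinates by [t] turns the box into one independent of [t]. Its points
    thus lie on perturbed lines: the base point moves in the last [n - r] coordinates, the direction
    in the first [r]. The bound [2 * d] adds real and imaginary parts. *)
Lemma slab_param (Psi : 'M[K]_n) r (w v : 'cV[K]_n) t d (x : cspace R n) :
  Psi \in unitmx -> 0 < t -> 0 <= d ->
  cbox (slab r t d) (clin Psi (cshift (- (w + rc t *: v)) x)) ->
  exists2 y : 'cV[K]_n, (forall j, normc (y j 0) <= 2 * d) &
    cvec x = (w + (invmx Psi *m copid_mx r) *m y)
       + rc t *: (v + (invmx Psi *m pid_mx r) *m y).
Proof.
move=> uP t0 d0 xb; pose y' := Psi *m (cvec x - (w + rc t *: v)).
have tn0 : rc t != 0.
  by apply/eqP => t00; have := normc_rc (ltW t0); rewrite t00 Normc.normc0 => te; rewrite -te ltxx in t0.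
pose y : 'cV[K]_n := \col_i (if (i < r)%N then (rc t)^-1 * y' i 0 else y' i 0).
exists y => [j|].
  have /cboxP/(_ j) := xb; rewrite /clin ccoord_cpt /cshift cptK -/y' [y j 0]mxE /slab.
  have := normc_le_ReIm (y' j 0); case: ifP => _ le1 [re im].
    rewrite Normc.normcM Normc.normcV normc_rc ?(ltW t0) // ler_pdivrMl //.
    by move: le1 re im; rewrite mulrCA; move: (normc _) (`|_|) (`|_|) (t * d) => *; lra.
  by move: le1 re im; move: (normc _) (`|_|) (`|_|) => *; lra.
have yE : copid_mx r *m y + rc t *: (pid_mx r *m y) = y'.
  rewrite mulmxBl mul1mx; apply/colP => i.
  have entry (p q : 'cV[K]_n) s : (p - q + s *: q) i 0 = p i 0 - q i 0 + s * q i 0.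
    by rewrite !mxE.
  rewrite entry pid_mulE [y i 0]mxE; case: ifP => _; last by rewrite subr0 mulr0 addr0.
  by rewrite subrr add0r mulrA mulfV // mul1r.
rewrite scalerDr addrACA -!mulmxA scalemxAr -mulmxDr yE /y' mulKmx //.
by rewrite addrC subrK.
Qed.

End Scaling.

Section Necessity.
Variables (R : realType) (n : nat).
Local Notation m := (lebesgueC R n).
Local Notation K := (R[i]).
Implicit Types (A : seq 'rV[K]_n) (w v y : 'cV[K]_n).

Lemma form_bound (a : 'rV[K]_n) y T : 0 <= T -> (forall j, normc (y j 0) <= T) ->
  normc ((a *m y) 0 0) <= cnorm1 a * T.
Proof. exact: normc_mulmx. Qed.

Lemma prodl_upper_bound A (p : pred 'rV[K]_n) (G t : R) x : 0 <= G -> 0 <= t ->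
  {in A, forall a, normc (form_val a x) <= G} ->
  {in [seq a <- A | p a], forall a, normc (form_val a x) <= t * G} ->
  normc (mpoly.meval (ccoord x) (prodl A)) <=
    G ^+ size A * t ^+ size [seq a <- A | p a].
Proof.
move=> G0 t0; rewrite normc_prodl.
elim: A => [|a A IH] hA hZ; first by rewrite big_nil mulr1.
have IHa : \prod_(b <- A) normc (form_val b x) <= G ^+ size A * t ^+ size [seq b <- A | p b].
  apply: IH => b bA; first by apply: hA; rewrite in_cons bA orbT.
  by apply: hZ; rewrite /=; case: (p a) => //; rewrite in_cons bA orbT.
have P0 : 0 <= \prod_(b <- A) normc (form_val b x).
  by apply: prodr_ge0 => b _; exact: normc_ge0.
rewrite big_cons /=; case: (boolP (p a)) hZ => pa hZ /=.
  have ha := hZ a; rewrite /= pa mem_head in ha.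
  rewrite !exprS mulrACA [G * t]mulrC; apply: ler_pM; rewrite ?normc_ge0 //.
  exact: ha.
by rewrite exprS -mulrA; apply: ler_pM; rewrite ?normc_ge0 // hA ?mem_head.
Qed.

Lemma ler_sum_term (I : eqType) (r : seq I) (F : I -> R) k : k \in r ->
  (forall l, 0 <= F l) -> F k <= \sum_(l <- r) F l.
Proof. by move=> kr F0; rewrite (big_rem k) //= lerDl sumr_ge0. Qed.

Lemma small_factor (L e q : R) : 0 <= L -> 0 < e -> 0 < q ->
  exists d, [/\ 0 < d, d <= e & L * d <= q].
Proof.
move=> L0 e0 q0; have L1 : 0 < L + 1 by rewrite ltr_wpDl.
exists (Order.min e (q / (L + 1))); split.
- by rewrite lt_min e0 divr_gt0.
- by rewrite ge_min lexx.
have d0 : 0 < Order.min e (q / (L + 1)) by rewrite lt_min e0 divr_gt0.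
have : Order.min e (q / (L + 1)) * (L + 1) <= q by rewrite -ler_pdivlMr // ge_min lexx orbT.
by move: (Order.min _ _) d0 => d d0; lra.
Qed.

(** In the coordinates given by [row_ebase (sp A)] the forms of [A] involve only the first [rk A]
    coordinates, so the remaining ones run along the flat. *)
Lemma form_pid_copid A a : a \in A ->
  a *m (invmx (row_ebase (sp A)) *m copid_mx (rk A)) = 0.
Proof.
move=> /mem_sp/submxP[D ->]; rewrite -{1}(mulmx_ebase (sp A)) -!mulmxA.
rewrite (mulmxA (row_ebase _)) mulmxV ?row_ebase_unit // mul1mx.
by rewrite mul_pid_mx_copid ?rank_leq_row // !mulmx0.
Qed.

Section Estimate.
Variables (A : seq 'rV[K]_n) (p : pred 'rV[K]_n).
Let Z := [seq a <- A | p a].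
Variables (f : mpoly.mpoly n K) (w v : 'cV[K]_n) (i : nat) (c : rat) (rho : R).
Hypotheses (c0 : 0 < c) (rho0 : 0 < rho).
Hypothesis wZ : {in Z, forall a, a *m w = 0}.
Hypothesis coef_low : forall l w' v', (l < i)%N -> {in Z, forall a, a *m w' = 0} ->
  (along w' v' f)`_l = 0.
Hypothesis coef_i : (along w v f)`_i != 0.

Let h (x : cspace R n) : R := normc (mpoly.meval (ccoord x) f) ^+ 2
  / normc (mpoly.meval (ccoord x) (prodl A)) `^ (2 * ratr c).

(* [P] is a box around [w + t v], of size [t] in the directions transverse to the
   flat of [Z] and of fixed size along it. *)
Lemma slab_lower_bound : exists e d eta G c1 : R,
  [/\ 0 < e, 0 < d, 0 < eta, 0 < G & 0 < c1 /\ forall t, 0 < t <= e ->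
    exists P : set (cspace R n),
    [/\ measurable P, P `<=` polydisc (cpt w) rho,
        m P = (c1 * ((4 * d ^+ 2) ^+ n * t ^+ (2 * rk Z)))%:E &
        forall x, P x -> normc (mpoly.meval (ccoord x) (prodl A)) != 0 ->
          (eta * t ^+ i) ^+ 2 / (G ^+ size A * t ^+ size Z) `^ (2 * ratr c) <= h x]].
Proof.
pose Psi := row_ebase (sp Z); have uP : Psi \in unitmx := row_ebase_unit _.
pose M1 := invmx Psi *m copid_mx (rk Z); pose M2 : 'M[K]_n := invmx Psi *m pid_mx (rk Z).
have aM1 : {in Z, forall a, a *m M1 = 0} by move=> a; exact: form_pid_copid.
have wZ' y : {in Z, forall a, a *m (w + M1 *m y) = 0}.
  by move=> a aZ; rewrite mulmxDr wZ // mulmxA aM1 // mul0mx addr0.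
have low l y : (l < i)%N -> (along (w + M1 *m y) (v + M2 *m y) f)`_l = 0.
  by move=> li; apply: coef_low.
have [e [eta [e0 e1 eta0 lower]]] := along_lower_bound low coef_i.
have [c1 c10 slabm] := slab_measure uP (rank_leq_col (sp Z)).
pose L := cnorm1 M1; have L0 : 0 <= L := cnorm1_ge0 _.
pose V := \sum_j normc (v j 0) + cnorm1 M2.
have V0 : 0 <= V by rewrite addr_ge0 ?cnorm1_ge0 // sumr_ge0 // => j _; exact: normc_ge0.
pose T := polydisc_radius (cpt w) rho; have T0 : 0 <= T := polydisc_radius_ge0 _ _.
have TV0 : 0 <= T + V := addr_ge0 T0 V0.
(* [T] bounds the coordinates on the polydisc and [V] those of the perturbed direction. Thus [G]
   bounds all forms on the box, and [t * G] those of [Z]. *)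
pose G := \sum_(a <- A) cnorm1 a * (T + V) + 1.
have GA : {in A, forall a, cnorm1 a * (T + V) <= G}.
  move=> a aA; apply: ler_wpDr; first exact: ler01.
  apply: (ler_sum_term (F := fun a => cnorm1 a * (T + V))) => // b.
  by rewrite mulr_ge0 // cnorm1_ge0.
have G0 : 0 < G.
  rewrite ltr_wpDl // sumr_ge0 // => b _; by rewrite mulr_ge0 // cnorm1_ge0.
have r4 : 0 < rho / 4 by rewrite divr_gt0.
have e20 : 0 < e / 2 by rewrite divr_gt0.
have r8 : 0 < rho / 8 by rewrite divr_gt0.
(* The coordinates of [y] reach [2 * d], so [d] must meet half of each bound. The displacement from
   [w] is then at most [rho / 4] along the flat and, by the choice of [e'], at most [rho / 4] along
   the direction. *)
have [d [d0 de' dL']] := small_factor L0 e20 r8.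
have de : 2 * d <= e by lra.
have dL : L * (2 * d) <= rho / 4 by lra.
have [e' [e'0 e'e e'V]] := small_factor V0 e0 r4.
exists e', d, eta, G, c1; split=> //; split=> // t /andP[t0 te'].
have te : t <= e := le_trans te' e'e.
have tV : t * V <= rho / 4.
  by rewrite mulrC (le_trans _ e'V) // ler_wpM2l.
pose P := [set x | cbox (slab (rk Z) t d) (clin Psi (cshift (- (w + rc t *: v)) x))].
have param x : P x -> exists2 y : 'cV[K]_n, (forall j, normc (y j 0) <= 2 * d) &
    cvec x = (w + M1 *m y) + rc t *: (v + M2 *m y).
  by move=> Px; exact: (slab_param uP t0 (ltW d0) Px).
have Vb y : (forall j, normc (y j 0) <= 2 * d) -> forall j, normc ((v + M2 *m y) j 0) <= V.
  move=> yd j; rewrite mxE (le_trans (le_normcD _ _)) //; apply: lerD.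
    by rewrite (bigD1 j) //= lerDl sumr_ge0 // => k _; exact: normc_ge0.
  rewrite -[leRHS]mulr1; apply: normc_mulmx => // k.
  by rewrite (le_trans (yd k)) // (le_trans de).
have Pball : P `<=` polydisc (cpt w) rho.
  move=> x /param[y yd xE] j.
  have -> : ccoord x j - ccoord (cpt w) j = (M1 *m y) j 0 + rc t * (v + M2 *m y) j 0.
    have -> : ccoord x j = cvec x j 0 by rewrite mxE.
    have entry (q1 q2 q3 : 'cV[K]_n) s : (q1 + q2 + s *: q3) j 0 - q1 j 0 = q2 j 0 + s * q3 j 0.
      by rewrite !mxE [LHS]addrC -addrA addKr.
    by rewrite ccoord_cpt xE entry.
  apply: (le_lt_trans (le_normcD _ _)).
  have b1 : normc ((M1 *m y) j 0) <= rho / 4.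
    by apply: le_trans dL; apply: normc_mulmx => //; rewrite mulr_ge0 // ltW.
  have b2 : normc (rc t * (v + M2 *m y) j 0) <= rho / 4.
    rewrite Normc.normcM normc_rc ?(ltW t0) //; apply: le_trans tV.
    by rewrite ler_wpM2l ?(ltW t0) // Vb.
  by move: (normc _) (normc _) b1 b2 rho0 => b1 b2; lra.
exists P; split=> //.
- rewrite (_ : P = cshift (- (w + rc t *: v)) @^-1` (clin Psi @^-1` cbox (slab (rk Z) t d))) //.
  have [mb _] := preserving_cshift (- (w + rc t *: v)).
  apply: measurable_preimage => //; apply: measurable_preimage; first exact: measurable_clin.
  exact: measurable_cbox.
- exact: slabm.
move=> x Px g0; have [y yd xE] := param _ Px.
have fx : eta * t ^+ i <= normc (mpoly.meval (ccoord x) f).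
  have -> : mpoly.meval (ccoord x) f = mpoly.meval
      (fun j => ((w + M1 *m y) + rc t *: (v + M2 *m y)) j 0) f.
    by apply: mpoly.meval_eq => j; rewrite -xE mxE.
  by apply: lower => // j; apply: le_trans (yd j) de.
have gx : normc (mpoly.meval (ccoord x) (prodl A)) <= G ^+ size A * t ^+ size Z.
  apply: prodl_upper_bound => [|||a aZ]; rewrite ?(ltW G0) ?(ltW t0) //.
    move=> a aA; apply: le_trans (GA _ aA).
    apply: (@le_trans _ _ (cnorm1 a * T)); last by rewrite ler_wpM2l ?cnorm1_ge0 // lerDl.
    apply: form_bound => // j; rewrite mxE; exact: (polydisc_bounded j (Pball _ Px)).
  have aA : a \in A by move: aZ; rewrite mem_filter => /andP[].
  rewrite /form_val xE mulmxDr wZ' // add0r -scalemxAr mxE Normc.normcM normc_rc ?(ltW t0) //.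
  rewrite ler_wpM2l ?(ltW t0) //; apply: le_trans (GA _ aA).
  apply: (@le_trans _ _ (cnorm1 a * V)); last by rewrite ler_wpM2l ?cnorm1_ge0 // lerDr.
  by apply: form_bound => // j; apply: Vb.
have gx0 : 0 < normc (mpoly.meval (ccoord x) (prodl A)) by rewrite lt_neqAle eq_sym g0 normc_ge0.
have c20 : 0 <= 2 * ratr c :> R by rewrite mulr_ge0 // ler0q ltW.
rewrite /h; apply: ler_pM.
- by rewrite sqr_ge0.
- by rewrite invr_ge0 powR_ge0.
- by rewrite lerXn2r ?nnegrE ?normc_ge0 // mulr_ge0 ?exprn_ge0 ?ltW.
rewrite lef_pV2 ?posrE ?powR_gt0 //; last by rewrite (lt_le_trans gx0).
by apply: ge0_ler_powR; rewrite ?nnegrE ?normc_ge0 // mulr_ge0 ?exprn_ge0 ?ltW.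
Qed.

End Estimate.
End Necessity.

(** Markov's inequality with an exceptional null set: the lower bound on the quotient holds only
    where the denominator is nonzero, since division by 0 yields 0. *)
Lemma markov_off_null d (T : measurableType d) (R : realType)
    (mu : {measure set T -> \bar R}) (D P N : set T) (h : T -> R) (k : R) :
  measurable D -> measurable P -> measurable N -> mu N = 0%E -> P `<=` D ->
  0 <= k -> (forall x, 0 <= h x) -> (forall x, P x -> ~ N x -> k <= h x) ->
  measurable_fun setT h ->
  (k%:E * mu P <= \int[mu]_(x in D) (h x)%:E)%E.
Proof.
move=> mD mP mN N0 PD k0 h0 kh mh.
have mPN : measurable (P `\` N) by exact: measurableD.
have mhE : measurable_fun setT (EFin \o h) by exact/measurable_EFinP.
have PN : (mu P <= mu (P `\` N))%E.
  rewrite -(measureU0 mPN mN N0); apply: le_measure; rewrite ?inE //.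
    exact: measurableU.
  by move=> x Px; have [Nx|Nx] := pselect (N x); [right | left].
apply: (@le_trans _ _ (k%:E * mu (P `\` N))%E); first exact: lee_wpmul2l.
rewrite -integral_cst //; apply: (@le_trans _ _ (\int[mu]_(x in P `\` N) (h x)%:E)%E).
  apply: ge0_le_integral => //; first exact: measurable_funTS.
  by move=> x [Px Nx]; rewrite lee_fin; exact: kh.
apply: ge0_subset_integral => //; first exact: measurable_funTS.
  by move=> x _; rewrite lee_fin.
by move=> x [Px _]; exact: PD.
Qed.

(** Collects the powers of [t]: [2 i] from the numerator, [q s] from the denominator and [2 r] from
    the volume. *)
Lemma slab_scaling (R : realType) (eta G t q c D : R) i r s : 0 < t -> 0 < G ->
  (eta * t ^+ i) ^+ 2 / (G * t ^+ s) `^ q * (c * (D * t ^+ (2 * r))) =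
  eta ^+ 2 / G `^ q * (c * D) * t `^ (- (q * s%:R - (2 * i)%:R - (2 * r)%:R)).
Proof.
move=> t0 G0.
have -> : (G * t ^+ s) `^ q = G `^ q * t `^ (q * s%:R).
  by rewrite powRM ?exprn_ge0 ?(ltW G0) ?(ltW t0) // -[t ^+ _]powR_mulrn ?(ltW t0) // -powRrM [s%:R * q]mulrC.
have -> : t `^ (- (q * s%:R - (2 * i)%:R - (2 * r)%:R)) =
    t ^+ (2 * i) * t ^+ (2 * r) / t `^ (q * s%:R).
  rewrite -!powR_mulrn ?(ltW t0) // -powRN -!powRD ?(gt_eqF t0) ?implybT //.
  by congr (_ `^ _); ring.
rewrite exprMn -exprM [(i * 2)%N]mulnC.
have Gn : G `^ q != 0 by rewrite gt_eqF // powR_gt0.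
have tn : t `^ (q * s%:R) != 0 by rewrite gt_eqF // powR_gt0.
move: (G `^ _) (t `^ _) Gn tn (t ^+ _) (t ^+ _) => x1 x2 x1n x2n x3 x4.
by field; rewrite x1n x2n.
Qed.

Section Necessity.
Variables (R : realType) (n : nat).
Local Notation m := (lebesgueC R n).
Local Notation K := (R[i]).

Lemma not_integrable (A : seq 'rV[K]_n) (p : pred 'rV[K]_n) f (w v : 'cV[K]_n) i
    (c : rat) (rho : R) :
  let Z := [seq a <- A | p a] in
  all (fun a => a != 0) A -> 0 < c -> 0 < rho -> {in Z, forall a, a *m w = 0} ->
  (forall l w' v', (l < i)%N -> {in Z, forall a, a *m w' = 0} ->
    (along w' v' f)`_l = 0) ->
  (along w v f)`_i != 0 -> (i + rk Z < size Z)%N -> (1 - c) * (size Z)%:R < 1 ->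
  ~ m.-integrable (polydisc (cpt w) rho)
      (EFin \o (fun x : cspace R n => normc (mpoly.meval (ccoord x) f) ^+ 2
        / normc (mpoly.meval (ccoord x) (prodl A)) `^ (2 * ratr c))).
Proof.
move=> Z A0 c0 rho0 wZ low fi iZ cZ hint.
have [e [d [eta [G [c1 [e0 d0 eta0 G0 [c10 slabP]]]]]]] :=
  slab_lower_bound c0 rho0 wZ low fi.
pose h (x : cspace R n) := normc (mpoly.meval (ccoord x) f) ^+ 2
        / normc (mpoly.meval (ccoord x) (prodl A)) `^ (2 * ratr c).
have h0 x : 0 <= h x by rewrite divr_ge0 ?sqr_ge0 ?powR_ge0.
have mh : measurable_fun setT h := multiplier_integrand_measurable c f (prodl A).
have mD := measurable_polydisc (cpt w) rho.
pose I := (\int[m]_(x in polydisc (cpt w) rho) (h x)%:E)%E.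
have Ifin : I \is a fin_num.
  exact: (integrable_fin_num mD hint).
pose q : R := 2 * ratr c.
have q0 : 0 < q by rewrite mulr_gt0 // ltr0q.
pose kappa : R := q * (size Z)%:R - (2 * i)%:R - (2 * rk Z)%:R.
have kappa0 : 0 < kappa.
  have : (i + rk Z)%:R + 1 < ratr c * (size Z)%:R + 1 :> R.
    rewrite ltrD2r.
    have h1 : (i + rk Z).+1%:R <= (size Z)%:R :> R by rewrite ler_nat.
    have h2 : (1 - ratr c) * (size Z)%:R < 1 :> R.
      have : ratr ((1 - c) * (size Z)%:R) < ratr 1 :> R by rewrite ltr_rat.
      by rewrite rmorphM rmorphB rmorph1 rmorph_nat [ratr 1]rmorph1.
    by move: h1 h2; rewrite -natr1; lra.
  by rewrite /kappa /q natrD !natrM; lra.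
pose C0 := eta ^+ 2 / (G ^+ size A) `^ q * (c1 * (4 * d ^+ 2) ^+ n).
have C00 : 0 < C0.
  rewrite mulr_gt0 ?divr_gt0 ?powR_gt0 ?exprn_gt0 // mulr_gt0 // exprn_gt0 //.
  by rewrite mulr_gt0 // exprn_gt0.
(* [t] is so small that the bound on the box exceeds the supposedly finite integral. *)
have [t /andP[t0 te]] := powR_neg_unbounded (fine I) kappa0 C00 e0.
apply/negP; rewrite -leNgt.
have [|P [mP PD Pm Ph]] := slabP t; first by rewrite t0.
set k := _ / _ in Ph.
have k0 : 0 <= k by rewrite divr_ge0 ?sqr_ge0 ?powR_ge0.
pose N := [set x : cspace R n | normc (mpoly.meval (ccoord x) (prodl A)) = 0].
have mN : measurable N.
  rewrite (_ : N = (fun x => normc (mpoly.meval (ccoord x) (prodl A))) @^-1` [set 0]) //.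
  by apply: measurable_preimage => //; exact: measurable_normc_meval.
have kh x : P x -> ~ N x -> k <= h x.
  by move=> Px Nx; apply: Ph => //; apply/eqP.
have : ((k * (c1 * ((4 * d ^+ 2) ^+ n * t ^+ (2 * rk Z))))%:E <= I)%E.
  by rewrite EFinM -Pm; exact: markov_off_null mD mP mN (prodl_null A0) PD k0 h0 kh mh.
rewrite -(fineK Ifin) lee_fin; apply: le_trans.
rewrite le_eqVlt; apply/orP; left; apply/eqP.
by rewrite /C0 /k -/q /kappa slab_scaling // exprn_gt0.
Qed.

(** The order [i] is minimal over all points of the flat cut out by [Z], not only at [w], so the
    lower coefficients vanish along the whole flat, as the bound on a box requires. The minimum may
    be reached at another point [w'], where more forms may vanish, while [Z] keeps only the forms
    through [w]. *)
Lemma multiplier_nullity_ideal (A : seq 'rV[K]_n) (c : rat) f :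
  all (fun a => a != 0) A -> 0 < c -> (1 - c) * (size A)%:R < 1 -> c <= 1 ->
  multiplier_ideal c (prodl A) f -> nullity_ideal A f.
Proof.
move=> A0 c0 cA c1 fm w v.
apply/dvdXnP => i0 i0n.
apply: contrapT => /eqP fi0.
pose Z := through w A.
pose bad i := `[< exists w' v', {in Z, forall a, a *m w' = 0} /\ (along w' v' f)`_i != 0 >].
have ex : exists i, bad i.
  exists i0; apply/asboolP; exists w, v; split=> // a.
  by rewrite mem_filter => /andP[/eqP].
have [i /asboolP[w' [v' [wZ fi]]] imin] := ex_minnP ex.
have ii0 : (i <= i0)%N.
  apply: imin; apply/asboolP; exists w, v; split=> // a.
  by rewrite mem_filter => /andP[/eqP].
have [rho rho0 hint] := fm (cpt w').
apply: (@not_integrable A (fun a => a *m w == 0) f w' v' i c rho) hint => //.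
- move=> l w2 v2 li w2Z; apply/eqP; apply: contraTT li => nz; rewrite -leqNgt.
  by apply: imin; apply/asboolP; exists w2, v2.
- by have := leq_ltn_trans ii0 i0n; rewrite /nullity ltn_subRL addnC.
apply: le_lt_trans cA; rewrite ler_wpM2l ?subr_ge0 // ler_nat size_filter.
exact: count_size.
Qed.

End Necessity.

End Analysis.
Import Analysis.

Local Open Scope ring_scope.

(** * Comparison of graded pieces and the Hilbert series *)

Lemma form_row_neq0 (K : fieldType) (V : vectType K) n (e : n.-tuple V) (H : {vspace V}) :
  basis_of {:V} e -> is_hyperplane H -> form_row e H != 0.
Proof.
move=> he hH; apply: contraTneq (hH) => a0.
suff -> : H = fullv by rewrite /is_hyperplane -[X in _ == X]addn0 -addn1 eqn_add2l.
by apply/vspaceP => v; rewrite memvf (form_row_coord he) // a0 mul0mx eqxx.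
Qed.

(** In the integrable direction homogeneity turns the vanishing conditions into products of forms;
    the resulting bound holds on every polydisc, so the radius 1 is arbitrary. *)
Lemma multiplier_ideal_graded (R : realType) n (A : seq 'rV[R[i]]_n) (c : rat) j f :
  all (fun a => a != 0) A -> 0 < c -> c < 1 -> (1 - c) * (size A)%:R < 1 ->
  graded_piece (nullity_ideal A) j f <-> graded_piece (multiplier_ideal c (prodl A)) j f.
Proof.
move=> A0 c0 c1 cA; split=> -[fA fj]; split=> //.
  move=> z; exists 1; first exact: ltr01.
  exact: cobasis_span_integrable (nullity_ideal_cobasis_span fj fA).
exact: multiplier_nullity_ideal A0 c0 cA (ltW c1) fA.
Qed.

Theorem corollary1p2 (R : realType) (V : vectType R[i]) (n d : nat)
    (e : n.-tuple V) (he : basis_of {:V} e)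
    (A : d.-tuple {vspace V}) (hA : is_arrangement A) :
  exists2 eps0 : rat, 0 < eps0 &
    forall eps : rat, 0 < eps < eps0 ->
      exists2 H : nat -> nat,
        is_hilbert_series
          (multiplier_ideal (1 - eps) (arrangement_poly e A)) H &
        let t : {fraction {poly int}} := tofrac 'X in
        is_expansion
          (t ^+ d / (1 - t) ^+ n
             * (map_poly intr (poincare_poly A)).[t^-1 - 1])
          (fun j => (H j)%:Z).
Proof.
have /andP[_ hyp] := hA.
have d0 : 0 < d.+1%:R :> rat by rewrite ltr0n.
(* [eps < 1 / (d + 1)] gives [eps < 1], also when [d = 0], and [eps * d < 1], the divergence
   condition for every sublist of the forms. *)
exists d.+1%:R^-1 => [|eps /andP[eps0]]; first by rewrite invr_gt0.
rewrite -div1r ltr_pdivlMr // => epsd.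
have eps1 : eps < 1.
  by apply: le_lt_trans epsd; rewrite ler_peMr ?(ltW eps0) // ler1n.
have epsd' : eps * d%:R < 1.
  by apply: le_lt_trans epsd; rewrite ler_wpM2l ?(ltW eps0) // ler_nat.
rewrite arrangement_polyE; set B := map _ _.
have B0 : all (fun a => a != 0) B.
  by rewrite all_map; apply/allP => H /(allP hyp); exact: form_row_neq0.
have [H HB HE] := hilbert_nullity_ideal B; exists H => [j|t].
  apply: eq_has_dim (HB j) => f; apply: multiplier_ideal_graded => //.
  - by rewrite subr_gt0.
  - by rewrite gtrBl.
  - by rewrite opprB addrC subrK size_map size_tuple.
exists (whitney B), ((1 - 'X) ^+ n); split.
- by rewrite -horner_coef0 !hornerE expr1n oner_eq0.
- exact: poincare_whitney.
move=> k; rewrite -HE coefM; apply: eq_bigr => i _.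
by rewrite coef_poly ltnS leq_subr.
Qed.
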